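(* Let $\mathcal{T}=(V,E)$ be a rootless directed tree with $\operatorname{Br}(\mathcal{T})=1$, and let $S_{\underline\lambda}$ be a bounded weighted shift on $\mathcal{T}$ with positive weights. (i) If $\mathcal{T}$ has exactly two leaves, then $S_{\underline\lambda}$ is cyclic. (ii) Suppose $\mathcal{T}$ has exactly one leaf; then (up to relabeling) $V=\mathbb{Z}\cup\{1',\dots,k_0'\}$ with $k_0\in\mathbb{N}$ and $E=\{(j-1,j):j\in\mathbb{Z}\}\cup\{(0,1')\}\cup\{((j-1)',j'):1<j\le k_0\}$. Then $S_{\underline\lambda}$ is cyclic if and only if the bilateral weighted shift $W$ on $\ell^2(\mathbb{Z})$, $We_n=\lambda_{n+1}e_{n+1}$, is cyclic. In particular, if $S_{\underline\lambda}$ is a contraction not of class $C_{\cdot0}$, then $S_{\underline\lambda}$ is cyclic. (iii) If $S_{\underline\lambda}$ is a contraction of class $C_{1\cdot}$, then $S_{\underline\lambda}$ has no cyclic vectors. (iv) Let $\widetilde{\mathcal{T}}$ be the directed tree with vertices $\mathbb{Z}\cup\{k':k\in\mathbb{N}\}$ and edges $(j-1,j)$ ($j\in\mathbb{Z}$), $(0,1')$, $((k-1)',k')$ ($k\ge2$). There exists a cyclic bounded weighted shift with positive weights on $\widetilde{\mathcal{T}}$.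
   Context: A directed graph $(V,E)$ with $E\subseteq V\times V$ minus the diagonal is a directed tree if it is connected (as an undirected graph), each vertex has at most one parent (a $u$ with $(u,v)\in E$), and it has no directed circuit. $\operatorname{Chi}(u)=\{v:(u,v)\in E\}$; $\operatorname{par}(v)$ is the parent of $v$; a root is a vertex without parent; a leaf is a vertex without children. The branching index is $\operatorname{Br}(\mathcal{T})=\sum_{u\text{ not a leaf}}(\#\operatorname{Chi}(u)-1)$. Given weights $\underline\lambda=\{\lambda_v:v\in V\text{ not the root}\}$ with $\sup_u\sum_{v\in\operatorname{Chi}(u)}|\lambda_v|^2<\infty$, the weighted shift $S_{\underline\lambda}$ on $\ell^2(V)$ (with orthonormal basis $\{e_u\}$) is $S_{\underline\lambda}e_u=\sum_{v\in\operatorname{Chi}(u)}\lambda_ve_v$. An operator $T$ is cyclic if $\bigvee\{T^nh:n\ge0\}$ is the whole space for some $h$. For a contraction $T$, $\mathcal{H}_0(T)=\{x:\|T^nx\|\to0\}$; $T$ is of class $C_{1\cdot}$ if $\mathcal{H}_0(T)=\{0\}$ and of class $C_{\cdot0}$ if $T^{*n}x\to0$ for all $x$. *)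

(* Defs.v *)
From Stdlib Require Export Reals List ZArith Relations ClassicalEpsilon.
Export ListNotations.
Open Scope R_scope.

Definition C := (R * R)%type.
Definition C0 : C := (0, 0).
Definition Cadd (a b : C) : C := (fst a + fst b, snd a + snd b).
Definition Copp (a : C) : C := (- fst a, - snd a).
Definition Cmul (a b : C) : C :=
  (fst a * fst b - snd a * snd b, fst a * snd b + snd a * fst b).
Definition Cconj (a : C) : C := (fst a, - snd a).
Definition RtoC (r : R) : C := (r, 0).
Definition Cnorm2 (a : C) : R := fst a * fst a + snd a * snd a.

Definition vec (V : Type) := V -> C.
Definition vzero {V : Type} : vec V := fun _ => C0.
Definition vadd {V : Type} (x y : vec V) : vec V := fun v => Cadd (x v) (y v).
Definition vsub {V : Type} (x y : vec V) : vec V := fun v => Cadd (x v) (Copp (y v)).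
Definition vscale {V : Type} (c : C) (x : vec V) : vec V := fun v => Cmul c (x v).

Definition sumR {V : Type} (f : V -> R) (l : list V) : R :=
  fold_right (fun v acc => f v + acc) 0 l.
Definition sumC {V : Type} (f : V -> C) (l : list V) : C :=
  fold_right (fun v acc => Cadd (f v) acc) C0 l.

(* ||x||^2 <= r, i.e. every finite partial sum of |x v|^2 is <= r *)
Definition nsq_le {V : Type} (x : vec V) (r : R) : Prop :=
  forall l : list V, NoDup l -> sumR (fun v => Cnorm2 (x v)) l <= r.

Definition l2 {V : Type} (x : vec V) : Prop := exists M, nsq_le x M.

Definition has_sumC {V : Type} (f : V -> C) (s : C) : Prop :=
  forall eps, 0 < eps -> exists F0 : list V,
    forall L : list V, NoDup L -> incl F0 L ->
      Cnorm2 (Cadd (sumC f L) (Copp s)) <= eps.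

Definition inner {V : Type} (x y : vec V) (s : C) : Prop :=
  has_sumC (fun v => Cmul (x v) (Cconj (y v))) s.

Definition op (V : Type) := vec V -> vec V.

Definition is_adjoint {V : Type} (T A : op V) : Prop :=
  forall x y : vec V, l2 x -> l2 y ->
    l2 (A y) /\ (forall s, inner (T x) y s <-> inner x (A y) s).

Definition orbit_to_zero {V : Type} (T : op V) (x : vec V) : Prop :=
  forall eps, 0 < eps -> exists N : nat, forall n : nat, (N <= n)%nat ->
    nsq_le (Nat.iter n T x) eps.

Definition contraction {V : Type} (T : op V) : Prop :=
  forall x, l2 x -> forall r, nsq_le x r -> nsq_le (T x) r.

Definition class_C1dot {V : Type} (T : op V) : Prop :=
  forall x, l2 x -> orbit_to_zero T x -> forall v, x v = C0.

Definition class_Cdot0 {V : Type} (T : op V) : Prop :=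
  forall A, is_adjoint T A -> forall x, l2 x -> orbit_to_zero A x.

Fixpoint poly_apply {V : Type} (T : op V) (h : vec V) (cs : list C) : vec V :=
  match cs with
  | [] => vzero
  | c :: cs' => vadd (vscale c h) (poly_apply T (T h) cs')
  end.

Definition cyclic {V : Type} (T : op V) : Prop :=
  exists h, l2 h /\ forall x, l2 x -> forall eps, 0 < eps ->
    exists cs : list C, nsq_le (vsub x (poly_apply T h cs)) eps.

Definition directed_tree {V : Type} (E : V -> V -> Prop) : Prop :=
  (forall v, ~ E v v) /\
  (forall u v, clos_refl_trans V (fun a b => E a b \/ E b a) u v) /\
  (forall u u' v, E u v -> E u' v -> u = u') /\
  (forall v, ~ clos_trans V E v v).

Definition rootless {V : Type} (E : V -> V -> Prop) : Prop :=
  forall v, exists u, E u v.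

Definition Chi {V : Type} (E : V -> V -> Prop) (u : V) : V -> Prop := fun v => E u v.
Definition leaf {V : Type} (E : V -> V -> Prop) (u : V) : Prop := forall v, ~ E u v.

Definition card_eq {V : Type} (P : V -> Prop) (n : nat) : Prop :=
  exists l : list V, NoDup l /\ length l = n /\ forall v, P v <-> In v l.
Definition card_le {V : Type} (P : V -> Prop) (n : nat) : Prop :=
  forall l : list V, NoDup l -> (forall v, In v l -> P v) -> (length l <= n)%nat.

(* Br(T) = sum_{u not leaf} (#Chi(u) - 1) = 1 : exactly one vertex has
   two children and every other vertex has at most one child. *)
Definition branching_index_one {V : Type} (E : V -> V -> Prop) : Prop :=
  exists u0, card_eq (Chi E u0) 2 /\ forall u, u <> u0 -> card_le (Chi E u) 1.

Definition bounded_weights {V : Type} (E : V -> V -> Prop) (lam : V -> R) : Prop :=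
  exists M, forall u (l : list V), NoDup l -> (forall v, In v l -> E u v) ->
    sumR (fun v => lam v * lam v) l <= M.

Definition par_of {V : Type} (E : V -> V -> Prop) (H : rootless E) (v : V) : V :=
  proj1_sig (constructive_indefinite_description _ (H v)).

(* weighted shift: S e_u = sum_{v in Chi u} lam_v e_v, i.e.
   (S x)(v) = lam_v x(par v) (every vertex has a parent here) *)
Definition wshift {V : Type} (par : V -> V) (lam : V -> R) : op V :=
  fun x v => Cmul (RtoC (lam v)) (x (par v)).

(* Z u {1',...,k0'}; inr k stands for (k+1)' *)
Definition MV (k0 : nat) : Type := (Z + {k : nat | (k < k0)%nat})%type.

Definition Em (k0 : nat) (a b : MV k0) : Prop :=
  match a, b with
  | inl i, inl j => i = (j - 1)%Z
  | inl i, inr k => i = 0%Z /\ proj1_sig k = 0%nat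
  | inr k, inr k' => proj1_sig k' = S (proj1_sig k)
  | inr _, inl _ => False
  end.

Definition graph_iso {A B : Type} (EA : A -> A -> Prop) (EB : B -> B -> Prop)
  (phi : A -> B) : Prop :=
  (forall a a', phi a = phi a' -> a = a') /\
  (forall b, exists a, phi a = b) /\
  (forall a a', EB (phi a) (phi a') <-> EA a a').

(* the tree T~ : Z u {k' : k in N, k >= 1}; inr k stands for (k+1)' *)
Definition VT : Type := (Z + nat)%type.

Definition ET (a b : VT) : Prop :=
  match a, b with
  | inl i, inl j => i = (j - 1)%Z
  | inl i, inr k => i = 0%Z /\ k = 0%nat
  | inr k, inr k' => k' = S k
  | inr _, inl _ => False
  end.

Definition parT (v : VT) : VT :=
  match v with
  | inl j => inl (j - 1)%Z
  | inr 0 => inl 0%Z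
  | inr (S k) => inr k
  end.

(* Main.v *)
From Coquelicot Require Import Hierarchy AutoDerive RInt RInt_analysis.
Require Import Defs.
From Stdlib Require Import Lra Lia FinFun FunctionalExtensionality.

(** A rootless tree with one fork consists of a trunk [..., a_2, a_1, a_0] and two
    branches issuing from [a_0].

    When the orbits along both branches decay fast (in particular when both branches
    are finite), take a sparse vector [h = e_{c1} + sum_k alpha_k e_{a_(2^k)}] with
    rapidly decreasing coefficients: [S^(2^k - j) h], divided by its dominant
    coefficient, tends to [e_{a_j}], so the closed cyclic subspace contains the trunk,
    hence also [e_{c1}], the other child of [a_0], and both branches.

    A finite branch attached to a bilateral shift W splits off up to similarity as a
    nilpotent Jordan block. As W has dense range, W is cyclic if and only if its sum
    with that block is. For a contraction that is not of class C.0 the products of the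
    weights along the trunk are bounded below, so W is the image of the unweighted
    bilateral shift U under a diagonal intertwiner with dense range. The Fourier
    coefficients of [exp (-1 / |1 - z|^2)] form a cyclic vector of U: this function
    tames the powers of [(1 - rho z) / (1 - r z)], which equal 1 at the origin and are
    small away from [z = 1], so the cyclic subspace is invariant under U^-1, and then
    under multiplication by approximate inverses of that function.

    In class C1. both branches are infinite, and rescaling the coordinates along the two
    bi-infinite chains maps S to U in two ways, h to f and g, say. Commutativity of
    convolution, [(p f) g = (p g) f], yields a bounded functional that annihilates
    every [p(S) h]; it vanishes identically only if h vanishes on the trunk below [a_0]. *)

(** * Vectors, operators and the closed cyclic subspace *)

(** The function [exp (-1 / |1 - z|^2)] is chosen because its logarithm is not integrable over the
    circle; by Szego's theorem this is what makes an almost everywhere nonzero function cyclic for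
    multiplication by z. Explicit estimates take the place of that theorem: the squared moduli of
    suitable powers of [(1 - rho z) / (1 - r z)] are at most a small constant times
    [exp (1 / |1 - z|^2)], which the square of the function absorbs.

    Diagonal rescalings are used in two opposite directions. Mapping U to a weighted shift needs
    cumulative weight products bounded above, mapping the shift to U needs them bounded below. The
    weights of a contraction are at most 1, so in each case only one half-line is in doubt: the
    backward one when the shift is not of class C.0, the forward one in class C1.

    The sparse vector is of no help when a branch is infinite and its weights do not decay: terms
    that have passed the fork then stay comparable with the dominant one. This is why one infinite
    branch is treated by similarity instead. *)

Lemma C_ring : ring_theory C0 (RtoC 1) Cadd Cmul (fun a b => Cadd a (Copp b)) Copp eq.
Proof.
  constructor; intros; try destruct x; try destruct y; try destruct z;
    unfold Cadd, Cmul, Copp, C0, RtoC; simpl; try reflexivity; f_equal; ring.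
Qed.
Add Ring C_ring_inst : C_ring.

Ltac cdestr :=
  repeat match goal with a : C |- _ => destruct a end;
  unfold Cadd, Cmul, Copp, Cconj, C0, RtoC, Cnorm2 in *; simpl in *.

Lemma Cnorm2_ge0 (a : C) : 0 <= Cnorm2 a.
Proof. cdestr; nra. Qed.

Lemma Cnorm2_mul (a b : C) : Cnorm2 (Cmul a b) = Cnorm2 a * Cnorm2 b.
Proof. cdestr; ring. Qed.

Lemma Cnorm2_opp (a : C) : Cnorm2 (Copp a) = Cnorm2 a.
Proof. cdestr; ring. Qed.

Lemma Cnorm2_RtoC (r : R) : Cnorm2 (RtoC r) = r * r.
Proof. cdestr; ring. Qed.

Lemma Cnorm2_C0 : Cnorm2 C0 = 0.
Proof. cdestr; ring. Qed.

Lemma Cnorm2_eq0 (a : C) : Cnorm2 a <= 0 -> a = C0.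
Proof. cdestr; intro H; f_equal; nra. Qed.

Lemma RtoC_mul (a b : R) : RtoC (a * b) = Cmul (RtoC a) (RtoC b).
Proof. cdestr; f_equal; ring. Qed.

Lemma RtoC_inv_l (r : R) (a : C) : r <> 0 -> Cmul (RtoC (/ r)) (Cmul (RtoC r) a) = a.
Proof. intro; cdestr; f_equal; field; assumption. Qed.

(** * Finite sums and norm bounds *)

Lemma sumR_le {V : Type} (f g : V -> R) (l : list V) :
  (forall v, In v l -> f v <= g v) -> sumR f l <= sumR g l.
Proof.
  induction l as [|v l IH]; simpl; intro H; [lra|].
  assert (f v <= g v) by auto.
  assert (sumR f l <= sumR g l) by auto. unfold sumR in *; lra.
Qed.

Lemma sumR_ext {V : Type} (f g : V -> R) (l : list V) :
  (forall v, In v l -> f v = g v) -> sumR f l = sumR g l.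
Proof.
  intro H; apply Rle_antisym; apply sumR_le; intros v Hv; rewrite (H v Hv); lra.
Qed.

Lemma sumR_plus {V : Type} (f g : V -> R) (l : list V) :
  sumR (fun v => f v + g v) l = sumR f l + sumR g l.
Proof. induction l as [|v l IH]; simpl; [lra|]. unfold sumR in *; lra. Qed.

Lemma sumR_scal {V : Type} (c : R) (f : V -> R) (l : list V) :
  sumR (fun v => c * f v) l = c * sumR f l.
Proof. induction l as [|v l IH]; simpl; [lra|]. unfold sumR in *; rewrite IH; lra. Qed.

Lemma sumR_0 {V : Type} (f : V -> R) (l : list V) :
  (forall v, In v l -> f v = 0) -> sumR f l = 0.
Proof.
  intro H; rewrite (sumR_ext f (fun v => 0 * f v)), sumR_scal by (intros; rewrite H; auto; ring).
  ring.
Qed.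

Lemma sumR_ge0 {V : Type} (f : V -> R) (l : list V) :
  (forall v, 0 <= f v) -> 0 <= sumR f l.
Proof.
  intro H; rewrite <- (sumR_0 (fun _ : V => 0) l) by auto. now apply sumR_le.
Qed.

Lemma sumR_app {V : Type} (f : V -> R) (l l' : list V) :
  sumR f (l ++ l') = sumR f l + sumR f l'.
Proof. induction l as [|v l IH]; simpl; [lra|]. unfold sumR in *; rewrite IH; lra. Qed.

Lemma sumR_map {V W : Type} (f : W -> R) (g : V -> W) (l : list V) :
  sumR f (map g l) = sumR (fun v => f (g v)) l.
Proof. induction l as [|v l IH]; simpl; [lra|]. unfold sumR in *; rewrite IH; lra. Qed.

Lemma sumR_incl {V : Type} (f : V -> R) (l l' : list V) :
  (forall v, 0 <= f v) -> NoDup l -> incl l l' -> sumR f l <= sumR f l'.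
Proof.
  intro Hf; revert l'; induction l as [|v l IH]; intros l' Hn Hi.
  - now apply sumR_ge0.
  - destruct (in_split v l' (Hi v (or_introl eq_refl))) as (l1 & l2 & ->).
    inversion Hn; subst.
    assert (sumR f l <= sumR f (l1 ++ l2)).
    { apply IH; auto. intros w Hw.
      specialize (Hi w (or_intror Hw)).
      apply in_app_or in Hi; apply in_or_app; destruct Hi as [|[->|]]; auto.
      contradiction. }
    rewrite sumR_app in *; simpl; unfold sumR in *; lra.
Qed.

(** A bound on the norm rather than on its square, so that bounds add under the triangle inequality.
    The norm itself is never formed; the sign condition excludes a negative [r] with the same
    square. *)
Definition nle {V : Type} (x : vec V) (r : R) : Prop := 0 <= r /\ nsq_le x (r * r).

Lemma nsq_le_mono {V : Type} (x : vec V) (r s : R) : r <= s -> nsq_le x r -> nsq_le x s.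
Proof. intros H Hx l Hl; specialize (Hx l Hl); lra. Qed.

Lemma nsq_le_nonneg {V : Type} (x : vec V) (r : R) : nsq_le x r -> 0 <= r.
Proof. intro H; apply (H []); constructor. Qed.

Lemma nsq_le_nle {V : Type} (x : vec V) (r : R) : nsq_le x r -> nle x (sqrt r).
Proof.
  intro H; split; [apply sqrt_pos|]. rewrite sqrt_sqrt; auto. eapply nsq_le_nonneg; eauto.
Qed.

Lemma nle_mono {V : Type} (x : vec V) (r s : R) : r <= s -> nle x r -> nle x s.
Proof.
  intros H [H0 Hx]; split; [lra|]. eapply nsq_le_mono; [|exact Hx]. nra.
Qed.

Lemma nle_vadd_pos {V : Type} (x y : vec V) (a b : R) :
  0 < a -> 0 < b -> nsq_le x (a * a) -> nsq_le y (b * b) ->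
  nsq_le (vadd x y) ((a + b) * (a + b)).
Proof.
  intros Ha Hb Hx Hy l Hl. specialize (Hx l Hl); specialize (Hy l Hl).
  apply Rmult_le_reg_l with (a * b); [nra|].
  rewrite <- sumR_scal.
  apply Rle_trans with (sumR (fun v => (a + b) * b * Cnorm2 (x v) + (a + b) * a * Cnorm2 (y v)) l).
  - apply sumR_le; intros v _. unfold vadd.
    (* the difference of the two sides is |b x - a y|^2 *)
    destruct (x v) as [x1 x2], (y v) as [y1 y2]; unfold Cadd, Cnorm2; simpl.
    assert (0 <= Rsqr (b * x1 - a * y1)) by apply Rle_0_sqr.
    assert (0 <= Rsqr (b * x2 - a * y2)) by apply Rle_0_sqr.
    unfold Rsqr in *; nra.
  - rewrite sumR_plus, !sumR_scal.
    assert ((a + b) * b * sumR (fun v => Cnorm2 (x v)) l <= (a + b) * b * (a * a))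
      by (apply Rmult_le_compat_l; nra).
    assert ((a + b) * a * sumR (fun v => Cnorm2 (y v)) l <= (a + b) * a * (b * b))
      by (apply Rmult_le_compat_l; nra).
    nra.
Qed.

Lemma nle_vadd {V : Type} (x y : vec V) (a b : R) :
  nle x a -> nle y b -> nle (vadd x y) (a + b).
Proof.
  intros [Ha Hx] [Hb Hy]; split; [lra|]. intros l Hl.
  set (s := sumR _ l).
  assert (Hs : 0 <= s) by (apply sumR_ge0; intro; apply Cnorm2_ge0).
  rewrite <- (sqrt_sqrt s) by assumption.
  assert (sqrt s <= a + b).
  (* Either bound may be 0, so each receives a slack of [e / 2] to reach the strictly positive
     case. *)
  { apply le_epsilon; intros e He.
    apply Rsqr_incr_0_var; [|lra]. unfold Rsqr; rewrite sqrt_sqrt by assumption.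
    replace (a + b + e) with ((a + e / 2) + (b + e / 2)) by lra.
    apply nle_vadd_pos; auto; try lra; eapply nsq_le_mono; eauto; nra. }
  assert (0 <= sqrt s) by apply sqrt_pos. nra.
Qed.

Lemma nle_vscale {V : Type} (c : C) (x : vec V) (r k : R) :
  0 <= k -> Cnorm2 c <= k * k -> nle x r -> nle (vscale c x) (k * r).
Proof.
  intros Hk Hc [Hr Hx]; split; [nra|]. intros l Hl. specialize (Hx l Hl).
  rewrite (sumR_ext _ (fun v => Cnorm2 c * Cnorm2 (x v)))
    by (intros; unfold vscale; apply Cnorm2_mul).
  rewrite sumR_scal. pose proof (Cnorm2_ge0 c).
  assert (0 <= sumR (fun v => Cnorm2 (x v)) l) by (apply sumR_ge0; intro; apply Cnorm2_ge0).
  nra.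
Qed.

Lemma nle_zero {V : Type} : @nle V vzero 0.
Proof.
  split; [lra|]. intros l _. rewrite sumR_0; [lra|]. intros; apply Cnorm2_C0.
Qed.

Lemma nle_opp {V : Type} (x : vec V) (r : R) :
  nle x r -> nle (fun v => Copp (x v)) r.
Proof.
  intros [Hr Hx]; split; auto. intros l Hl.
  rewrite (sumR_ext _ (fun v => Cnorm2 (x v))) by (intros; apply Cnorm2_opp). now apply Hx.
Qed.

Lemma nle_vsub {V : Type} (x y : vec V) (a b : R) :
  nle x a -> nle y b -> nle (vsub x y) (a + b).
Proof. intros Hx Hy. exact (nle_vadd _ _ _ _ Hx (nle_opp _ _ Hy)). Qed.

Lemma nle_point {V : Type} (x : vec V) (r : R) (v : V) : nle x r -> Cnorm2 (x v) <= r * r.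
Proof.
  intros [_ H]. specialize (H [v]). simpl in H. rewrite Rplus_0_r in H. apply H.
  constructor; [easy|constructor].
Qed.

Lemma nle_comp_inj {V W : Type} (a : W -> V) (x : vec V) (r : R) :
  (forall w w', a w = a w' -> w = w') -> nle x r -> nle (fun w => x (a w)) r.
Proof.
  intros Ha [Hr Hx]; split; auto. intros l Hl.
  rewrite <- (sumR_map (fun v => Cnorm2 (x v)) a l). apply Hx.
  now apply FinFun.Injective_map_NoDup.
Qed.

Lemma l2_nle {V : Type} (x : vec V) : l2 x <-> exists r, nle x r.
Proof.
  split.
  - intros [M HM]; exists (sqrt M); now apply nsq_le_nle.
  - intros [r [_ H]]; now exists (r * r).
Qed.

Lemma sumC_parts {V : Type} (x : V -> C) (l : list V) : fst (sumC x l) = sumR (fun v => fst (x v)) l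
  /\ snd (sumC x l) = sumR (fun v => snd (x v)) l.
Proof.
  induction l as [|v l [IH1 IH2]]; simpl; auto. unfold sumR, sumC in *.
  rewrite IH1, IH2; auto.
Qed.

Definition eqb_cl {V : Type} (u v : V) : bool :=
  if excluded_middle_informative (u = v) then true else false.

Lemma eqb_cl_spec {V : Type} (u v : V) : eqb_cl u v = true <-> u = v.
Proof. unfold eqb_cl; destruct excluded_middle_informative; split; easy. Qed.

Definition delta {V : Type} (u : V) : vec V := fun v => if eqb_cl v u then RtoC 1 else C0.

Lemma delta_same {V : Type} (u : V) : delta u u = RtoC 1.
Proof. unfold delta. now rewrite (proj2 (eqb_cl_spec u u) eq_refl). Qed.

Lemma delta_other {V : Type} (u v : V) : v <> u -> delta u v = C0.
Proof.
  intro H; unfold delta. destruct (eqb_cl v u) eqn:E; auto. apply (proj1 (eqb_cl_spec _ _)) in E; contradiction.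
Qed.

Lemma delta_inj {V W : Type} (a : V -> W) (u v : V) :
  (forall v v', a v = a v' -> v = v') -> delta (a u) (a v) = delta u v.
Proof.
  intro Ha. destruct (excluded_middle_informative (v = u)) as [->|H].
  - now rewrite !delta_same.
  - rewrite !delta_other; auto.
Qed.

Lemma sumR_single {V : Type} (f : V -> R) (u : V) (l : list V) :
  NoDup l -> (forall v, v <> u -> f v = 0) -> 0 <= f u -> sumR f l <= f u.
Proof.
  intros Hl Hf Hu; induction l as [|v l IH]; simpl; auto.
  inversion Hl; subst. destruct (excluded_middle_informative (v = u)) as [->|Hv].
  - replace (fold_right _ 0 l) with (sumR f l) by reflexivity.
    rewrite sumR_0; [lra|]. intros w Hw. apply Hf. now intros ->.
  - rewrite Hf, Rplus_0_l by auto. now apply IH.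
Qed.

Lemma nle_delta {V : Type} (u : V) : nle (delta u) 1.
Proof.
  split; [lra|]. intros l Hl.
  replace (1 * 1) with (Cnorm2 (delta u u)) by (rewrite delta_same, Cnorm2_RtoC; ring).
  apply (sumR_single (fun v => Cnorm2 (delta u v))); auto using Cnorm2_ge0.
  intros v Hv; rewrite delta_other by auto. apply Cnorm2_C0.
Qed.

Lemma delta_l2 {V : Type} (u : V) : l2 (delta u).
Proof. apply l2_nle; exists 1; apply nle_delta. Qed.

(** Linearity is required on all functions, not only on square-summable ones: every operator below
    is given by a coordinatewise formula, and membership in [l2] then never has to be carried along
    in algebraic rewriting. *)
Record blin {V W : Type} (T : vec V -> vec W) (K : R) : Prop := {
  blin_add : forall x y, T (vadd x y) = vadd (T x) (T y);
  blin_scale : forall c x, T (vscale c x) = vscale c (T x);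
  blin_pos : 0 <= K;
  blin_bound : forall x r, nle x r -> nle (T x) (K * r) }.

Ltac vext := apply functional_extensionality; intro; unfold vadd, vsub, vscale, vzero; try ring.

Lemma vsub_alt {V : Type} (x y : vec V) : vsub x y = vadd x (vscale (RtoC (-1)) y).
Proof. vext. unfold vsub. cdestr. f_equal; destruct (y x0); simpl; ring. Qed.

Lemma blin_sub {V W : Type} (T : vec V -> vec W) K (x y : vec V) :
  blin T K -> T (vsub x y) = vsub (T x) (T y).
Proof. intro H. now rewrite !vsub_alt, (blin_add _ _ H), (blin_scale _ _ H). Qed.

Lemma blin_zero {V W : Type} (T : vec V -> vec W) K : blin T K -> T vzero = vzero.
Proof.
  intro H. replace (@vzero V) with (vscale C0 (@vzero V)) by vext.
  rewrite (blin_scale _ _ H). vext.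
Qed.

Lemma blin_l2 {V W : Type} (T : vec V -> vec W) K x : blin T K -> l2 x -> l2 (T x).
Proof.
  intros H Hx. apply l2_nle in Hx as [r Hr]. apply l2_nle. exists (K * r).
  now apply (blin_bound _ _ H).
Qed.

Lemma blin_poly {V W : Type} (T : op V) (T' : op W) (X : vec V -> vec W) K h cs :
  blin X K -> (forall x, X (T x) = T' (X x)) ->
  X (poly_apply T h cs) = poly_apply T' (X h) cs.
Proof.
  intros HX HT; revert h; induction cs as [|c cs IH]; intro h; simpl.
  - eapply blin_zero; eauto.
  - now rewrite (blin_add _ _ HX), (blin_scale _ _ HX), IH, HT.
Qed.

Lemma blin_iter {V : Type} (T : op V) K n : blin T K -> blin (Nat.iter n T) (K ^ n).
Proof.
  intro H; induction n as [|n [IH1 IH2 IH3 IH4]].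
  - constructor; auto; simpl; [lra|]. intros; now rewrite Rmult_1_l.
  - change (Nat.iter (S n) T) with (fun x => T (Nat.iter n T x)).
    constructor; simpl pow.
    + intros; now rewrite IH1, (blin_add _ _ H).
    + intros; now rewrite IH2, (blin_scale _ _ H).
    + apply Rmult_le_pos; auto. apply (blin_pos _ _ H).
    + intros x r Hx. rewrite Rmult_assoc. apply (blin_bound _ _ H). auto.
Qed.

(** * The closed span of an orbit *)

Definition in_cl {V : Type} (T : op V) (h x : vec V) : Prop :=
  forall eps, 0 < eps -> exists cs : list C, nle (vsub x (poly_apply T h cs)) eps.

Fixpoint padd (cs ds : list C) : list C :=
  match cs, ds with
  | [], _ => ds
  | _, [] => cs
  | c :: cs', d :: ds' => Cadd c d :: padd cs' ds'
  end.

Lemma poly_apply_padd {V : Type} (T : op V) h cs ds :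
  poly_apply T h (padd cs ds) = vadd (poly_apply T h cs) (poly_apply T h ds).
Proof.
  revert h ds; induction cs as [|c cs IH]; intros h [|d ds]; simpl; try solve [vext].
  rewrite IH. vext.
Qed.

Lemma poly_apply_scale {V : Type} (T : op V) h c cs :
  poly_apply T h (map (Cmul c) cs) = vscale c (poly_apply T h cs).
Proof.
  revert h; induction cs as [|d cs IH]; intros h; simpl; try solve [vext].
  rewrite IH. vext.
Qed.

Section ClosedCyclicSubspace.
Context {V : Type} (T : op V) (h : vec V).

Lemma in_cl_poly cs : in_cl T h (poly_apply T h cs).
Proof.
  intros e He; exists cs. replace (vsub _ _) with (@vzero V) by vext.
  apply nle_mono with 0; [lra|apply nle_zero].
Qed.

Lemma in_cl_self : in_cl T h h.
Proof.
  replace h with (poly_apply T h [RtoC 1]) at 2; [apply in_cl_poly|]. simpl. vext.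
Qed.

Lemma in_cl_zero : in_cl T h vzero.
Proof. exact (in_cl_poly []). Qed.

Lemma in_cl_add x y : in_cl T h x -> in_cl T h y -> in_cl T h (vadd x y).
Proof.
  intros Hx Hy e He. destruct (Hx (e / 2)) as [cs Hc]; [lra|].
  destruct (Hy (e / 2)) as [ds Hd]; [lra|].
  exists (padd cs ds). rewrite poly_apply_padd.
  replace (vsub _ _) with
    (vadd (vsub x (poly_apply T h cs)) (vsub y (poly_apply T h ds))) by vext.
  replace e with (e / 2 + e / 2) by lra. now apply nle_vadd.
Qed.

Lemma in_cl_scale c x : in_cl T h x -> in_cl T h (vscale c x).
Proof.
  intros Hx e He.
  set (k := sqrt (Cnorm2 c) + 1).
  assert (0 <= sqrt (Cnorm2 c)) by apply sqrt_pos.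
  destruct (Hx (e / k)) as [cs Hc]; [apply Rdiv_lt_0_compat; unfold k; lra|].
  exists (map (Cmul c) cs). rewrite poly_apply_scale.
  replace (vsub _ _) with (vscale c (vsub x (poly_apply T h cs))) by vext.
  replace e with (k * (e / k)) by (field; unfold k; lra).
  apply nle_vscale; auto; [unfold k; lra|].
  rewrite <- (sqrt_sqrt (Cnorm2 c)) at 1 by apply Cnorm2_ge0. unfold k; nra.
Qed.

Lemma in_cl_sub x y : in_cl T h x -> in_cl T h y -> in_cl T h (vsub x y).
Proof. intros; rewrite vsub_alt; auto using in_cl_add, in_cl_scale. Qed.

Lemma in_cl_lim x :
  (forall eps, 0 < eps -> exists y, in_cl T h y /\ nle (vsub x y) eps) -> in_cl T h x.
Proof.
  intros H e He. destruct (H (e / 2)) as (y & Hy & Hxy); [lra|].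
  destruct (Hy (e / 2)) as [cs Hc]; [lra|]. exists cs.
  replace (vsub _ _) with (vadd (vsub x y) (vsub y (poly_apply T h cs))) by vext.
  replace e with (e / 2 + e / 2) by lra. now apply nle_vadd.
Qed.

Lemma in_cl_T K x : blin T K -> in_cl T h x -> in_cl T h (T x).
Proof.
  intros HT Hx e He. pose proof (blin_pos _ _ HT).
  destruct (Hx (e / (K + 1))) as [cs Hc]; [apply Rdiv_lt_0_compat; lra|].
  exists (C0 :: cs). simpl.
  rewrite <- (blin_poly T T T K h cs HT (fun _ => eq_refl)).
  replace (vsub _ _) with (vsub (T x) (T (poly_apply T h cs))) by vext.
  rewrite <- (blin_sub _ _ _ _ HT).
  apply nle_mono with (K * (e / (K + 1))); [|now apply (blin_bound _ _ HT)].
  replace e with ((K + 1) * (e / (K + 1))) at 2 by (field; lra).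
  assert (0 < e / (K + 1)) by (apply Rdiv_lt_0_compat; lra). nra.
Qed.

Lemma in_cl_iter K n x : blin T K -> in_cl T h x -> in_cl T h (Nat.iter n T x).
Proof. intros HT Hx; induction n; simpl; auto. eapply in_cl_T; eauto. Qed.

Lemma in_cl_poly_apply (T' : op V) y cs :
  (forall x, in_cl T h x -> in_cl T h (T' x)) ->
  in_cl T h y -> in_cl T h (poly_apply T' y cs).
Proof.
  intros HT; revert y; induction cs as [|c cs IH]; intros y Hy; simpl.
  - apply in_cl_zero.
  - apply in_cl_add; auto using in_cl_scale.
Qed.

End ClosedCyclicSubspace.

Definition restr {V : Type} (l : list V) (x : vec V) : vec V :=
  fun v => if excluded_middle_informative (In v l) then x v else C0.

Lemma in_cl_restr {V : Type} (T : op V) h (l : list V) x :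
  (forall v, In v l -> in_cl T h (delta v)) -> in_cl T h (restr l x).
Proof.
  induction l as [|u l IH]; intro H.
  - replace (restr [] x) with (@vzero V); [apply in_cl_zero|].
    vext. unfold restr. destruct excluded_middle_informative; easy.
  - assert (IH' : in_cl T h (restr l x)) by (apply IH; intros; apply H; now right).
    destruct (excluded_middle_informative (In u l)) as [Hu|Hu].
    + replace (restr (u :: l) x) with (restr l x); auto.
      apply functional_extensionality; intro v; unfold restr.
      destruct (excluded_middle_informative (In v l)) as [H1|H1],
        (excluded_middle_informative (In v (u :: l))) as [H2|H2]; auto.
      * exfalso; apply H2; now right.
      * destruct H2 as [->|]; contradiction.
    + replace (restr (u :: l) x) with (vadd (vscale (x u) (delta u)) (restr l x)).
      * apply in_cl_add; auto. apply in_cl_scale, H. now left.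
      * apply functional_extensionality; intro v. unfold vadd, vscale, restr.
        destruct (excluded_middle_informative (v = u)) as [->|Hv].
        -- rewrite delta_same.
           destruct (excluded_middle_informative (In u l)), (excluded_middle_informative (In u (u :: l)));
             try contradiction; [ring|]. exfalso; apply n0; now left.
        -- rewrite delta_other by auto.
           destruct (excluded_middle_informative (In v l)) as [H1|H1],
             (excluded_middle_informative (In v (u :: l))) as [H2|H2]; try ring.
           ++ exfalso; apply H2; now right.
           ++ destruct H2 as [->|]; contradiction.
Qed.

Lemma nsq_sup {V : Type} (x : vec V) (eps : R) : l2 x -> 0 < eps ->
  exists l, NoDup l /\ forall l', NoDup l' -> incl l l' ->
    sumR (fun v => Cnorm2 (x v)) l' <= sumR (fun v => Cnorm2 (x v)) l + eps.
Proof.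
  intros [M HM] He.
  destruct (completeness (fun r => exists l, NoDup l /\ r = sumR (fun v => Cnorm2 (x v)) l))
    as [s [Hub Hlub]].
  - exists M. intros r (l & Hl & ->). now apply HM.
  - exists 0, []. split; [constructor|reflexivity].
  - destruct (classic (exists l, NoDup l /\ s - eps < sumR (fun v => Cnorm2 (x v)) l))
      as [(l & Hl & Hs)|Hno].
    + exists l; split; auto. intros l' Hl' _.
      assert (sumR (fun v => Cnorm2 (x v)) l' <= s) by (apply Hub; eauto). lra.
    + assert (s <= s - eps); [|lra]. apply Hlub. intros r (l & Hl & ->).
      destruct (Rle_or_lt (sumR (fun v => Cnorm2 (x v)) l) (s - eps)); auto.
      exfalso; eauto.
Qed.

Lemma list_union_nodup {V : Type} (l l' : list V) : exists m, NoDup m /\ forall v, In v m <-> In v l \/ In v l'.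
Proof.
  exists (nodup (fun u v => excluded_middle_informative (u = v)) (l ++ l')).
  split; [apply NoDup_nodup|]. intro v. rewrite nodup_In. apply in_app_iff.
Qed.

Lemma sumR_filter {V : Type} (f : V -> R) (p : V -> bool) (l : list V) :
  sumR f (filter p l) = sumR (fun v => if p v then f v else 0) l.
Proof.
  induction l as [|v l IH]; simpl; auto. unfold sumR in *.
  destruct (p v); simpl; rewrite IH; lra.
Qed.

(** The list [l] nearly attains the supremum of the partial sums. Over the union of [l] and [m] the
    sum splits exactly into the part on [l] and the part off it, so the latter cannot exceed
    [eps]. *)
Lemma nsq_tail {V : Type} (x : vec V) (eps : R) : l2 x -> 0 < eps ->
  exists l, NoDup l /\ nsq_le (vsub x (restr l x)) eps.
Proof.
  intros Hx He. destruct (nsq_sup x eps Hx He) as (l & Hl & H). exists l; split; auto.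
  intros m Hm. destruct (list_union_nodup l m) as (L & HL & HLi).
  specialize (H L HL). 
  assert (sumR (fun v => Cnorm2 (x v)) L <= sumR (fun v => Cnorm2 (x v)) l + eps) as H1.
  { apply H. intros v Hv; apply HLi; auto. }
  assert (sumR (fun v => Cnorm2 (vsub x (restr l x) v)) m <=
          sumR (fun v => Cnorm2 (vsub x (restr l x) v)) L) as H2.
  { apply sumR_incl; auto using Cnorm2_ge0. intros v Hv; apply HLi; auto. }
  assert (sumR (fun v => Cnorm2 (restr l x v)) L >= sumR (fun v => Cnorm2 (x v)) l) as H3.
  { apply Rle_ge. rewrite (sumR_ext _ (fun v => Cnorm2 (restr l x v)) l).
    - apply sumR_incl; auto using Cnorm2_ge0. intros v Hv; apply HLi; auto.
    - intros v Hv. unfold restr. destruct excluded_middle_informative; easy. }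
  assert (sumR (fun v => Cnorm2 (x v)) L = sumR (fun v => Cnorm2 (vsub x (restr l x) v)) L
     + sumR (fun v => Cnorm2 (restr l x v)) L) as H4.
  { rewrite <- sumR_plus. apply sumR_ext. intros v _. unfold vsub, restr.
    destruct excluded_middle_informative.
    - replace (Cadd (x v) (Copp (x v))) with C0 by ring. rewrite Cnorm2_C0; ring.
    - replace (Cadd (x v) (Copp C0)) with (x v) by ring. rewrite Cnorm2_C0; ring. }
  lra.
Qed.

Lemma in_cl_all {V : Type} (T : op V) h :
  (forall v, in_cl T h (delta v)) -> forall x, l2 x -> in_cl T h x.
Proof.
  intros H x Hx. apply in_cl_lim. intros e He.
  destruct (nsq_tail x (e * e) Hx) as (l & Hl & Hn); [nra|].
  exists (restr l x). split; [apply in_cl_restr; auto|]. split; [lra|exact Hn].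
Qed.

Lemma cyclic_intro {V : Type} (T : op V) h :
  l2 h -> (forall v, in_cl T h (delta v)) -> cyclic T.
Proof.
  intros Hh H. exists h; split; auto. intros x Hx e He.
  destruct (in_cl_all T h H x Hx (sqrt e)) as [cs [_ Hc]]; [now apply sqrt_lt_R0|].
  exists cs. rewrite sqrt_sqrt in Hc by lra. exact Hc.
Qed.

Lemma cyclic_elim {V : Type} (T : op V) :
  cyclic T -> exists h, l2 h /\ forall x, l2 x -> in_cl T h x.
Proof.
  intros (h & Hh & H). exists h; split; auto. intros x Hx e He.
  destruct (H x Hx (e * e)) as [cs Hc]; [nra|]. exists cs; split; auto; lra.
Qed.

Lemma cyclic_of_scaled {V : Type} (T T' : op V) (c : C) K :
  blin T K -> (forall x, T' x = vscale c (T x)) -> cyclic T' -> cyclic T.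
Proof.
  intros HT HT' Hc. apply cyclic_elim in Hc as (h & Hh & H).
  apply (cyclic_intro T h Hh). intro v. apply in_cl_lim. intros e He.
  destruct (H (delta v) (delta_l2 v) e He) as [cs Hcs].
  exists (poly_apply T' h cs); split; auto.
  apply in_cl_poly_apply; [|apply in_cl_self].
  intros x Hx. rewrite HT'. apply in_cl_scale. eapply in_cl_T; eauto.
Qed.

(** An intertwiner with dense range carries a cyclic vector to a cyclic vector. Density is asked for
    in the form met by diagonal and coordinate maps: the range contains a nonzero multiple of each
    basis vector. *)
Lemma cyclic_quasi_affine {V W : Type} (T : op V) (T' : op W) (X : vec V -> vec W) K K' :
  blin X K -> blin T' K' -> (forall x, X (T x) = T' (X x)) ->
  (forall w, exists u c, X u = vscale c (delta w) /\ c <> C0 /\ l2 u) ->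
  cyclic T -> cyclic T'.
Proof.
  intros HX HT' HI Hd Hc. apply cyclic_elim in Hc as (h & Hh & H).
  apply (cyclic_intro T' (X h)); [eapply blin_l2; eauto|].
  assert (HXcl : forall x, l2 x -> in_cl T' (X h) (X x)).
  { intros x Hx e He. pose proof (blin_pos _ _ HX).
    destruct (H x Hx (e / (K + 1))) as [cs Hcs]; [apply Rdiv_lt_0_compat; lra|].
    exists cs. rewrite <- (blin_poly T T' X K h cs HX HI), <- (blin_sub _ _ _ _ HX).
    apply nle_mono with (K * (e / (K + 1))); [|now apply (blin_bound _ _ HX)].
    replace e with ((K + 1) * (e / (K + 1))) at 2 by (field; lra).
    assert (0 < e / (K + 1)) by (apply Rdiv_lt_0_compat; lra). nra. }
  intro w. destruct (Hd w) as (u & c & Hu & Hc & Hl).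
  specialize (HXcl u Hl). rewrite Hu in HXcl.
  assert (Hn : 0 < Cnorm2 c).
  { destruct (Rle_or_lt (Cnorm2 c) 0) as [h0|h0]; auto. elim Hc. now apply Cnorm2_eq0. }
  set (d := Cmul (RtoC (/ Cnorm2 c)) (Cconj c)).
  replace (delta w) with (vscale d (vscale c (delta w))); [now apply in_cl_scale|].
  apply functional_extensionality; intro v. unfold vscale, d. generalize (delta w v); intro a.
  clear -Hn. cdestr. f_equal; field; nra.
Qed.

(** * Weighted shifts through iterated parents *)

Fixpoint piter {V : Type} (par : V -> V) (n : nat) (v : V) : V :=
  match n with O => v | S n' => piter par n' (par v) end.

(** The product of the weights on the path from the n-th ancestor of [v] down to [v], that is, the
    coefficient with which the n-th iterate of the shift brings the value at that ancestor to
    [v]. *)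
Fixpoint wprod {V : Type} (par : V -> V) (lam : V -> R) (n : nat) (v : V) : R :=
  match n with O => 1 | S n' => lam v * wprod par lam n' (par v) end.

Lemma piter_add {V : Type} (par : V -> V) m n v :
  piter par (m + n) v = piter par n (piter par m v).
Proof. revert v; induction m; simpl; auto. Qed.

Lemma piter_S {V : Type} (par : V -> V) n v : piter par (S n) v = par (piter par n v).
Proof. rewrite <- Nat.add_1_r. now rewrite piter_add. Qed.

Lemma wprod_add {V : Type} (par : V -> V) lam m n v :
  wprod par lam (m + n) v = wprod par lam m v * wprod par lam n (piter par m v).
Proof. revert v; induction m; simpl; intros; [ring|]. rewrite IHm; ring. Qed.

Lemma wprod_pos {V : Type} (par : V -> V) lam n v :
  (forall v, 0 < lam v) -> 0 < wprod par lam n v.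
Proof. intro H; revert v; induction n; simpl; intros; [lra|]. now apply Rmult_lt_0_compat. Qed.

Lemma wprod_le1 {V : Type} (par : V -> V) lam n v :
  (forall v, 0 < lam v <= 1) -> wprod par lam n v <= 1.
Proof.
  intro H; revert v; induction n; simpl; intros; [lra|].
  pose proof (H v). specialize (IHn (par v)).
  assert (0 < wprod par lam n (par v)) by (apply wprod_pos; apply H). nra.
Qed.

Lemma wshift_iter {V : Type} (par : V -> V) lam n (x : vec V) v :
  Nat.iter n (wshift par lam) x v = Cmul (RtoC (wprod par lam n v)) (x (piter par n v)).
Proof.
  revert v; induction n; intro v.
  - simpl. ring.
  - change (Nat.iter (S n) (wshift par lam) x v)
      with (Cmul (RtoC (lam v)) (Nat.iter n (wshift par lam) x (par v))).
    rewrite IHn. simpl. rewrite RtoC_mul. ring.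
Qed.

Lemma sumR_exchange {V W : Type} (f : V -> W -> R) (l : list V) (m : list W) :
  sumR (fun v => sumR (f v) m) l = sumR (fun w => sumR (fun v => f v w) l) m.
Proof.
  induction l as [|v l IH]; simpl.
  - now rewrite sumR_0.
  - unfold sumR in *. rewrite IH. clear IH.
    exact (eq_sym (sumR_plus (f v) (fun w => sumR (fun v => f v w) l) m)).
Qed.

Lemma sumR_pick {V : Type} (f : V -> R) (u : V) (l : list V) : NoDup l -> In u l ->
  sumR (fun v => if eqb_cl u v then f v else 0) l = f u.
Proof.
  induction l as [|v l IH]; simpl; intros Hn Hi; [easy|]. inversion Hn; subst.
  destruct (eqb_cl u v) eqn:E.
  - apply (proj1 (eqb_cl_spec _ _)) in E; subst. replace (fold_right _ 0 l) with (sumR (fun w => if eqb_cl v w then f w else 0) l) by reflexivity.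
    rewrite sumR_0; [lra|]. intros w Hw. destruct (eqb_cl v w) eqn:E; auto.
    apply (proj1 (eqb_cl_spec _ _)) in E; subst; contradiction.
  - destruct Hi as [->|Hi]; [rewrite (proj2 (eqb_cl_spec u u) eq_refl) in E; easy|].
    specialize (IH H2 Hi). unfold sumR in *. lra.
Qed.

(** The vertices of a finite list are grouped by parent. Each parent [u] contributes [Cnorm2 (x u)]
    times the squared weights of its listed children, and distinct parents use distinct coordinates
    of [x]. *)
Lemma wshift_blin {V : Type} (par : V -> V) (lam : V -> R) (K : R) :
  0 <= K ->
  (forall u l, NoDup l -> (forall v, In v l -> par v = u) ->
     sumR (fun v => lam v * lam v) l <= K * K) ->
  blin (wshift par lam) K.
Proof.
  intros HK H. constructor; auto.
  - intros; vext. unfold wshift. ring.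
  - intros; vext. unfold wshift. ring.
  - intros x r [Hr Hx]; split; [nra|]. intros l Hl.
    set (U := nodup (fun u v => excluded_middle_informative (u = v)) (map par l)).
    assert (HU : NoDup U) by apply NoDup_nodup.
    rewrite (sumR_ext _ (fun v => sumR (fun u => if eqb_cl (par v) u
        then lam v * lam v * Cnorm2 (x u) else 0) U)).
    2:{ intros v Hv. rewrite (sumR_pick (fun u => lam v * lam v * Cnorm2 (x u)) (par v) U); auto.
        - unfold wshift. now rewrite Cnorm2_mul, Cnorm2_RtoC.
        - apply nodup_In, in_map, Hv. }
    rewrite sumR_exchange.
    apply Rle_trans with (sumR (fun u => K * K * Cnorm2 (x u)) U).
    + apply sumR_le. intros u _.
      rewrite (sumR_ext _ (fun v => Cnorm2 (x u) * (if eqb_cl (par v) u then lam v * lam v else 0)))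
        by (intros; destruct (eqb_cl _ _); ring).
      rewrite sumR_scal, <- (sumR_filter (fun v => lam v * lam v) (fun v => eqb_cl (par v) u)).
      rewrite Rmult_comm. apply Rmult_le_compat_r; [apply Cnorm2_ge0|].
      apply H with u; [now apply NoDup_filter|]. intros v Hv.
      apply filter_In in Hv as [_ Hv]. now apply (proj1 (eqb_cl_spec _ _)).
    + rewrite sumR_scal. specialize (Hx U HU). nra.
Qed.

(** Covers both moves without branching: along the trunk as far as the fork, and away from the fork
    along one branch. *)
Lemma wshift_delta_unique {V : Type} (par : V -> V) lam n u v :
  piter par n v = u -> (forall v', piter par n v' = u -> v' = v) ->
  Nat.iter n (wshift par lam) (delta u) = vscale (RtoC (wprod par lam n v)) (delta v).
Proof.
  intros Hv Hu. apply functional_extensionality; intro w. rewrite wshift_iter.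
  unfold vscale. destruct (excluded_middle_informative (w = v)) as [->|Hw].
  - now rewrite Hv, !delta_same.
  - rewrite (delta_other v w Hw), delta_other; [ring|]. intro E. apply Hw; auto.
Qed.

Lemma in_cl_unscale {V : Type} (T : op V) h (r : R) x :
  r <> 0 -> in_cl T h (vscale (RtoC r) x) -> in_cl T h x.
Proof.
  intros Hr H. apply (in_cl_scale _ _ (RtoC (/ r))) in H.
  replace x with (vscale (RtoC (/ r)) (vscale (RtoC r) x)); auto.
  apply functional_extensionality; intro. now apply RtoC_inv_l.
Qed.

Lemma wshift_weight_le {V : Type} (par : V -> V) lam K v :
  (forall v, 0 < lam v) -> blin (wshift par lam) K -> 0 < lam v <= K.
Proof.
  intros Hpos HT. split; auto. pose proof (blin_bound _ _ HT _ _ (nle_delta (par v))) as H.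
  apply (nle_point _ _ v) in H. unfold wshift in H.
  rewrite delta_same, Cnorm2_mul, !Cnorm2_RtoC in H.
  pose proof (Hpos v). pose proof (blin_pos _ _ HT). nra.
Qed.

(** * The bilateral shift is cyclic *)

Definition mean (f : R -> R) : R := / (2 * PI) * RInt f (- PI) PI.

Lemma ex_mean (f : R -> R) a b : continuity f -> ex_RInt f a b.
Proof.
  intro H. apply (ex_RInt_continuous (V := R_CompleteNormedModule)).
  intros t _. apply continuity_pt_filterlim, H.
Qed.

Lemma PI2_pos : 0 < / (2 * PI).
Proof. apply Rinv_0_lt_compat. pose proof PI_RGT_0; lra. Qed.

Lemma mean_plus f g : continuity f -> continuity g ->
  mean (fun t => f t + g t) = mean f + mean g.
Proof.
  intros Hf Hg. unfold mean.
  rewrite (RInt_plus (V := R_CompleteNormedModule) f g) by now apply ex_mean.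
  unfold plus; simpl; ring.
Qed.

Lemma mean_scal c f : continuity f -> mean (fun t => c * f t) = c * mean f.
Proof.
  intros Hf. unfold mean.
  rewrite (RInt_scal (V := R_CompleteNormedModule) f) by now apply ex_mean.
  unfold scal; simpl; unfold mult; simpl; ring.
Qed.

Lemma mean_ext f g : (forall t, f t = g t) -> mean f = mean g.
Proof. intro H; replace g with f; auto. now apply functional_extensionality. Qed.

Lemma mean_le f g : continuity f -> continuity g ->
  (forall t, f t <= g t) -> mean f <= mean g.
Proof.
  intros Hf Hg H. pose proof PI2_pos. unfold mean. apply Rmult_le_compat_l; [lra|].
  pose proof PI_RGT_0. apply RInt_le; try (now apply ex_mean); [lra|]. intros; apply H.
Qed.

Lemma mean_const c : mean (fun _ => c) = c.
Proof.
  unfold mean. rewrite RInt_const. unfold scal; simpl; unfold mult; simpl.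
  pose proof PI_RGT_0; field; lra.
Qed.

Lemma cont_cos k : continuity (fun t => cos (IZR k * t)).
Proof. reg. Qed.
Lemma cont_sin k : continuity (fun t => sin (IZR k * t)).
Proof. reg. Qed.

Lemma sin_IZR_PI k : sin (IZR k * PI) = 0.
Proof. apply sin_eq_0_1. now exists k. Qed.

Lemma mean_cos k : k <> 0%Z -> mean (fun t => cos (IZR k * t)) = 0.
Proof.
  intro Hk. assert (Hk' : IZR k <> 0) by (intro E; apply Hk; now apply eq_IZR).
  unfold mean.
  replace (RInt _ _ _) with (minus (sin (IZR k * PI) / IZR k) (sin (IZR k * - PI) / IZR k)).
  - replace (IZR k * - PI) with (- (IZR k * PI)) by ring.
    rewrite sin_neg, sin_IZR_PI. unfold minus, plus, opp; simpl. field.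
    pose proof PI_RGT_0; split; auto; lra.
  - symmetry. apply is_RInt_unique.
    apply (is_RInt_derive (fun t => sin (IZR k * t) / IZR k)).
    + intros t _. auto_derive; auto. field; auto.
    + intros t _. apply continuity_pt_filterlim, cont_cos.
Qed.

(** * Continuous functions on the circle and their Fourier coefficients *)

Definition contC (g : R -> C) : Prop :=
  continuity (fun t => fst (g t)) /\ continuity (fun t => snd (g t)).

Definition expi (k : Z) (t : R) : C := (cos (IZR k * t), sin (IZR k * t)).

Lemma expi_add j k t : expi (j + k) t = Cmul (expi j t) (expi k t).
Proof.
  unfold expi, Cmul; simpl. rewrite plus_IZR, Rmult_plus_distr_r, cos_plus, sin_plus.
  f_equal; ring.
Qed.

Lemma expi_0 t : expi 0 t = RtoC 1.
Proof. unfold expi, RtoC. rewrite Rmult_0_l, cos_0, sin_0. reflexivity. Qed.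

Lemma Cnorm2_expi k t : Cnorm2 (expi k t) = 1.
Proof.
  unfold Cnorm2, expi; simpl. pose proof (sin2_cos2 (IZR k * t)). unfold Rsqr in *. lra.
Qed.

Lemma contC_expi k : contC (expi k).
Proof. split; [apply cont_cos|apply cont_sin]. Qed.

Lemma contC_add f g : contC f -> contC g -> contC (fun t => Cadd (f t) (g t)).
Proof. intros [] []; split; simpl; now apply (continuity_plus (fun t => _ (f t)) (fun t => _ (g t))). Qed.

Lemma contC_mul f g : contC f -> contC g -> contC (fun t => Cmul (f t) (g t)).
Proof.
  intros [f1 f2] [g1 g2]; split; simpl.
  - apply (continuity_minus (fun t => fst (f t) * fst (g t)) (fun t => snd (f t) * snd (g t)));
    now apply (continuity_mult (fun t => _ (f t)) (fun t => _ (g t))).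
  - apply (continuity_plus (fun t => fst (f t) * snd (g t)) (fun t => snd (f t) * fst (g t)));
    now apply (continuity_mult (fun t => _ (f t)) (fun t => _ (g t))).
Qed.

Lemma contC_opp g : contC g -> contC (fun t => Copp (g t)).
Proof. intros []; split; simpl; now apply (continuity_opp (fun t => _ (g t))). Qed.

Lemma continuity_const' (c : R) : continuity (fun _ => c).
Proof. apply continuity_const. now intros ? ?. Qed.

Lemma contC_RtoC f : continuity f -> contC (fun t => RtoC (f t)).
Proof. split; simpl; auto. apply continuity_const'. Qed.

Lemma contC_const c : contC (fun _ => c).
Proof. split; apply continuity_const'. Qed.

Lemma cont_norm2 g : contC g -> continuity (fun t => Cnorm2 (g t)).
Proof.
  intros [g1 g2]. apply (continuity_plus (fun t => fst (g t) * fst (g t)) (fun t => snd (g t) * snd (g t)));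
    now apply (continuity_mult (fun t => _ (g t)) (fun t => _ (g t))).
Qed.

(* The real part of the k-th Fourier coefficient of g. *)
Definition coef (g : R -> C) (k : Z) : R :=
  mean (fun t => fst (g t) * cos (IZR k * t) + snd (g t) * sin (IZR k * t)).

Lemma cont_coef g k : contC g ->
  continuity (fun t => fst (g t) * cos (IZR k * t) + snd (g t) * sin (IZR k * t)).
Proof.
  intros [g1 g2].
  apply (continuity_plus (fun t => fst (g t) * cos (IZR k * t)) (fun t => snd (g t) * sin (IZR k * t))).
  - apply (continuity_mult (fun t => fst (g t))); auto. apply cont_cos.
  - apply (continuity_mult (fun t => snd (g t))); auto. apply cont_sin.
Qed.

Lemma coef_add f g k : contC f -> contC g ->
  coef (fun t => Cadd (f t) (g t)) k = coef f k + coef g k.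
Proof.
  intros Hf Hg. unfold coef. rewrite <- mean_plus by now apply cont_coef.
  apply mean_ext; intro t; simpl; ring.
Qed.

Lemma coef_scale c g k : contC g -> coef (fun t => Cmul (RtoC c) (g t)) k = c * coef g k.
Proof.
  intros Hg. unfold coef. rewrite <- mean_scal by now apply cont_coef.
  apply mean_ext; intro t; simpl; ring.
Qed.

Lemma coef_shift g k : coef (fun t => Cmul (expi 1 t) (g t)) k = coef g (k - 1)%Z.
Proof.
  unfold coef. apply mean_ext; intro t; simpl.
  rewrite minus_IZR. replace ((IZR k - 1) * t) with (IZR k * t - 1 * t) by ring.
  rewrite cos_minus, sin_minus. ring.
Qed.

Lemma coef_expi j k : coef (expi j) k = if Z.eq_dec j k then 1 else 0.
Proof.
  unfold coef, expi; simpl.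
  rewrite (mean_ext _ (fun t => cos (IZR (j - k) * t))).
  2:{ intro t. rewrite minus_IZR.
      replace ((IZR j - IZR k) * t) with (IZR j * t - IZR k * t) by ring.
      now rewrite cos_minus. }
  destruct Z.eq_dec as [->|H].
  - rewrite Z.sub_diag. rewrite (mean_ext _ (fun _ => 1)); [apply mean_const|].
    intro; rewrite Rmult_0_l; apply cos_0.
  - apply mean_cos; lia.
Qed.

(** Keeping only real parts leaves a real-linear map. This suffices: all scalars applied to
    functions below are real, multiplication by [expi 1] still becomes the shift, and Bessel's
    inequality survives. *)
Definition fourier (g : R -> C) : vec Z := fun k => RtoC (coef g k).

Fixpoint residual (g : R -> C) (l : list Z) : R -> C :=
  match l with
  | [] => g
  | k :: l' => fun t => Cadd (residual g l' t) (Cmul (RtoC (- coef g k)) (expi k t))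
  end.

Lemma residual_cont g l : contC g -> contC (residual g l).
Proof.
  intro Hg; induction l; simpl; auto. apply contC_add; auto.
  apply (contC_mul (fun _ => _)); [apply contC_const|apply contC_expi].
Qed.

Lemma coef_residual g l k : contC g -> ~ In k l -> coef (residual g l) k = coef g k.
Proof.
  intros Hg; induction l as [|j l IH]; simpl; intro Hk; auto.
  rewrite coef_add, coef_scale, coef_expi, IH; auto using residual_cont, contC_expi.
  - destruct Z.eq_dec; [tauto|ring].
  - apply (contC_mul (fun _ => _)); [apply contC_const|apply contC_expi].
Qed.

(** Frequencies are removed one at a time. As [k] is not in [l], the earlier subtractions have left
    its coefficient intact, and completing the square removes exactly the square of that
    coefficient. *)
Lemma energy_residual g l : contC g -> NoDup l ->
  mean (fun t => Cnorm2 (residual g l t)) =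
  mean (fun t => Cnorm2 (g t)) - sumR (fun k => coef g k * coef g k) l.
Proof.
  intros Hg; induction l as [|k l IH]; intro Hl; simpl; [ring|].
  inversion Hl; subst. set (c := coef g k).
  rewrite (mean_ext _ (fun t => Cnorm2 (residual g l t) +
    ((-2 * c) * (fst (residual g l t) * cos (IZR k * t) + snd (residual g l t) * sin (IZR k * t))
     + c * c))).
  - rewrite mean_plus, mean_plus, mean_scal, mean_const.
    + change (mean (fun t => fst (residual g l t) * cos (IZR k * t) + snd (residual g l t) * sin (IZR k * t)))
        with (coef (residual g l) k).
      rewrite coef_residual, IH by auto. fold c. unfold sumR. ring.
    + apply cont_coef; now apply residual_cont.
    + apply (continuity_scal (fun t => fst (residual g l t) * cos (IZR k * t) + snd (residual g l t) * sin (IZR k * t)) (-2 * c)).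
      apply cont_coef; now apply residual_cont.
    + apply continuity_const'.
    + apply cont_norm2; now apply residual_cont.
    + apply (continuity_plus (fun t => -2 * c * (fst (residual g l t) * cos (IZR k * t) + snd (residual g l t) * sin (IZR k * t))) (fun _ => c * c)); [|apply continuity_const'].
      apply (continuity_scal (fun t => fst (residual g l t) * cos (IZR k * t) + snd (residual g l t) * sin (IZR k * t)) (-2 * c)).
      apply cont_coef; now apply residual_cont.
  - intro t. pose proof (Cnorm2_expi k t) as Hz.
    unfold Cnorm2, expi, Cadd, Cmul, RtoC in *; simpl in *.
    replace (c * c) with (c * c * (cos (IZR k * t) * cos (IZR k * t) + sin (IZR k * t) * sin (IZR k * t)))
      by (rewrite Hz; ring). ring.
Qed.

Lemma bessel g : contC g -> nsq_le (fourier g) (mean (fun t => Cnorm2 (g t))).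
Proof.
  intros Hg l Hl. pose proof (energy_residual g l Hg Hl) as H.
  assert (0 <= mean (fun t => Cnorm2 (residual g l t))).
  { rewrite <- (mean_const 0). apply mean_le; [apply continuity_const'| |intro; apply Cnorm2_ge0].
    now apply cont_norm2, residual_cont. }
  rewrite (sumR_ext _ (fun k => coef g k * coef g k)); [lra|].
  intros; apply Cnorm2_RtoC.
Qed.

Lemma bessel_sup g B : contC g -> 0 <= B -> (forall t, Cnorm2 (g t) <= B * B) -> nle (fourier g) B.
Proof.
  intros Hg HB H. split; auto. eapply nsq_le_mono; [|now apply bessel].
  rewrite <- (mean_const (B * B)). apply mean_le; auto using cont_norm2, continuity_const'.
Qed.

Definition bshift : op Z := wshift (fun n => (n - 1)%Z) (fun _ => 1).

Lemma bshift_blin : blin bshift 1.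
Proof.
  apply wshift_blin; [lra|]. intros u [|v [|w l]] Hn H; simpl; try lra.
  inversion Hn; subst. elim H2. left. pose proof (H v (or_introl eq_refl)).
  pose proof (H w (or_intror (or_introl eq_refl))). lia.
Qed.

Lemma fourier_shift g : fourier (fun t => Cmul (expi 1 t) (g t)) = bshift (fourier g).
Proof.
  apply functional_extensionality; intro k. unfold fourier, bshift, wshift.
  rewrite coef_shift. ring.
Qed.

Lemma fourier_add f g : contC f -> contC g ->
  fourier (fun t => Cadd (f t) (g t)) = vadd (fourier f) (fourier g).
Proof.
  intros; apply functional_extensionality; intro k. unfold fourier, vadd.
  rewrite coef_add by auto. unfold Cadd, RtoC; simpl. f_equal; ring.
Qed.

Lemma fourier_scale c g : contC g ->
  fourier (fun t => Cmul (RtoC c) (g t)) = vscale (RtoC c) (fourier g).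
Proof.
  intros; apply functional_extensionality; intro k. unfold fourier, vscale.
  rewrite coef_scale by auto. apply RtoC_mul.
Qed.

Lemma fourier_sub f g : contC f -> contC g ->
  fourier (fun t => Cadd (f t) (Copp (g t))) = vsub (fourier f) (fourier g).
Proof.
  intros. rewrite vsub_alt, <- fourier_scale, <- fourier_add; auto.
  - f_equal. apply functional_extensionality; intro. cdestr. f_equal; ring.
  - apply (contC_mul (fun _ => _)); auto using contC_const.
Qed.

Lemma fourier_expi j : fourier (expi j) = delta j.
Proof.
  apply functional_extensionality; intro k. unfold fourier. rewrite coef_expi.
  destruct Z.eq_dec as [->|H]; [now rewrite delta_same|rewrite delta_other; auto].
Qed.

(** * The flat function and the multipliers of its cyclic subspace *)

Definition flat (s : R) : R := if Rle_dec s 0 then 0 else exp (- / s).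

Lemma flat_pos s : 0 < s -> flat s = exp (- / s).
Proof. intro; unfold flat; destruct Rle_dec; auto; lra. Qed.

Lemma flat_nonpos s : s <= 0 -> flat s = 0.
Proof. intro; unfold flat; destruct Rle_dec; auto; lra. Qed.

Lemma flat_bounds s : 0 <= flat s <= 1.
Proof.
  destruct (Rle_or_lt s 0).
  - rewrite flat_nonpos; lra.
  - rewrite flat_pos by auto. split; [left; apply exp_pos|].
    rewrite <- exp_0. left; apply exp_increasing. pose proof (Rinv_0_lt_compat s H); lra.
Qed.

Lemma flat_le s : flat s <= Rabs s.
Proof.
  destruct (Rle_or_lt s 0).
  - rewrite flat_nonpos by auto. apply Rabs_pos.
  - rewrite flat_pos, Rabs_right, exp_Ropp by lra.
    pose proof (Rinv_0_lt_compat s H).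
    rewrite <- (Rinv_inv s) at 2. apply Rinv_le_contravar; auto.
    pose proof (exp_ineq1_le (/ s)). lra.
Qed.

Lemma flat_cont : continuity flat.
Proof.
  intro s. destruct (Rtotal_order s 0) as [H|[->|H]].
  - apply continuity_pt_locally_ext with (fun _ => 0) (- s); [lra| |apply continuity_const'].
    intros y Hy. symmetry; apply flat_nonpos. unfold Rdist in Hy; apply Rabs_def2 in Hy; lra.
  - intros e He. exists e; split; auto. intros y [_ Hy]. simpl in *. unfold Rdist in *.
    rewrite (flat_nonpos 0), Rminus_0_r in * by lra. pose proof (flat_bounds y).
    pose proof (flat_le y). rewrite Rabs_right; lra.
  - apply continuity_pt_locally_ext with (fun x => exp (- / x)) s; auto.
    + intros y Hy. symmetry; apply flat_pos. unfold Rdist in Hy; apply Rabs_def2 in Hy; lra.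
    + apply (continuity_pt_comp (fun x => - / x) exp).
      * apply continuity_pt_opp, continuity_pt_inv; [|lra].
        apply derivable_continuous, derivable_id.
      * apply derivable_continuous, derivable_exp.
Qed.

(* [gap t = |1 - e^{it}|^2] *)
Definition gap (t : R) : R := 2 - 2 * cos t.

Definition flat_vec : vec Z := fourier (fun t => RtoC (flat (gap t))).

Definition good (u : R -> C) : Prop :=
  contC u /\ exists B, 0 <= B /\ forall t, Cnorm2 (u t) <= B * B.

Definition admissible (u : R -> C) : Prop :=
  good u /\ in_cl bshift flat_vec (fourier (fun t => Cmul (RtoC (flat (gap t))) (u t))).

(** Preserving admissibility is inherited by sums, products and Neumann series, whereas
    admissibility alone gives no access to products. The aim is to show that [expi (-1)] and
    approximate inverses of the flat function are multipliers. *)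
Definition multiplier (v : R -> C) : Prop :=
  good v /\ forall u, admissible u -> admissible (fun t => Cmul (v t) (u t)).

Lemma gap_bounds t : 0 <= gap t <= 4.
Proof. unfold gap. pose proof (COS_bound t). lra. Qed.

Lemma cont_gap : continuity gap.
Proof. unfold gap. reg. Qed.

Lemma contC_flat : contC (fun t => RtoC (flat (gap t))).
Proof.
  apply contC_RtoC. apply (continuity_comp gap flat); [apply cont_gap|apply flat_cont].
Qed.

(** This is the triangle inequality for vectors over a one-point index set. *)
Lemma Cnorm2_add_le a b A B : 0 <= A -> 0 <= B ->
  Cnorm2 a <= A * A -> Cnorm2 b <= B * B -> Cnorm2 (Cadd a b) <= (A + B) * (A + B).
Proof.
  intros HA HB Ha Hb.
  assert (Hx : nle (fun _ : unit => a) A).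
  { split; auto. intros [|[] [|[] l]] Hn; simpl; try nra. 
    inversion Hn; subst; elim H1; now left. }
  assert (Hy : nle (fun _ : unit => b) B).
  { split; auto. intros [|[] [|[] l]] Hn; simpl; try nra.
    inversion Hn; subst; elim H1; now left. }
  exact (nle_point _ _ tt (nle_vadd _ _ _ _ Hx Hy)).
Qed.

Lemma good_add u v : good u -> good v -> good (fun t => Cadd (u t) (v t)).
Proof.
  intros (Cu & A & HA & Hu) (Cv & B & HB & Hv). split; [now apply contC_add|].
  exists (A + B); split; [lra|]. intro; now apply Cnorm2_add_le.
Qed.

Lemma good_mul u v : good u -> good v -> good (fun t => Cmul (u t) (v t)).
Proof.
  intros (Cu & A & HA & Hu) (Cv & B & HB & Hv). split; [now apply contC_mul|].
  exists (A * B); split; [nra|]. intro t. rewrite Cnorm2_mul.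
  replace (A * B * (A * B)) with ((A * A) * (B * B)) by ring.
  apply Rmult_le_compat; auto using Cnorm2_ge0.
Qed.

Lemma good_const c : good (fun _ => c).
Proof.
  split; [apply contC_const|]. exists (sqrt (Cnorm2 c)); split; [apply sqrt_pos|].
  intros _; rewrite sqrt_sqrt by apply Cnorm2_ge0; lra.
Qed.

Lemma good_expi k : good (expi k).
Proof. split; [apply contC_expi|]. exists 1; split; [lra|]. intro; rewrite Cnorm2_expi; lra. Qed.

Lemma admissible_add u v : admissible u -> admissible v -> admissible (fun t => Cadd (u t) (v t)).
Proof.
  intros [Hu Fu] [Hv Fv]; split; [now apply good_add|].
  pose proof contC_flat. destruct Hu as [Cu _], Hv as [Cv _].
  replace (fun t => Cmul (RtoC (flat (gap t))) (Cadd (u t) (v t))) with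
    (fun t => Cadd (Cmul (RtoC (flat (gap t))) (u t)) (Cmul (RtoC (flat (gap t))) (v t)))
    by (apply functional_extensionality; intro; ring).
  rewrite fourier_add by now apply contC_mul. now apply in_cl_add.
Qed.

Lemma admissible_scale c u : admissible u -> admissible (fun t => Cmul (RtoC c) (u t)).
Proof.
  intros [Hu Fu]; split; [apply (good_mul (fun _ => _)); auto using good_const|].
  pose proof contC_flat. destruct Hu as [Cu _].
  replace (fun t => Cmul (RtoC (flat (gap t))) (Cmul (RtoC c) (u t))) with
    (fun t => Cmul (RtoC c) (Cmul (RtoC (flat (gap t))) (u t)))
    by (apply functional_extensionality; intro; ring).
  rewrite fourier_scale by now apply contC_mul. now apply in_cl_scale.
Qed.

Lemma admissible_one : admissible (fun _ => RtoC 1).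
Proof.
  split; [apply good_const|].
  replace (fun t => Cmul (RtoC (flat (gap t))) (RtoC 1)) with (fun t => RtoC (flat (gap t)))
    by (apply functional_extensionality; intro; ring).
  apply in_cl_self.
Qed.

(** Uniform closeness is demanded only after multiplication by the flat function, so an
    approximation may be poor near z = 1. This weighting is what lets [expi (-1)] be reached. *)
Lemma admissible_lim u : good u ->
  (forall eps, 0 < eps -> exists u', admissible u' /\
     forall t, flat (gap t) * flat (gap t) * Cnorm2 (Cadd (u t) (Copp (u' t))) <= eps * eps) ->
  admissible u.
Proof.
  intros Hu H; split; auto. pose proof contC_flat. destruct Hu as [Cu _].
  apply in_cl_lim. intros e He. destruct (H e He) as (u' & [[Cu' Bu'] Fu'] & Hb).
  exists (fourier (fun t => Cmul (RtoC (flat (gap t))) (u' t))). split; auto.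
  rewrite <- fourier_sub by now apply contC_mul.
  apply bessel_sup; [|lra|].
  - apply contC_add; [|apply contC_opp]; now apply contC_mul.
  - intro t.
    replace (Cadd _ _) with (Cmul (RtoC (flat (gap t))) (Cadd (u t) (Copp (u' t)))) by ring.
    rewrite Cnorm2_mul, Cnorm2_RtoC. apply Hb.
Qed.

Lemma multiplier_const c : multiplier (fun _ => RtoC c).
Proof. split; [apply good_const|]. intros; now apply admissible_scale. Qed.

Lemma multiplier_mul u v : multiplier u -> multiplier v -> multiplier (fun t => Cmul (u t) (v t)).
Proof.
  intros [Gu Hu] [Gv Hv]; split; [now apply good_mul|]. intros w Hw.
  replace (fun t => Cmul (Cmul (u t) (v t)) (w t)) with (fun t => Cmul (u t) (Cmul (v t) (w t)))
    by (apply functional_extensionality; intro; ring).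
  apply Hu. now apply Hv.
Qed.

Lemma multiplier_add u v : multiplier u -> multiplier v -> multiplier (fun t => Cadd (u t) (v t)).
Proof.
  intros [Gu Hu] [Gv Hv]; split; [now apply good_add|]. intros w Hw.
  replace (fun t => Cmul (Cadd (u t) (v t)) (w t)) with
    (fun t => Cadd (Cmul (u t) (w t)) (Cmul (v t) (w t)))
    by (apply functional_extensionality; intro; ring).
  apply admissible_add; auto.
Qed.

Lemma multiplier_ext u v : (forall t, u t = v t) -> multiplier u -> multiplier v.
Proof. intros H; replace v with u; auto. now apply functional_extensionality. Qed.

Lemma multiplier_z : multiplier (expi 1).
Proof.
  split; [apply good_expi|]. intros u [Gu Fu]. split; [apply good_mul; auto using good_expi|].
  replace (fun t => Cmul (RtoC (flat (gap t))) (Cmul (expi 1 t) (u t))) with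
    (fun t => Cmul (expi 1 t) (Cmul (RtoC (flat (gap t))) (u t)))
    by (apply functional_extensionality; intro; ring).
  rewrite fourier_shift. eapply in_cl_T; eauto using bshift_blin.
Qed.

(** The Neumann series of [y = 1 / (1 - v)]: the partial sums satisfy [w' = 1 + v w], so their
    distance to [y] shrinks by the factor [k] at each step. *)
Lemma multiplier_inv v y k : multiplier v -> good y -> 0 <= k < 1 ->
  (forall t, Cnorm2 (v t) <= k * k) ->
  (forall t, y t = Cadd (RtoC 1) (Cmul (v t) (y t))) -> multiplier y.
Proof.
  intros Hv Gy Hk Hvk Hy. split; auto. intros u Hu.
  apply admissible_lim; [apply good_mul; auto; apply Hu|].
  intros e He. destruct Gy as (Cy & A & HA & By). destruct Hu as [Gu Fu].
  pose proof Gu as (Cu & B & HB & Bu).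
  assert (HS : forall n, exists w, multiplier w /\
    forall t, Cnorm2 (Cadd (y t) (Copp (w t))) <= (k ^ n * A) * (k ^ n * A)).
  { induction n as [|n (w & Hw & IH)].
    - exists (fun _ => RtoC 0). split; [apply multiplier_const|]. intro t.
      replace (Cadd _ _) with (y t) by (change (RtoC 0) with C0; ring).
      simpl. rewrite Rmult_1_l. apply By.
    - exists (fun t => Cadd (RtoC 1) (Cmul (v t) (w t))). split.
      + apply (multiplier_add (fun _ => _)); [apply multiplier_const|now apply multiplier_mul].
      + intro t. rewrite (Hy t) at 1.
        replace (Cadd _ _) with (Cmul (v t) (Cadd (y t) (Copp (w t)))) by ring.
        rewrite Cnorm2_mul. simpl.
        replace (k * k ^ n * A * (k * k ^ n * A)) with (k * k * (k ^ n * A * (k ^ n * A))) by ring.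
        apply Rmult_le_compat; auto using Cnorm2_ge0. }
  destruct (pow_lt_1_zero k) with (y := e / (A * B + 1)) as [N HN].
  - rewrite Rabs_right; lra.
  - apply Rdiv_lt_0_compat; nra.
  - destruct (HS N) as (w & [Gw Hw] & Hwb).
    exists (fun t => Cmul (w t) (u t)). split; [apply Hw; split; auto|]. intro t.
    specialize (HN N (le_n N)). 
    assert (0 <= k ^ N) by (apply pow_le; lra). rewrite Rabs_right in HN by lra.
    replace (Cadd _ _) with (Cmul (Cadd (y t) (Copp (w t))) (u t)) by ring.
    rewrite Cnorm2_mul. specialize (Hwb t). specialize (Bu t).
    assert (Cnorm2 (Cadd (y t) (Copp (w t))) * Cnorm2 (u t) <= (k ^ N * A * (k ^ N * A)) * (B * B))
      by (apply Rmult_le_compat; auto using Cnorm2_ge0).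
    assert (k ^ N * (A * B) <= e).
    { replace e with (e / (A * B + 1) * (A * B + 1)) by (field; nra).
      apply Rmult_le_compat; nra. }
    pose proof (flat_bounds (gap t)).
    assert (0 <= Cnorm2 (Cadd (y t) (Copp (w t))) * Cnorm2 (u t))
      by (apply Rmult_le_pos; apply Cnorm2_ge0).
    assert (0 <= k ^ N * (A * B)) by (apply Rmult_le_pos; nra).
    assert (k ^ N * A * (k ^ N * A) * (B * B) <= e * e).
    { replace (k ^ N * A * (k ^ N * A) * (B * B)) with ((k ^ N * (A * B)) * (k ^ N * (A * B))) by ring.
      apply Rmult_le_compat; auto. }
    assert (flat (gap t) * flat (gap t) <= 1) by nra. nra.
Qed.

(* [dist2 r t = |1 - r e^{it}|^2] *)
Definition dist2 (r t : R) : R := (1 - r) * (1 - r) + r * gap t.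

Lemma dist2_alt r t : dist2 r t = (1 - r * cos t) * (1 - r * cos t) + (r * sin t) * (r * sin t).
Proof.
  unfold dist2, gap. pose proof (sin2_cos2 t). unfold Rsqr in H.
  replace (r * sin t * (r * sin t)) with (r * r * (sin t * sin t)) by ring.
  replace (sin t * sin t) with (1 - cos t * cos t) by lra. ring.
Qed.

Lemma dist2_pos r t : 0 <= r < 1 -> 0 < dist2 r t.
Proof. intro H. unfold dist2. pose proof (gap_bounds t). nra. Qed.

(** The function [1 / (1 - r z)], written as conjugate over squared modulus. *)
Definition resolvent (r t : R) : C :=
  Cmul (RtoC (/ dist2 r t)) (1 - r * cos t, r * sin t).

Lemma resolvent_eq r t : 0 <= r < 1 ->
  Cmul (Cadd (RtoC 1) (Copp (Cmul (RtoC r) (expi 1 t)))) (resolvent r t) = RtoC 1.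
Proof.
  intro H. pose proof (dist2_pos r t H) as Hd. unfold resolvent.
  rewrite dist2_alt in *.
  unfold expi, Cmul, Cadd, Copp, RtoC; simpl. rewrite !Rmult_1_l. f_equal; field; lra.
Qed.

Lemma resolvent_norm2 r t : 0 <= r < 1 -> Cnorm2 (resolvent r t) = / dist2 r t.
Proof.
  intro H. pose proof (dist2_pos r t H) as Hd. unfold resolvent.
  rewrite Cnorm2_mul, Cnorm2_RtoC.
  replace (Cnorm2 (1 - r * cos t, r * sin t)) with (dist2 r t).
  - field; lra.
  - rewrite dist2_alt. unfold Cnorm2; simpl; ring.
Qed.

Lemma cont_dist2_inv r : 0 <= r < 1 -> continuity (fun t => / dist2 r t).
Proof.
  intro H. apply (continuity_inv (dist2 r)).
  - unfold dist2, gap. reg.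
  - intro t. pose proof (dist2_pos r t H); lra.
Qed.

Lemma multiplier_resolvent r : 0 <= r < 1 -> multiplier (resolvent r).
Proof.
  intro H. apply multiplier_inv with (fun t => Cmul (RtoC r) (expi 1 t)) r; auto.
  - apply (multiplier_mul (fun _ => _)); [apply multiplier_const|apply multiplier_z].
  - split.
    + apply contC_mul.
      * apply contC_RtoC. now apply cont_dist2_inv.
      * split; simpl; reg.
    + exists (/ (1 - r)). split; [left; apply Rinv_0_lt_compat; lra|]. intro t.
      rewrite resolvent_norm2, <- Rinv_mult by auto. apply Rinv_le_contravar; [nra|].
      unfold dist2. pose proof (gap_bounds t). nra.
  - intro t. rewrite Cnorm2_mul, Cnorm2_RtoC, Cnorm2_expi. lra.
  - intro t. rewrite <- (resolvent_eq r t H) at 1. ring.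
Qed.

Fixpoint Cpow (a : C) (n : nat) : C :=
  match n with O => RtoC 1 | S n' => Cmul a (Cpow a n') end.

Lemma Cnorm2_pow a n : Cnorm2 (Cpow a n) = Cnorm2 a ^ n.
Proof. induction n; simpl; [rewrite Cnorm2_RtoC; ring|]. now rewrite Cnorm2_mul, IHn. Qed.

Lemma multiplier_pow v n : multiplier v -> multiplier (fun t => Cpow (v t) n).
Proof.
  intro H; induction n; simpl; [apply multiplier_const|now apply multiplier_mul].
Qed.

(* [(1 - rho z) / (1 - r z)]; it equals 1 at the origin, so its powers are
   [1 + z v] with [v] again a multiplier. *)
Definition damp (rho r t : R) : C :=
  Cadd (RtoC 1) (Cmul (expi 1 t) (Cmul (RtoC (r - rho)) (resolvent r t))).

Lemma damp_norm2 rho r t : 0 <= r < 1 ->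
  Cnorm2 (damp rho r t) = dist2 rho t / dist2 r t.
Proof.
  intro H. unfold damp.
  replace (Cadd _ _) with (Cmul (Cadd (RtoC 1) (Copp (Cmul (RtoC rho) (expi 1 t)))) (resolvent r t)).
  - rewrite Cnorm2_mul, resolvent_norm2 by auto. unfold Rdiv; f_equal.
    rewrite dist2_alt. unfold expi, Cmul, Cadd, Copp, RtoC, Cnorm2; simpl.
    rewrite Rmult_1_l. ring.
  - rewrite <- (resolvent_eq r t H) at 2. generalize (resolvent r t), (expi 1 t); intros a b.
    cdestr; f_equal; ring.
Qed.

Lemma damp_pow rho r n : 0 <= r < 1 -> exists v, multiplier v /\
  forall t, Cpow (damp rho r t) n = Cadd (RtoC 1) (Cmul (expi 1 t) (v t)).
Proof.
  intro H; induction n as [|n (v & Hv & E)].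
  - exists (fun _ => RtoC 0); split; [apply multiplier_const|]. intro; simpl.
    change (RtoC 0) with C0; ring.
  - set (w := fun t => Cmul (RtoC (r - rho)) (resolvent r t)).
    assert (Hw : multiplier w) by (apply (multiplier_mul (fun _ => _)); auto using multiplier_const, multiplier_resolvent).
    exists (fun t => Cadd (w t) (Cadd (v t) (Cmul (expi 1 t) (Cmul (w t) (v t))))). split.
    + exact (multiplier_add _ _ Hw (multiplier_add _ _ Hv
        (multiplier_mul _ _ multiplier_z (multiplier_mul _ _ Hw Hv)))).
    + intro t. simpl. rewrite E. unfold damp, w. ring.
Qed.

(** With [s = gap t], the squared modulus of the n-th power of [damp] is at most [exp (1 / s)] times
    [exp (- (m - 1) / 2)]. The square of the flat function, [exp (-2 / s)], absorbs the first
    factor, and the second is as small as desired. *)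
Lemma damp_small eps : 0 < eps -> exists v, multiplier v /\ forall t,
  flat (gap t) * flat (gap t) * Cnorm2 (Cadd (RtoC 1) (Cmul (expi 1 t) (v t))) <= eps.
Proof.
  intro He.
  (* The final estimate is [exp (- (m - 1) / 2) <= 1 / (1 + (m - 1) / 2)], which this choice of [m]
     puts below [eps]. *)
  destruct (INR_unbounded (2 + 2 / eps)) as [m Hm].
  assert (0 < 2 / eps) by (apply Rdiv_lt_0_compat; lra).
  assert (Hm2 : 2 < INR m) by lra.
  assert (Hinv : 0 < / INR m) by (apply Rinv_0_lt_compat; lra).
  assert (Hinv2 : / INR m < / 2) by (apply Rinv_lt_contravar; lra).
  set (rho := 1 - / INR m). set (r := 1 - / (2 * INR m)).
  assert (Hhalf : / (2 * INR m) = / INR m / 2) by (field; lra).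
  assert (Hr : 0 <= r < 1) by (unfold r; rewrite Hhalf; lra).
  set (n := (m * (m - 1))%nat).
  assert (Hn : INR n = INR m * (INR m - 1)).
  { unfold n. rewrite mult_INR, minus_INR; [simpl; ring|]. apply INR_le; simpl; lra. }
  destruct (damp_pow rho r n Hr) as (v & Hv & E). exists v; split; auto. intro t.
  rewrite <- E, Cnorm2_pow, damp_norm2 by auto.
  destruct (Rle_or_lt (gap t) 0) as [Hg|Hg]; [rewrite flat_nonpos by auto; lra|].
  rewrite flat_pos by auto. set (s := gap t) in *.
  assert (0 < / s) by now apply Rinv_0_lt_compat.
  (* The constants are tuned for this quotient. As [rho / (1 - rho)^2 = n], the numerator is
     [rho (s + 1 / n)]; the denominator is at least [r s]; and [rho <= r^2]. Hence the quotient is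
     at most [r (1 + 1 / (n s))], and [1 + x <= exp x] applies to both factors. *)
  assert (Hb : dist2 rho t / dist2 r t <= exp (- (/ (2 * INR m)) + / INR n * / s)).
  { rewrite exp_plus.
    apply Rle_trans with ((1 - / (2 * INR m)) * (1 + / INR n * / s)).
    - unfold dist2. fold s. apply Rmult_le_reg_r with ((1 - r) * (1 - r) + r * s); [nra|].
      unfold Rdiv. rewrite Rmult_assoc, Rinv_l, Rmult_1_r by nra.
      change (1 - / (2 * INR m)) with r.
      assert (Hrho : rho * (/ INR n) = (1 - rho) * (1 - rho)).
      { rewrite Hn. unfold rho. field. split; lra. }
      assert (Hrr : rho <= r * r).
      { unfold rho, r. rewrite Hhalf. nra. }
      assert (Hn0 : 0 < INR n) by (rewrite Hn; nra).
      assert (0 < / INR n) by now apply Rinv_0_lt_compat.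
      apply Rle_trans with (r * (1 + / INR n * / s) * (r * s)).
      + replace (r * (1 + / INR n * / s) * (r * s)) with (r * r * (s + / INR n)) by (field; split; lra).
        rewrite <- Hrho. replace (rho * / INR n + rho * s) with (rho * (s + / INR n)) by ring.
        apply Rmult_le_compat_r; lra.
      + apply Rmult_le_compat_l; [|nra]. apply Rmult_le_pos; [lra|].
        assert (0 < / INR n * / s) by now apply Rmult_lt_0_compat. lra.
    - apply Rmult_le_compat.
      + fold r; lra.
      + assert (0 < / INR n) by (apply Rinv_0_lt_compat; rewrite Hn; nra).
        assert (0 < / INR n * / s) by now apply Rmult_lt_0_compat. lra.
      + pose proof (exp_ineq1_le (- / (2 * INR m))). lra.
      + apply exp_ineq1_le. }
  apply Rle_trans with (exp (- / s) * exp (- / s) * exp (- ((INR m - 1) / 2) + / s)).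
  - apply Rmult_le_compat_l; [apply Rmult_le_pos; left; apply exp_pos|].
    replace (- ((INR m - 1) / 2) + / s) with (INR n * (- (/ (2 * INR m)) + / INR n * / s)).
    + apply Rle_trans with (exp (- / (2 * INR m) + / INR n * / s) ^ n).
      * apply pow_incr. split; auto. apply Rmult_le_pos.
        -- unfold dist2; fold s. unfold rho. nra.
        -- left; apply Rinv_0_lt_compat. now apply dist2_pos.
      * clear. generalize (- / (2 * INR m) + / INR n * / s) as x; intro x.
        right. generalize n as k; intro k. induction k; [simpl; now rewrite Rmult_0_l, exp_0|].
        rewrite S_INR. simpl. rewrite IHk, <- exp_plus. f_equal; ring.
    + rewrite Hn. field. repeat split; lra.
  - rewrite <- !exp_plus.
    apply Rle_trans with (exp (- ((INR m - 1) / 2))).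
    + replace (- / s + - / s + (- ((INR m - 1) / 2) + / s)) with (- ((INR m - 1) / 2) - / s) by ring.
      left; apply exp_increasing. lra.
    + rewrite exp_Ropp. rewrite <- (Rinv_inv eps). apply Rinv_le_contravar.
      * now apply Rinv_0_lt_compat.
      * apply Rle_trans with (1 + (INR m - 1) / 2); [|apply exp_ineq1_le].
        unfold Rdiv in *. lra.
Qed.

(** From [zbar + v = zbar (1 + z v)], the multiplier [- v] approximates [zbar] in the weighted sense
    as soon as [1 + z v] is small in that sense, which [damp_small] supplies. *)
Lemma multiplier_zbar : multiplier (expi (-1)).
Proof.
  split; [apply good_expi|]. intros u Hu. pose proof Hu as [Gu Fu].
  apply admissible_lim; [apply good_mul; auto using good_expi|]. intros e He.
  destruct Gu as (Cu & B & HB & Bu).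
  destruct (damp_small (e * e / (B * B + 1))) as (v & Hv & Hb).
  { apply Rdiv_lt_0_compat; nra. }
  exists (fun t => Cmul (RtoC (-1)) (Cmul (v t) (u t))). split.
  - apply admissible_scale, Hv, Hu.
  - intro t. replace (Cadd _ _) with
      (Cmul (expi (-1) t) (Cmul (Cadd (RtoC 1) (Cmul (expi 1 t) (v t))) (u t))).
    + rewrite !Cnorm2_mul, Cnorm2_expi. specialize (Hb t). specialize (Bu t).
      set (q := Cnorm2 (Cadd (RtoC 1) (Cmul (expi 1 t) (v t)))) in *.
      assert (0 <= q) by apply Cnorm2_ge0. pose proof (Cnorm2_ge0 (u t)).
      pose proof (flat_bounds (gap t)).
      assert (0 <= flat (gap t) * flat (gap t) * q) by (apply Rmult_le_pos; nra).
      replace (flat (gap t) * flat (gap t) * (1 * (q * Cnorm2 (u t)))) with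
        (flat (gap t) * flat (gap t) * q * Cnorm2 (u t)) by ring.
      apply Rle_trans with (e * e / (B * B + 1) * (B * B + 1)).
      * apply Rmult_le_compat; auto; lra.
      * right; field; nra.
    + assert (Hz : Cmul (expi (-1) t) (expi 1 t) = RtoC 1) by (rewrite <- expi_add; apply expi_0).
      transitivity (Cadd (Cmul (expi (-1) t) (u t)) (Cmul (Cmul (expi (-1) t) (expi 1 t)) (Cmul (v t) (u t)))); [ring|].
      rewrite Hz. generalize (Cmul (v t) (u t)), (Cmul (expi (-1) t) (u t)); intros. cdestr; f_equal; ring.
Qed.

Lemma multiplier_expi j : multiplier (expi j).
Proof.
  assert (H : forall n : nat, multiplier (expi (Z.of_nat n)) /\ multiplier (expi (- Z.of_nat n))).
  { induction n as [|n [IH1 IH2]].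
    - split; (eapply multiplier_ext; [|apply (multiplier_const 1)]); intro; symmetry; apply expi_0.
    - rewrite Nat2Z.inj_succ. split.
      + eapply multiplier_ext; [|exact (multiplier_mul _ _ multiplier_z IH1)].
        intro; simpl. rewrite <- expi_add. f_equal; lia.
      + eapply multiplier_ext; [|exact (multiplier_mul _ _ multiplier_zbar IH2)].
        intro; simpl. rewrite <- expi_add. f_equal; lia. }
  destruct (H (Z.abs_nat j)) as [H1 H2]. destruct (Z.le_ge_cases 0 j).
  - replace j with (Z.of_nat (Z.abs_nat j)) by lia. exact H1.
  - replace j with (- Z.of_nat (Z.abs_nat j))%Z by lia. exact H2.
Qed.

Lemma multiplier_gap : multiplier (fun t => RtoC (gap t)).
Proof.
  eapply multiplier_ext.
  2:{ exact (multiplier_add _ _ (multiplier_const 2)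
        (multiplier_mul _ _ (multiplier_const (-1)) (multiplier_add _ _ (multiplier_expi 1) (multiplier_expi (-1))))). }
  intro t. unfold gap, expi, Cadd, Cmul, RtoC; simpl.
  replace (-1 * t) with (- t) by ring. rewrite Rmult_1_l, cos_neg, sin_neg. f_equal; ring.
Qed.

Lemma multiplier_gap_inv eta : 0 < eta -> multiplier (fun t => RtoC (/ (gap t + eta))).
Proof.
  intro He. set (M := 4 + eta).
  assert (Hy : multiplier (fun t => RtoC (M * / (gap t + eta)))).
  (* Since [gap] takes values in [0, 4] and [M = 4 + eta], the function
     [1 - (gap + eta) / M = (4 - gap) / M] lies between 0 and [4 / M < 1]. *)
  { apply multiplier_inv with (fun t => RtoC (1 - (gap t + eta) / M)) (4 / M).
    - eapply multiplier_ext.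
      2:{ exact (multiplier_add _ _ (multiplier_const (4 / M))
           (multiplier_mul _ _ (multiplier_const (- / M)) multiplier_gap)). }
      intro t. unfold Cadd, Cmul, RtoC; simpl. f_equal; [|ring]. unfold M; field; lra.
    - split.
      + apply contC_RtoC, (continuity_scal (fun t => / (gap t + eta))).
        apply (continuity_inv (fun t => gap t + eta)).
        * apply (continuity_plus gap (fun _ => eta)); [apply cont_gap|apply continuity_const'].
        * intro t; pose proof (gap_bounds t); lra.
      + exists (M * / eta). assert (0 < / eta) by now apply Rinv_0_lt_compat.
        split; [unfold M; nra|]. intro t. rewrite Cnorm2_RtoC. pose proof (gap_bounds t).
        assert (0 < / (gap t + eta)) by (apply Rinv_0_lt_compat; lra).
        assert (/ (gap t + eta) <= / eta) by (apply Rinv_le_contravar; lra).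
        apply Rmult_le_compat; unfold M in *; nra.
    - unfold M. split; [apply Rmult_le_pos; [lra|left; apply Rinv_0_lt_compat; lra]|].
      apply Rmult_lt_reg_r with (4 + eta); [lra|]. unfold Rdiv. rewrite Rmult_assoc, Rinv_l; lra.
    - intro t. rewrite Cnorm2_RtoC. pose proof (gap_bounds t).
      assert (0 < / M) by (apply Rinv_0_lt_compat; unfold M; lra).
      assert (1 - (gap t + eta) / M = (4 - gap t) * / M) as -> by (unfold M; field; unfold M in *; lra).
      unfold Rdiv. assert (0 <= (4 - gap t) * / M <= 4 * / M) by nra. nra.
    - intro t. pose proof (gap_bounds t). unfold Cadd, Cmul, RtoC; simpl. f_equal; [|ring].
      unfold M; field; lra. }
  eapply multiplier_ext; [|exact (multiplier_mul _ _ (multiplier_const (/ M)) Hy)].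
  intro t; simpl. pose proof (gap_bounds t). rewrite <- RtoC_mul. f_equal. unfold M; field. lra.
Qed.

(** * Approximate inverses of the flat function *)

Lemma RInt_le_const g a b c : continuity g -> a <= b ->
  (forall t, a < t < b -> g t <= c) -> RInt g a b <= c * (b - a).
Proof.
  intros Hg Hab H. replace (c * (b - a)) with (RInt (fun _ => c) a b).
  - apply RInt_le; auto; apply ex_mean; auto using continuity_const'.
  - rewrite RInt_const. unfold scal; simpl; unfold mult; simpl; ring.
Qed.

Lemma mean_concentrated g eps d : continuity g -> 0 < d < PI -> 0 <= eps ->
  (forall t, g t <= 1) -> (forall t, d <= Rabs t <= PI -> g t <= eps) ->
  mean g <= eps + d.
Proof.
  intros Hg Hd He H1 H2. unfold mean.
  rewrite <- (RInt_Chasles g (- PI) (- d) PI) by now apply ex_mean.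
  rewrite <- (RInt_Chasles g (- d) d PI) by now apply ex_mean.
  unfold plus; simpl.
  assert (RInt g (- PI) (- d) <= eps * (- d - - PI)).
  { apply RInt_le_const; auto; [lra|]. intros t Ht. apply H2. rewrite Rabs_left; lra. }
  assert (RInt g (- d) d <= 1 * (d - - d)) by (apply RInt_le_const; auto; lra).
  assert (RInt g d PI <= eps * (PI - d)).
  { apply RInt_le_const; auto; [lra|]. intros t Ht. apply H2. rewrite Rabs_right; lra. }
  apply Rle_trans with (/ (2 * PI) * (2 * PI * eps + 2 * d)).
  - apply Rmult_le_compat_l; [left; apply PI2_pos|]. nra.
  - replace (/ (2 * PI) * (2 * PI * eps + 2 * d)) with (eps + d * / PI) by (field; lra).
    assert (/ PI <= 1).
    { rewrite <- Rinv_1. apply Rinv_le_contravar; [lra|]. pose proof PI2_1; lra. }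
    nra.
Qed.

(** The second factor is an approximate inverse of the flat function: [(1 + x / m)^m] stands for
    [exp x], to remain polynomial in a known multiplier, and [x = 1 / (gap + eta)] stands for the
    unbounded [1 / gap]. *)
Definition window (m : nat) (eta t : R) : R :=
  flat (gap t) * (1 + / (gap t + eta) / INR m) ^ m.

Lemma exp_pow_INR x n : exp x ^ n = exp (INR n * x).
Proof.
  induction n; [simpl; now rewrite Rmult_0_l, exp_0|].
  rewrite S_INR. simpl. rewrite IHn, <- exp_plus. f_equal; ring.
Qed.

Lemma bernoulli x n : 0 <= x <= 1 -> 1 - INR n * x <= (1 - x) ^ n.
Proof.
  intro H; induction n; [simpl; lra|]. rewrite S_INR. simpl.
  assert (0 <= (1 - x) ^ n) by (apply pow_le; lra).
  pose proof (pos_INR n). nra.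
Qed.

Lemma window_bounds m eta t : (0 < m)%nat -> 0 < eta -> 0 <= window m eta t <= 1.
Proof.
  intros Hm He. unfold window. apply lt_INR in Hm; simpl in Hm.
  pose proof (gap_bounds t). pose proof (flat_bounds (gap t)).
  assert (Hx : 0 < / (gap t + eta)) by (apply Rinv_0_lt_compat; lra).
  set (x := / (gap t + eta)) in *.
  assert (0 < x / INR m) by (apply Rdiv_lt_0_compat; lra).
  split; [apply Rmult_le_pos; [lra|apply pow_le; lra]|].
  destruct (Rle_or_lt (gap t) 0) as [Hg|Hg]; [rewrite flat_nonpos by auto; lra|].
  rewrite flat_pos by auto.
  apply Rle_trans with (exp (- / gap t) * exp x).
  - apply Rmult_le_compat_l; [left; apply exp_pos|].
    replace x with (INR m * (x / INR m)) at 2 by (field; lra).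
    rewrite <- exp_pow_INR. apply pow_incr. split; [lra|]. apply exp_ineq1_le.
  - rewrite <- exp_plus, <- exp_0.
    assert (x <= / gap t) by (apply Rinv_le_contravar; lra).
    destruct (Req_dec (- / gap t + x) 0) as [->|]; [lra|]. left; apply exp_increasing; lra.
Qed.

(** The first error term comes from replacing [1 / s] by [1 / (s + eta)], the second from replacing
    [exp x] by [(1 + x / m)^m]. *)
Lemma window_near_one m eta t sigma : (0 < m)%nat -> 0 < eta -> 0 < sigma <= gap t ->
  / eta <= INR m ->
  1 - window m eta t <= eta / (sigma * sigma) + / (eta * eta) / INR m.
Proof.
  intros Hm He Hs Hem. unfold window. apply lt_INR in Hm; simpl in Hm.
  rewrite flat_pos by lra. set (s := gap t) in *.
  assert (Hx : 0 < / (s + eta)) by (apply Rinv_0_lt_compat; lra).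
  assert (Hx2 : / (s + eta) <= / eta) by (apply Rinv_le_contravar; lra).
  assert (Hss : / s - / (s + eta) <= eta / (sigma * sigma)).
  { replace (/ s - / (s + eta)) with (eta * / (s * (s + eta))) by (field; lra).
    apply Rmult_le_compat_l; [lra|]. apply Rinv_le_contravar; nra. }
  assert (Hss0 : 0 <= / s - / (s + eta)).
  { assert (/ (s + eta) <= / s) by (apply Rinv_le_contravar; lra). lra. }
  set (x := / (s + eta)) in *.
  assert (Him : 0 < / INR m) by now apply Rinv_0_lt_compat.
  assert (Hxm : 0 < x / INR m) by (apply Rmult_lt_0_compat; lra).
  assert (Hxm1 : x / INR m <= 1).
  { apply Rmult_le_reg_r with (INR m); auto. unfold Rdiv. rewrite Rmult_assoc, Rinv_l; lra. }
  (* With [y = x / m], the inequality [exp y (1 - y) <= 1] gives [exp y (1 - y^2) <= 1 + y]; raising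
     it to the power [m] and applying Bernoulli's inequality to [(1 - y^2)^m] finishes. *)
  assert (Hpow : exp x * (1 - x * x / INR m) <= (1 + x / INR m) ^ m).
  { replace x with (INR m * (x / INR m)) at 1 by (field; lra). rewrite <- exp_pow_INR.
    apply Rle_trans with (exp (x / INR m) ^ m * (1 - (x / INR m) * (x / INR m)) ^ m).
    - apply Rmult_le_compat_l; [apply pow_le; left; apply exp_pos|].
      replace (x * x / INR m) with (INR m * (x / INR m * (x / INR m))) by (field; lra).
      apply bernoulli. nra.
    - rewrite <- Rpow_mult_distr. pose proof (exp_pos (x / INR m)).
      apply pow_incr. split; [apply Rmult_le_pos; nra|].
      assert (exp (x / INR m) * (1 - x / INR m) <= 1).
      { pose proof (exp_ineq1_le (- (x / INR m))).
        apply Rle_trans with (exp (x / INR m) * exp (- (x / INR m))).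
        - apply Rmult_le_compat_l; lra.
        - rewrite <- exp_plus, Rplus_opp_r, exp_0; lra. }
      nra. }
  assert (Hb : x * x / INR m <= / (eta * eta) / INR m).
  { apply Rmult_le_compat_r; [lra|]. rewrite Rinv_mult. nra. }
  assert (0 <= x * x / INR m) by (apply Rmult_le_pos; [nra|lra]).
  (* In the second alternative the claimed bound already exceeds 1, and the window is
     nonnegative. *)
  assert (Hfin : (1 - (/ s - x)) * (1 - x * x / INR m) <= exp (- / s) * (1 + x / INR m) ^ m \/ 1 < x * x / INR m).
  { destruct (Rle_or_lt (x * x / INR m) 1) as [H1|H1]; [left|now right].
    apply Rle_trans with (exp (- / s) * (exp x * (1 - x * x / INR m))).
    - rewrite <- Rmult_assoc, <- exp_plus. apply Rmult_le_compat_r; [lra|].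
      pose proof (exp_ineq1_le (- / s + x)). lra.
    - apply Rmult_le_compat_l; auto. left; apply exp_pos. }
  assert (0 <= exp (- / s) * (1 + x / INR m) ^ m).
  { apply Rmult_le_pos; [left; apply exp_pos|apply pow_le; lra]. }
  destruct Hfin as [Hfin|Hfin]; nra.
Qed.

Lemma gap_away d t : 0 < d < PI -> d <= Rabs t <= PI -> gap d <= gap t.
Proof.
  intros Hd Ht. unfold gap.
  assert (cos t <= cos d); [|lra].
  replace (cos t) with (cos (Rabs t)).
  - destruct (Req_dec d (Rabs t)) as [->|]; [lra|].
    left; apply cos_decreasing_1; lra.
  - unfold Rabs; destruct Rcase_abs; auto. apply cos_neg.
Qed.

Lemma gap_pos d : 0 < d < PI -> 0 < gap d.
Proof.
  intro H. unfold gap. assert (cos d < cos 0) by (apply cos_decreasing_1; lra).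
  rewrite cos_0 in *. lra.
Qed.

Lemma Cpow_RtoC x n : Cpow (RtoC x) n = RtoC (x ^ n).
Proof. induction n; simpl; auto. now rewrite IHn, RtoC_mul. Qed.

Lemma window_multiplier m eta : 0 < eta ->
  multiplier (fun t => RtoC ((1 + / (gap t + eta) / INR m) ^ m)).
Proof.
  intro He.
  eapply multiplier_ext; [|apply (multiplier_pow _ m (multiplier_add _ _ (multiplier_const 1)
    (multiplier_mul _ _ (multiplier_const (/ INR m)) (multiplier_gap_inv eta He))))].
  intro t. simpl. rewrite <- Cpow_RtoC. f_equal. unfold Cadd, Cmul, RtoC; simpl.
  f_equal; unfold Rdiv; ring.
Qed.

(** The window times [expi j] is the flat function times an admissible one. As
    [0 <= 1 - window <= 1], the mean square error is at most the mean of [1 - window], so only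
    convergence in mean is needed and the failure at z = 1 is harmless. *)
Lemma bshift_cl_delta j : in_cl bshift flat_vec (delta j).
Proof.
  apply in_cl_lim. intros e He.
  (* The squared error [e * e] has three shares: [d <= e * e / 2] for the arc [|t| < d], and off
     that arc, where [gap >= sigma], one share [e * e / 4] controlled by [eta] and one controlled by
     [m]. The minimum with 1 keeps [d < PI]. *)
  set (d := Rmin (e * e / 2) 1).
  assert (Hee : 0 < e * e) by nra.
  assert (Hd : 0 < d < PI).
  { unfold d. split; [apply Rmin_glb_lt; lra|].
    pose proof (Rmin_r (e * e / 2) 1). pose proof PI2_1; lra. }
  assert (Hd2 : d <= e * e / 2) by apply Rmin_l.
  set (sigma := gap d). assert (Hs : 0 < sigma) by now apply gap_pos.
  set (eta := e * e / 4 * (sigma * sigma)).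
  assert (Heta : 0 < eta) by (unfold eta; apply Rmult_lt_0_compat; nra).
  assert (Hieta : 0 < / (eta * eta)) by (apply Rinv_0_lt_compat; nra).
  destruct (INR_unbounded (/ eta + / (eta * eta) / (e * e / 4))) as [m Hm].
  assert (0 < / eta) by now apply Rinv_0_lt_compat.
  assert (0 < / (eta * eta) / (e * e / 4)) by (apply Rdiv_lt_0_compat; lra).
  assert (Hm0 : (0 < m)%nat) by (apply INR_lt; simpl; lra).
  destruct (window_multiplier m eta Heta) as [_ Hw].
  pose proof (proj2 (multiplier_expi j) _ admissible_one) as Hj.
  destruct (Hw _ Hj) as [[Cw _] Fw].
  exists (fourier (fun t => Cmul (RtoC (flat (gap t)))
     (Cmul (RtoC ((1 + / (gap t + eta) / INR m) ^ m)) (Cmul (expi j t) (RtoC 1))))).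
  split; [exact Fw|].
  rewrite <- fourier_expi, <- fourier_sub.
  2: apply contC_expi.
  2: apply contC_mul; [apply contC_flat|exact Cw].
  assert (Hdiff := contC_add _ _ (contC_expi j) (contC_opp _ (contC_mul _ _ contC_flat Cw))).
  set (g := fun t => 1 - window m eta t).
  assert (Hcg : continuity g).
  { apply (continuity_minus (fun _ => 1) (window m eta)); [apply continuity_const'|].
    apply (continuity_mult (fun t => flat (gap t)) (fun t => (1 + / (gap t + eta) / INR m) ^ m)).
    - apply (proj1 contC_flat).
    - apply (proj1 (proj1 (proj1 (window_multiplier m eta Heta)))). }
  split; [lra|]. eapply nsq_le_mono; [|apply bessel].
  - apply Rle_trans with (mean g).
    + apply mean_le.
      * exact (cont_norm2 _ Hdiff).
      * exact Hcg.
      * intro t. replace (Cadd _ _) with (Cmul (RtoC (g t)) (expi j t)).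
        -- rewrite Cnorm2_mul, Cnorm2_RtoC, Cnorm2_expi.
           pose proof (window_bounds m eta t Hm0 Heta). unfold g; nra.
        -- unfold g, window. generalize (expi j t); intro.
           generalize (flat (gap t)), ((1 + / (gap t + eta) / INR m) ^ m); intros.
           cdestr; f_equal; ring.
    + apply Rle_trans with (e * e / 2 + d); [|lra].
      apply mean_concentrated; auto; [lra| |].
      * intro t; pose proof (window_bounds m eta t Hm0 Heta). unfold g; lra.
      * intros t Ht. unfold g.
        eapply Rle_trans; [apply (window_near_one m eta t sigma); auto|].
        -- split; auto. now apply gap_away.
        -- lra.
        -- replace (eta / (sigma * sigma)) with (e * e / 4) by (unfold eta; field; lra).
           assert (/ (eta * eta) / INR m <= e * e / 4); [|lra].
           apply Rmult_le_reg_r with (INR m); [lra|].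
           unfold Rdiv at 1. rewrite Rmult_assoc, Rinv_l, Rmult_1_r by lra.
           apply Rle_trans with (e * e / 4 * (/ (eta * eta) / (e * e / 4))).
           ++ right; field. split; lra.
           ++ apply Rmult_le_compat_l; lra.
  - exact Hdiff.
Qed.

Lemma bshift_cyclic : cyclic bshift.
Proof.
  apply (cyclic_intro bshift flat_vec); [|apply bshift_cl_delta].
  eexists. apply bessel, contC_flat.
Qed.

(** * Bilateral weighted shifts *)

Definition zpred (n : Z) : Z := (n - 1)%Z.

(** The solution of [cumw n = w n * cumw (n - 1)] with value 1 at 0. The diagonal operator with
    these entries intertwines [bshift] with the shift of weights [w]. *)
Definition cumw (w : Z -> R) (n : Z) : R :=
  if Z_le_dec 0 n then wprod zpred w (Z.to_nat n) n
  else / wprod zpred w (Z.to_nat (- n)) 0%Z.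

Lemma piter_zpred n k : piter zpred n k = (k - Z.of_nat n)%Z.
Proof.
  revert k; induction n; intro k; simpl; [lia|]. rewrite IHn. unfold zpred; lia.
Qed.

Lemma cumw_step w n : (forall k, 0 < w k) -> cumw w n = w n * cumw w (n - 1)%Z.
Proof.
  intro H. unfold cumw. destruct (Z_le_dec 0 n) as [Hn|Hn], (Z_le_dec 0 (n - 1)) as [Hm|Hm]; try lia.
  - replace (Z.to_nat n) with (S (Z.to_nat (n - 1))) by lia. reflexivity.
  - replace n with 0%Z by lia. simpl. field. apply Rgt_not_eq, H.
  - replace (Z.to_nat (- (n - 1))) with (Z.to_nat (- n) + 1)%nat by lia.
    rewrite wprod_add, piter_zpred. simpl.
    replace (- Z.of_nat (Z.to_nat (- n)))%Z with n by lia.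
    field. split; [apply Rgt_not_eq, H|apply Rgt_not_eq, wprod_pos, H].
Qed.

Lemma cumw_pos w n : (forall k, 0 < w k) -> 0 < cumw w n.
Proof.
  intro H. unfold cumw. destruct Z_le_dec; [|apply Rinv_0_lt_compat]; now apply wprod_pos.
Qed.

Definition diag {V : Type} (d : V -> R) (x : vec V) : vec V := fun v => Cmul (RtoC (d v)) (x v).

Lemma diag_blin {V : Type} (d : V -> R) K :
  0 <= K -> (forall v, 0 <= d v <= K) -> blin (diag d) K.
Proof.
  intros HK Hd. constructor; auto.
  - intros; vext. unfold diag. ring.
  - intros; vext. unfold diag. ring.
  - intros x r [Hr Hx]. split; [nra|]. intros l Hl. specialize (Hx l Hl).
    apply Rle_trans with (sumR (fun v => K * K * Cnorm2 (x v)) l).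
    + apply sumR_le. intros v _. unfold diag. rewrite Cnorm2_mul, Cnorm2_RtoC.
      apply Rmult_le_compat_r; [apply Cnorm2_ge0|]. pose proof (Hd v). nra.
    + rewrite sumR_scal. nra.
Qed.

Lemma zshift_blin w K : 0 <= K -> (forall n, 0 < w n <= K) -> blin (wshift zpred w) K.
Proof.
  intros HK H. apply wshift_blin; auto.
  intros u [|v [|v' l]] Hn Hp; simpl; [nra| |].
  - pose proof (H v); nra.
  - inversion Hn; subst. elim H2. left. pose proof (Hp v (or_introl eq_refl)).
    pose proof (Hp v' (or_intror (or_introl eq_refl))). unfold zpred in *; lia.
Qed.

(** The diagonal intertwiner is bounded: forward entries are products of weights at most 1, backward
    entries are reciprocals of the products bounded below by [d]. *)
Lemma bilateral_cyclic (w : Z -> R) (d : R) :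
  (forall n, 0 < w n <= 1) -> 0 < d -> (forall n, d <= wprod zpred w n 0%Z) ->
  cyclic (wshift zpred w).
Proof.
  intros Hw Hd Hp.
  assert (Hw0 : forall n, 0 < w n) by apply Hw.
  assert (Hid : 0 < / d) by now apply Rinv_0_lt_compat.
  apply (cyclic_quasi_affine bshift _ (diag (cumw w)) (1 + / d) 1).
  - apply diag_blin; [lra|]. intro n. split; [left; now apply cumw_pos|].
    unfold cumw. destruct Z_le_dec.
    + pose proof (wprod_le1 zpred w (Z.to_nat n) n Hw). lra.
    + assert (/ wprod zpred w (Z.to_nat (- n)) 0%Z <= / d) by (apply Rinv_le_contravar; auto). lra.
  - apply zshift_blin; auto; lra.
  - intro x. apply functional_extensionality; intro n. unfold diag, bshift, wshift.
    rewrite (cumw_step w n Hw0), RtoC_mul. unfold zpred. ring.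
  - intro n. exists (delta n), (RtoC (cumw w n)). repeat split; auto using delta_l2.
    + apply functional_extensionality; intro k. unfold diag, vscale.
      destruct (Z.eq_dec k n) as [->|Hk]; auto. rewrite delta_other by auto. ring.
    + intro E. apply (f_equal fst) in E. simpl in E. pose proof (cumw_pos w n Hw0). lra.
  - apply bshift_cyclic.
Qed.

(** * Trunks with rapidly decaying orbits *)

(** The tree is recoded through its parent map, because iterates of the shift see it only through
    [piter]. *)
Record forked {V : Type} (par : V -> V) (u0 c1 c2 : V) : Prop := {
  fk_acyclic : forall n v, piter par (S n) v <> v;
  fk_connected : forall v, exists m n, piter par m v = piter par n u0;
  fk_single : forall v v', par v = par v' -> par v <> u0 -> v = v';
  fk_c1 : par c1 = u0;
  fk_c2 : par c2 = u0;
  fk_neq : c1 <> c2;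
  fk_fork : forall v, par v = u0 -> v = c1 \/ v = c2 }.

Section Forked.
Context {V : Type} (par : V -> V) (u0 c1 c2 : V) (F : forked par u0 c1 c2).

Lemma piter_inj m n v : piter par m v = piter par n v -> m = n.
Proof.
  assert (H : forall m k, piter par (m + S k) v <> piter par m v).
  { intros i k. rewrite piter_add. apply (fk_acyclic _ _ _ _ F). }
  intro E. destruct (Nat.lt_trichotomy m n) as [Hl|[->|Hl]]; auto; exfalso.
  - apply (H m (n - m - 1)%nat). rewrite E. f_equal; lia.
  - apply (H n (m - n - 1)%nat). rewrite <- E. f_equal; lia.
Qed.

Lemma trunk_child n v : par v = piter par (S n) u0 -> v = piter par n u0.
Proof.
  intro E. apply (fk_single _ _ _ _ F).
  - now rewrite E, piter_S.
  - rewrite E. apply (fk_acyclic _ _ _ _ F).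
Qed.

Lemma trunk_descendant m n v : piter par m v = piter par (m + n) u0 -> v = piter par n u0.
Proof.
  revert n v; induction m; intros n v E; simpl in E; auto.
  apply trunk_child. apply IHm. rewrite E.
  change (piter par (m + n) (par u0)) with (piter par (S (m + n)) u0).
  f_equal; lia.
Qed.

Lemma branch_unique d c v v' : par c = u0 ->
  piter par d v = c -> piter par d v' = c -> v = v'.
Proof.
  intro Hc; revert v v'; induction d; simpl; intros v v' E E'; [congruence|].
  apply (fk_single _ _ _ _ F); auto. intro E0. rewrite E0 in E.
  apply (fk_acyclic _ _ _ _ F d u0). rewrite piter_S. congruence.
Qed.

Lemma vertex_cases v : (exists n, v = piter par n u0) \/
  exists d, piter par d v = c1 \/ piter par d v = c2.
Proof.
  destruct (fk_connected _ _ _ _ F v) as (m & n & E). revert v E.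
  induction m; simpl; intros v E; [left; eauto|].
  destruct (IHm _ E) as [[[|k] Hk]|[d Hd]].
  - right. exists 0%nat. now apply (fk_fork _ _ _ _ F).
  - left. exists k. now apply trunk_child.
  - right. exists (S d). exact Hd.
Qed.

Context (lam : V -> R) (Hpos : forall v, 0 < lam v <= 1).
Let T := wshift par lam.
Context (HT : blin T 1).
Let Hpos0 : forall v, 0 < lam v := fun v => proj1 (Hpos v).
Let a n := piter par n u0.
Let c n := wprod par lam n u0.

(* Chosen so that the terms after the k-th one sum to at most
   [alpha k * c (2 ^ k) * (1 / 2) ^ k]. *)
Fixpoint alpha (k : nat) : R :=
  match k with
  | O => 1
  | S k' => alpha k' * c (2 ^ k') * (1 / 2) ^ k
  end.

Lemma c_bounds n : 0 < c n <= 1.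
Proof. split; [now apply wprod_pos|now apply wprod_le1]. Qed.

Lemma half_pow_bounds k : 0 < (1 / 2) ^ k <= 1.
Proof. induction k; simpl; lra. Qed.

Lemma alpha_pos k : 0 < alpha k.
Proof.
  induction k; cbn [alpha]; [lra|]. pose proof (c_bounds (2 ^ k)). pose proof (half_pow_bounds (S k)).
  apply Rmult_lt_0_compat; [apply Rmult_lt_0_compat|]; tauto.
Qed.

Lemma alpha_half k : 2 * alpha (S k) <= alpha k.
Proof.
  cbn [alpha pow]. pose proof (c_bounds (2 ^ k)). pose proof (half_pow_bounds k).
  pose proof (alpha_pos k).
  assert (c (2 ^ k) * (1 / 2) ^ k <= 1) by nra. nra.
Qed.

Lemma alpha_le k : alpha k <= (1 / 2) ^ k.
Proof.
  induction k; [simpl; lra|]. pose proof (alpha_half k). cbn [pow]. lra.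
Qed.

Fixpoint partial_sum (N : nat) : vec V :=
  match N with
  | O => vzero
  | S N' => vadd (partial_sum N') (vscale (RtoC (alpha N')) (delta (a (2 ^ N'))))
  end.

Lemma nle_scaled_delta r (v : V) : 0 <= r -> nle (vscale (RtoC r) (delta v)) r.
Proof.
  intro H. replace r with (r * 1) at 2 by ring. apply nle_vscale; auto using nle_delta.
  rewrite Cnorm2_RtoC; lra.
Qed.

(** The bound telescopes, since [alpha k <= 2 * alpha k - 2 * alpha (S k)] by [alpha_half]. *)
Lemma partial_sum_diff N m : nle (vsub (partial_sum (N + m)) (partial_sum N)) (2 * alpha N - 2 * alpha (N + m)).
Proof.
  induction m.
  - rewrite Nat.add_0_r. replace (vsub _ _) with (@vzero V) by vext.
    replace (_ - _) with 0 by ring. apply nle_zero.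
  - rewrite Nat.add_succ_r. cbn [partial_sum].
    replace (vsub _ _) with (vadd (vsub (partial_sum (N + m)) (partial_sum N))
       (vscale (RtoC (alpha (N + m))) (delta (a (2 ^ (N + m)))))) by vext.
    eapply nle_mono; [|apply nle_vadd; [exact IHm|apply nle_scaled_delta]].
    + pose proof (alpha_half (N + m)). lra.
    + left; apply alpha_pos.
Qed.

(** At most one term touches a given coordinate, trunk vertices at different depths being distinct.
    The limit vector can therefore be taken coordinatewise as an eventual value. *)
Lemma partial_sum_stable v : exists N0, forall N, (N0 <= N)%nat -> partial_sum N v = partial_sum N0 v.
Proof.
  assert (H : forall N0, (forall i, (N0 <= i)%nat -> v <> a (2 ^ i)) ->
     forall N, (N0 <= N)%nat -> partial_sum N v = partial_sum N0 v).
  { intros N0 Hi N HN. induction HN; auto. cbn [partial_sum]. unfold vadd, vscale.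
    rewrite IHHN, delta_other by auto. ring. }
  destruct (classic (exists i, v = a (2 ^ i))) as [[i ->]|Hn].
  - exists (S i). apply H. intros j Hj E. apply piter_inj in E.
    apply Nat.pow_inj_r in E; lia.
  - exists 0%nat. apply H. intros i _ E. eauto.
Qed.

Definition partial_sum_lim : vec V :=
  fun v => partial_sum (proj1_sig (constructive_indefinite_description _ (partial_sum_stable v))) v.

Lemma partial_sum_lim_eventually v : exists N0, forall N, (N0 <= N)%nat -> partial_sum N v = partial_sum_lim v.
Proof.
  unfold partial_sum_lim. destruct constructive_indefinite_description as [N0 H]; simpl. eauto.
Qed.

Lemma partial_sum_lim_approx N : nle (vsub partial_sum_lim (partial_sum N)) (2 * alpha N).
Proof.
  split; [pose proof (alpha_pos N); lra|]. intros l Hl.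
  assert (H : exists M, (N <= M)%nat /\ forall v, In v l -> partial_sum M v = partial_sum_lim v).
  { clear Hl. assert (exists N0, forall M, (N0 <= M)%nat -> forall v, In v l -> partial_sum M v = partial_sum_lim v) as [N0 H].
    { induction l as [|v l [N0 IH]]; [exists 0%nat; easy|].
      destruct (partial_sum_lim_eventually v) as [N1 H1]. exists (max N0 N1).
      intros M HM w [<-|Hw]; [apply H1; lia|apply IH; auto; lia]. }
    exists (max N N0). split; [lia|]. apply H; lia. }
  destruct H as (M & HM & H).
  destruct (partial_sum_diff N (M - N)) as [H0 Hd]. replace (N + (M - N))%nat with M in * by lia.
  pose proof (alpha_pos M). pose proof (alpha_pos N).
  apply Rle_trans with ((2 * alpha N - 2 * alpha M) * (2 * alpha N - 2 * alpha M)); [|nra].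
  rewrite (sumR_ext _ (fun v => Cnorm2 (vsub (partial_sum M) (partial_sum N) v))); [now apply Hd|].
  intros v Hv. unfold vsub. now rewrite H.
Qed.

(** [tau] is a common decay bound for the orbits of the fork and of the additional vector [z], later
    [delta c1]. At time [2 ^ k - j] every term with index below [k] passed the fork at least
    [2 ^ (k - 1) - j] steps ago; at that age the bound must be negligible against the dominant
    coefficient [alpha k * c (2 ^ k)]. *)
Context (z : vec V) (tau : nat -> R)
  (tau_mono : forall m n, (m <= n)%nat -> tau n <= tau m)
  (tau_u0 : forall d, nle (Nat.iter d T (delta u0)) (tau d))
  (tau_z : forall d, nle (Nat.iter d T z) (tau d))
  (tau_small : forall j eps, 0 < eps -> exists k0, forall k, (k0 <= k)%nat ->
     tau (2 ^ (k - 1) - j)%nat <= eps * (alpha k * c (2 ^ k))).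

Lemma iter_trunk m j :
  Nat.iter m T (delta (a (m + j))) = vscale (RtoC (wprod par lam m (a j))) (delta (a j)).
Proof.
  apply wshift_delta_unique.
  - unfold a. now rewrite <- piter_add, Nat.add_comm.
  - intros v E. now apply trunk_descendant in E.
Qed.

Lemma iter_trunk_deep i m : (i <= m)%nat -> nle (Nat.iter m T (delta (a i))) (tau (m - i)).
Proof.
  intro H.
  assert (E : Nat.iter m T (delta (a i)) = Nat.iter (m - i) T (Nat.iter i T (delta (a (i + 0))))).
  { rewrite Nat.add_0_r, <- Nat.iter_add. now replace (m - i + i)%nat with m by lia. }
  rewrite E, iter_trunk.
  rewrite (blin_scale _ _ (blin_iter T 1 (m - i) HT)).
  replace (tau (m - i)) with (1 * tau (m - i)) by ring. apply nle_vscale; [lra| |apply tau_u0].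
  rewrite Cnorm2_RtoC. pose proof (c_bounds i). unfold c in *. unfold a; simpl. nra.
Qed.

Lemma tau_ge0 d : 0 <= tau d.
Proof. apply (tau_u0 d). Qed.

(** The factor [2 - 2 * alpha i] is a telescoping bound for the sum of the first [i]
    coefficients. *)
Lemma iter_partial_sum k j m : (j <= 2 ^ (k - 1))%nat -> (1 <= k)%nat -> m = (2 ^ k - j)%nat ->
  forall i, (i <= k)%nat ->
  nle (Nat.iter m T (partial_sum i)) ((2 - 2 * alpha i) * tau (2 ^ (k - 1) - j)).
Proof.
  intros Hj Hk Hm. set (t := tau (2 ^ (k - 1) - j)).
  pose proof (tau_ge0 (2 ^ (k - 1) - j)) as Ht.
  induction i as [|i IH]; intro Hi.
  - cbn [partial_sum alpha]. rewrite (blin_zero _ _ (blin_iter T 1 m HT)).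
    replace (_ * t) with 0 by ring. apply nle_zero.
  - cbn [partial_sum]. rewrite (blin_add _ _ (blin_iter T 1 m HT)), (blin_scale _ _ (blin_iter T 1 m HT)).
    assert (E : (2 ^ k = 2 * 2 ^ (k - 1))%nat).
    { replace k with (S (k - 1)) at 1 by lia. reflexivity. }
    assert (Hp : (2 ^ i <= 2 ^ (k - 1))%nat) by (apply Nat.pow_le_mono_r; lia).
    pose proof (alpha_pos i). pose proof (alpha_half i).
    eapply nle_mono; [|apply nle_vadd; [apply IH; lia|apply nle_vscale with (k := alpha i) (r := t)]].
    + fold t in Ht. nra.
    + lra.
    + rewrite Cnorm2_RtoC; lra.
    + eapply nle_mono; [|apply iter_trunk_deep; lia]. apply tau_mono. lia.
Qed.

Let h := vadd z partial_sum_lim.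

Lemma h_l2 : l2 h.
Proof.
  apply l2_nle. eexists. apply nle_vadd.
  - apply (tau_z 0).
  - replace partial_sum_lim with (vsub partial_sum_lim (partial_sum 0)) by (simpl; vext). apply partial_sum_lim_approx.
Qed.

Lemma trunk_in_cl j : in_cl T h (delta (a j)).
Proof.
  apply in_cl_lim. intros e He.
  (* The value [t] of the decay bound enters three times, once for [z] and twice for the earlier
     terms, and is allowed half of the error. The other half goes to the later terms, of total size
     at most [alpha k * c (2 ^ k) * (1 / 2) ^ k]. *)
  destruct (tau_small j (e / 6)) as [k0 Hk0]; [lra|].
  destruct (pow_lt_1_zero (1 / 2)) with (y := e / 2) as [k1 Hk1];
    [rewrite Rabs_right; lra|lra|].
  set (k := (k0 + k1 + j + 1)%nat).
  assert (Hj : (j <= 2 ^ (k - 1))%nat).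
  { apply Nat.le_trans with (2 ^ j)%nat; [apply Nat.lt_le_incl, Nat.pow_gt_lin_r; lia|].
    apply Nat.pow_le_mono_r; unfold k; lia. }
  assert (E : (2 ^ k = 2 * 2 ^ (k - 1))%nat).
  { replace k with (S (k - 1)) at 1 by (unfold k; lia). reflexivity. }
  specialize (Hk0 k ltac:(unfold k; lia)). specialize (Hk1 k ltac:(unfold k; lia)).
  pose proof (half_pow_bounds k). rewrite Rabs_right in Hk1 by lra.
  set (m := (2 ^ k - j)%nat). set (t := tau (2 ^ (k - 1) - j)) in *.
  set (w := wprod par lam m (a j)).
  (* [c (2 ^ k)] is the product of [c j <= 1] and [w], so dividing by [alpha k * w] loses nothing
     against the bounds stated with [c (2 ^ k)]. *)
  assert (Hw : c (2 ^ k) <= w).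
  { unfold c, w. replace (2 ^ k)%nat with (j + m)%nat by (unfold m; lia).
    rewrite wprod_add. fold (a j). pose proof (c_bounds j). unfold c in *.
    assert (0 < wprod par lam m (a j)) by now apply wprod_pos. nra. }
  pose proof (c_bounds (2 ^ k)) as Hc. pose proof (alpha_pos k) as Ha.
  assert (Haw : 0 < alpha k * w) by nra.
  assert (Hac : 0 < alpha k * c (2 ^ k)) by nra.
  exists (vscale (RtoC (/ (alpha k * w))) (Nat.iter m T h)). split.
  - apply in_cl_scale, (in_cl_iter _ _ 1); auto. apply in_cl_self.
  - pose proof (blin_iter T 1 m HT) as HTm.
    assert (Eh : h = vadd (vadd z (partial_sum k))
       (vadd (vscale (RtoC (alpha k)) (delta (a (2 ^ k)))) (vsub partial_sum_lim (partial_sum (S k))))).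
    { unfold h. cbn [partial_sum]. vext. }
    assert (Hn : nle (vsub (vscale (RtoC (alpha k * w)) (delta (a j))) (Nat.iter m T h))
       (t + 2 * t + alpha k * c (2 ^ k) * (1 / 2) ^ k)).
    { rewrite Eh, !(blin_add _ _ HTm), (blin_scale _ _ HTm).
      replace (2 ^ k)%nat with (m + j)%nat at 1 by (unfold m; lia).
      rewrite iter_trunk. fold w.
      replace (vsub _ _) with (vsub vzero
        (vadd (vadd (Nat.iter m T z) (Nat.iter m T (partial_sum k)))
              (Nat.iter m T (vsub partial_sum_lim (partial_sum (S k)))))).
      2:{ rewrite RtoC_mul. vext. }
      eapply nle_mono; [|apply nle_vsub; [apply nle_zero|apply nle_vadd; [apply nle_vadd|]]].
      2: apply tau_z.
      2: apply (iter_partial_sum k j m); auto; unfold k; lia.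
      2: apply (blin_bound _ _ HTm), partial_sum_lim_approx.
      fold t. rewrite pow1.
      assert (tau m <= t) by (apply tau_mono; unfold m; lia).
      pose proof (tau_ge0 (2 ^ (k - 1) - j)) as Ht. fold t in Ht.
      cbn [alpha pow]. nra. }
    replace (vsub _ _) with (vscale (RtoC (/ (alpha k * w)))
       (vsub (vscale (RtoC (alpha k * w)) (delta (a j))) (Nat.iter m T h))).
    2:{ apply functional_extensionality; intro v. unfold vsub, vscale.
        rewrite <- (RtoC_inv_l (alpha k * w) (delta (a j) v)) at 2 by lra. ring. }
    assert (Hi : 0 < / (alpha k * w)) by now apply Rinv_0_lt_compat.
    apply nle_mono with (/ (alpha k * w) *
      (t + 2 * t + alpha k * c (2 ^ k) * (1 / 2) ^ k)).
    2:{ apply nle_vscale; auto; [lra|]. rewrite Cnorm2_RtoC; lra. }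
    apply Rmult_le_reg_l with (alpha k * w); auto.
    rewrite <- Rmult_assoc, Rinv_r, Rmult_1_l by lra.
    apply Rle_trans with (alpha k * c (2 ^ k) * e).
    2:{ apply Rmult_le_compat_r; [lra|]. apply Rmult_le_compat_l; lra. }
    assert (alpha k * c (2 ^ k) * (1 / 2) ^ k <= alpha k * c (2 ^ k) * (e / 2)) by nra.
    nra.
Qed.

Lemma z_in_cl : in_cl T h z.
Proof.
  replace z with (vsub h partial_sum_lim) by (unfold h; vext).
  apply in_cl_sub; [apply in_cl_self|]. apply in_cl_lim. intros e He.
  destruct (pow_lt_1_zero (1 / 2)) with (y := e / 2) as [k Hk];
    [rewrite Rabs_right; lra|lra|].
  specialize (Hk k (le_n k)). pose proof (half_pow_bounds k). rewrite Rabs_right in Hk by lra.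
  exists (partial_sum k). split.
  - clear Hk. induction k as [|k IH]; cbn [partial_sum]; [apply in_cl_zero|].
    apply in_cl_add; [apply IH, half_pow_bounds|]. apply in_cl_scale, trunk_in_cl.
  - eapply nle_mono; [|apply partial_sum_lim_approx]. pose proof (alpha_le k). lra.
Qed.

Lemma forked_cyclic_aux : z = delta c1 -> cyclic T.
Proof.
  intro Ez. apply (cyclic_intro T h h_l2).
  assert (H1 : in_cl T h (delta c1)) by (rewrite <- Ez; apply z_in_cl).
  (* The image of the fork vector is a combination of both child vectors, and one of them is already
     available. *)
  assert (H2 : in_cl T h (delta c2)).
  { pose proof (in_cl_T _ _ 1 _ HT (trunk_in_cl 0)) as H.
    assert (E : T (delta (a 0)) =
      vadd (vscale (RtoC (lam c1)) (delta c1)) (vscale (RtoC (lam c2)) (delta c2))).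
    { apply functional_extensionality; intro v. unfold T, wshift, vadd, vscale, a. simpl.
      pose proof (fk_neq _ _ _ _ F) as Hne.
      destruct (excluded_middle_informative (par v = u0)) as [Hv|Hv].
      - rewrite Hv, delta_same.
        destruct (fk_fork _ _ _ _ F v Hv) as [-> | ->].
        + rewrite delta_same, (delta_other c2 c1) by auto. ring.
        + rewrite delta_same, (delta_other c1 c2) by auto. ring.
      - rewrite (delta_other u0) by auto.
        rewrite !delta_other; [ring| |].
        + intros ->. apply Hv, (fk_c2 _ _ _ _ F).
        + intros ->. apply Hv, (fk_c1 _ _ _ _ F). }
    rewrite E in H.
    apply in_cl_unscale with (lam c2); [pose proof (Hpos0 c2); lra|].
    replace (vscale (RtoC (lam c2)) (delta c2)) with
      (vsub (vadd (vscale (RtoC (lam c1)) (delta c1)) (vscale (RtoC (lam c2)) (delta c2)))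
         (vscale (RtoC (lam c1)) (delta c1))) by vext.
    apply in_cl_sub; auto. now apply in_cl_scale. }
  assert (Hb : forall b d v, par b = u0 -> in_cl T h (delta b) -> piter par d v = b ->
    in_cl T h (delta v)).
  { intros b d v Hb Hcl Hd. apply in_cl_unscale with (wprod par lam d v).
    - apply Rgt_not_eq. now apply wprod_pos.
    - rewrite <- (wshift_delta_unique par lam d b v); auto.
      + now apply (in_cl_iter _ _ 1).
      + intros v' Hv'. now apply (branch_unique d b). }
  intro v. destruct (vertex_cases v) as [[n ->]|[d [Hd|Hd]]].
  - apply trunk_in_cl.
  - apply (Hb c1 d); auto. apply (fk_c1 _ _ _ _ F).
  - apply (Hb c2 d); auto. apply (fk_c2 _ _ _ _ F).
Qed.

End Forked.

Theorem forked_cyclic {V : Type} (par : V -> V) (u0 c1 c2 : V) (lam : V -> R) (tau : nat -> R) :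
  forked par u0 c1 c2 -> (forall v, 0 < lam v <= 1) -> blin (wshift par lam) 1 ->
  (forall m n, (m <= n)%nat -> tau n <= tau m) ->
  (forall d, nle (Nat.iter d (wshift par lam) (delta u0)) (tau d)) ->
  (forall d, nle (Nat.iter d (wshift par lam) (delta c1)) (tau d)) ->
  (forall j eps, 0 < eps -> exists k0, forall k, (k0 <= k)%nat ->
     tau (2 ^ (k - 1) - j)%nat <= eps * (alpha par u0 lam k * wprod par lam (2 ^ k) u0)) ->
  cyclic (wshift par lam).
Proof.
  intros F Hpos HT H1 H2 H3 H4.
  exact (forked_cyclic_aux par u0 c1 c2 F lam Hpos HT (delta c1) tau H1 H2 H3 H4 eq_refl).
Qed.

(** * Attaching a finite branch *)

Lemma nle_partial {V W : Type} (g : V -> option W) (x : vec W) r :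
  (forall v v' w, g v = Some w -> g v' = Some w -> v = v') -> nle x r ->
  nle (fun v => match g v with Some w => x w | None => C0 end) r.
Proof.
  intros Hg [Hr Hx]; split; auto. intros l Hl.
  set (pm := flat_map (fun v => match g v with Some w => [w] | None => [] end)).
  assert (Hin : forall w m, In w (pm m) -> exists v, In v m /\ g v = Some w).
  { intros w m Hw. apply in_flat_map in Hw as (v & Hv & Hw). exists v; split; auto.
    destruct (g v); [destruct Hw as [->|[]]; auto|easy]. }
  assert (Hn : NoDup (pm l)).
  { induction Hl as [|v l Hv Hl IH]; simpl; [constructor|].
    destruct (g v) as [w|] eqn:E; auto. constructor; auto. intro Hw.
    apply Hin in Hw as (v' & Hv' & E'). rewrite (Hg v v' w) in Hv; auto. }
  apply Rle_trans with (sumR (fun w => Cnorm2 (x w)) (pm l)); [|now apply Hx].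
  right. clear. induction l as [|v l IH]; simpl; auto. unfold sumR in *.
  destruct (g v); simpl; rewrite IH; auto. rewrite Cnorm2_C0; ring.
Qed.

Definition parM {k0 : nat} (v : MV k0) : MV k0 :=
  match v with
  | inl j => inl (j - 1)%Z
  | inr (exist O _) => inl 0%Z
  | inr (exist (S k) p) => inr (exist _ k (Nat.lt_succ_l k k0 p))
  end.

Lemma sig_lt_eq k0 (a b : {k : nat | (k < k0)%nat}) : proj1_sig a = proj1_sig b -> a = b.
Proof.
  destruct a as [a p], b as [b q]; simpl; intros ->. f_equal. apply le_unique.
Qed.

Lemma Em_parM k0 (a b : MV k0) : Em k0 a b <-> parM b = a.
Proof.
  destruct a as [i|[i p]], b as [j|[[|j] q]]; simpl; split; intro H; try easy.
  - now subst.
  - now injection H.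
  - destruct H as [-> _]. reflexivity.
  - injection H as <-. auto.
  - f_equal. apply sig_lt_eq. simpl. lia.
  - injection H as H. lia.
Qed.

Lemma piter_inr k0 n (v : MV k0) q : piter parM n v = inr q ->
  exists p, v = inr p /\ proj1_sig p = (proj1_sig q + n)%nat.
Proof.
  revert v; induction n; intros v E; simpl in E.
  - exists q; split; auto; lia.
  - apply IHn in E as (p & E & Hp). destruct v as [j|[[|k] Hk]]; simpl in E; try easy.
    injection E as E. exists (exist _ (S k) Hk); split; auto. simpl.
    rewrite <- E in Hp. simpl in Hp. lia.
Qed.

Section Appendix.
Context {k0 : nat} (lam : MV k0 -> R) (Hpos : forall v, 0 < lam v)
  (K : R) (HS : blin (wshift parM lam) K).
Let SM := wshift parM lam.
Let w : Z -> R := fun n => lam (inl n).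
Let W := wshift zpred w.

Lemma spine_blin : blin W K.
Proof. apply zshift_blin; [apply (blin_pos _ _ HS)|]. intro n; exact (wshift_weight_le parM lam K (inl n) Hpos HS). Qed.

(** The spine is closed under parents, so restricting coordinates to it intertwines the two shifts
    exactly. *)
Lemma cyclic_restrict : cyclic SM -> cyclic W.
Proof.
  apply (cyclic_quasi_affine SM W (fun x n => x (inl n)) 1 K).
  - constructor; auto; [lra|]. intros x r Hx. rewrite Rmult_1_l.
    apply (nle_comp_inj (fun n : Z => inl n : MV k0)); auto. congruence.
  - apply spine_blin.
  - auto.
  - intro n. exists (delta (inl n)), (RtoC 1). repeat split; auto using delta_l2.
    + apply functional_extensionality; intro m. unfold vscale.
      rewrite (delta_inj (fun n : Z => inl n : MV k0)) by congruence. ring.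
    + intro E; apply (f_equal fst) in E; simpl in E; lra.
Qed.

(** Compares the weights from the vertex 0 up to one branch vertex with those up to the spine vertex
    at the same height. This is the factor forced by the requirement that a copy of the spine values
    on the branch commute with the shifts. *)
Definition branch_ratio (p : {k : nat | (k < k0)%nat}) : R :=
  wprod parM lam (1 + proj1_sig p) (inr p) /
  wprod zpred w (1 + proj1_sig p) (Z.of_nat (1 + proj1_sig p)).

Lemma branch_ratio_pos p : 0 < branch_ratio p.
Proof. apply Rdiv_lt_0_compat; apply wprod_pos; unfold w; auto. Qed.

Lemma branch_ratio_bounded : exists B, 0 <= B /\ forall p, branch_ratio p <= B.
Proof.
  assert (H : forall n, exists B, 0 <= B /\ forall p, (proj1_sig p < n)%nat -> branch_ratio p <= B).
  { induction n as [|n (B & HB & IH)]; [exists 0; split; [lra|lia]|].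
    destruct (lt_dec n k0) as [Hn|Hn].
    - exists (B + branch_ratio (exist _ n Hn)). pose proof (branch_ratio_pos (exist _ n Hn)). split; [lra|].
      intros p Hp. destruct (Nat.eq_dec (proj1_sig p) n) as [E|E].
      + replace p with (exist (fun k => (k < k0)%nat) n Hn) by now apply sig_lt_eq. lra.
      + specialize (IH p ltac:(lia)). lra.
    - exists B; split; auto. intros p Hp. apply IH. pose proof (proj2_sig p). simpl in *. lia. }
  destruct (H k0) as (B & HB & HB'). exists B; split; auto. intro p; apply HB'.
  exact (proj2_sig p).
Qed.

(* With N the shift inside the branch and R the coupling from the vertex 0 into it,
   this is the graph of the solution X of [X W - N X = R]. *)
Definition lift (x : vec Z) : vec (MV k0) := fun v =>
  match v with
  | inl n => x n
  | inr p => Cmul (RtoC (branch_ratio p)) (x (Z.of_nat (1 + proj1_sig p)))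
  end.

Lemma lift_blin : exists B, blin lift B.
Proof.
  destruct branch_ratio_bounded as (B & HB & Hratio). exists (1 + B). constructor.
  - intros; vext. unfold lift. destruct x0; unfold vadd; ring.
  - intros; vext. unfold lift. destruct x0; unfold vscale; ring.
  - lra.
  - intros x r Hx.
    set (gl := fun v : MV k0 => match v with inl n => Some n | inr _ => None end).
    set (gr := fun v : MV k0 => match v with inl n => None | inr p => Some (Z.of_nat (1 + proj1_sig p)) end).
    set (d := fun v : MV k0 => match v with inl n => 0 | inr p => branch_ratio p end).
    replace (lift x) with (vadd (fun v => match gl v with Some n => x n | None => C0 end)
       (diag d (fun v => match gr v with Some n => x n | None => C0 end))).
    + replace ((1 + B) * r) with (r + B * r) by ring. apply nle_vadd.
      * apply nle_partial; auto. intros [v|p] [v'|p'] n; simpl; congruence.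
      * apply (blin_bound _ B).
        -- apply diag_blin; auto. intros [n|p]; simpl; [lra|]. pose proof (branch_ratio_pos p).
           pose proof (Hratio p). lra.
        -- apply nle_partial; auto. intros [v|p] [v'|p'] n; unfold gr; try congruence.
           intros E E'. f_equal. apply sig_lt_eq. injection E; injection E'; lia.
    + apply functional_extensionality; intros [n|p]; unfold vadd, diag, d, gl, gr, lift; ring.
Qed.

Lemma lift_intertwines x : lift (W x) = SM (lift x).
Proof.
  apply functional_extensionality; intros [n|[[|k] p]]; unfold SM, wshift, lift; simpl parM.
  - unfold W, wshift, zpred. reflexivity.
  - unfold W, wshift, branch_ratio, zpred. cbn [proj1_sig Nat.add wprod parM Z.of_nat Pos.of_succ_nat].
    cbn iota. replace (Z.pos 1 - 1)%Z with 0%Z by lia. unfold w.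
    pose proof (Hpos (inl 1%Z)). generalize (x 0%Z); intro a.
    cdestr; f_equal; field; lra.
  - set (p' := exist (fun k => (k < k0)%nat) k (Nat.lt_succ_l k k0 p)).
    unfold W, wshift. cbn [proj1_sig].
    replace (zpred (Z.of_nat (1 + S k))) with (Z.of_nat (1 + k)) by (unfold zpred; lia).
    assert (E : branch_ratio (exist _ (S k) p) * w (Z.of_nat (1 + S k)) =
      lam (inr (exist _ (S k) p)) * branch_ratio p').
    { assert (E1 : branch_ratio p' = wprod parM lam (1 + k) (inr p') / wprod zpred w (1 + k) (Z.of_nat (1 + k)))
        by reflexivity.
      assert (E2 : branch_ratio (exist _ (S k) p) =
        lam (inr (exist _ (S k) p)) * wprod parM lam (1 + k) (inr p') /
        (w (Z.of_nat (1 + S k)) *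
         wprod zpred w (1 + k) (zpred (Z.of_nat (1 + S k))))) by reflexivity.
      rewrite E1, E2.
      replace (zpred (Z.of_nat (1 + S k))) with (Z.of_nat (1 + k)) by (unfold zpred; lia).
      assert (0 < w (Z.of_nat (1 + S k))) by apply Hpos.
      assert (0 < wprod zpred w (1 + k) (Z.of_nat (1 + k))) by (apply wprod_pos; intro; apply Hpos).
      field. split; lra. }
    transitivity (Cmul (RtoC (branch_ratio (exist _ (S k) p) * w (Z.of_nat (1 + S k))))
       (x (Z.of_nat (1 + k)))); [rewrite RtoC_mul; ring|].
    rewrite E, RtoC_mul.
    transitivity (Cmul (RtoC (lam (inr (exist _ (S k) p))))
      (Cmul (RtoC (branch_ratio p')) (x (Z.of_nat (1 + k))))); [ring|reflexivity].
Qed.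

Lemma lift_iter n x : lift (Nat.iter n W x) = Nat.iter n SM (lift x).
Proof.
  induction n; auto. change (lift (W (Nat.iter n W x)) = SM (Nat.iter n SM (lift x))).
  now rewrite lift_intertwines, IHn.
Qed.

(** The basis vector of the vertex 1', or zero when the branch is empty; this form avoids a case
    distinction on [k0]. *)
Definition first_branch : vec (MV k0) := fun v =>
  match v with
  | inr p => if Nat.eq_dec (proj1_sig p) 0 then RtoC 1 else C0
  | inl _ => C0
  end.

Lemma first_branch_killed : Nat.iter k0 SM first_branch = vzero.
Proof.
  apply functional_extensionality; intro v. unfold SM. rewrite wshift_iter. unfold first_branch.
  destruct (piter parM k0 v) as [j|p] eqn:E; [unfold vzero; ring|].
  apply piter_inr in E as (q & -> & E). pose proof (proj2_sig q). simpl in *. lia.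
Qed.

Lemma first_branch_iter p : Nat.iter (proj1_sig p) SM first_branch =
  vscale (RtoC (wprod parM lam (proj1_sig p) (inr p))) (delta (inr p)).
Proof.
  apply functional_extensionality; intro v. unfold SM, vscale. rewrite wshift_iter.
  destruct (excluded_middle_informative (v = inr p)) as [->|Hv].
  - rewrite delta_same. f_equal. clear. destruct p as [k p]; simpl.
    induction k as [|k IH]; simpl; auto.
  - rewrite delta_other by auto. destruct (piter parM (proj1_sig p) v) as [j|q] eqn:E; simpl; [ring|].
    destruct Nat.eq_dec as [E0|]; [|ring]. apply piter_inr in E as (q' & -> & E).
    elim Hv. f_equal. apply sig_lt_eq. lia.
Qed.

Lemma first_branch_l2 : l2 first_branch.
Proof.
  destruct (lt_dec 0 k0) as [H|H].
  - pose proof (first_branch_iter (exist _ 0%nat H)) as E. simpl in E. rewrite E.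
    apply l2_nle. eexists. apply (nle_vscale (RtoC 1) _ 1 1); [lra| |apply nle_delta].
    rewrite Cnorm2_RtoC; lra.
  - apply l2_nle. exists 0. replace first_branch with (@vzero (MV k0)); [apply nle_zero|].
    apply functional_extensionality; intros [n|[k p]]; simpl; auto. lia.
Qed.

(** The cyclic vector is [lift h] plus [first_branch]. Applying [SM] to the power [k0] erases the
    second summand and leaves [lift] of the [k0]-th iterate of [h] under [W]; this yields all lifted
    vectors, then [first_branch] by subtraction, then the branch. *)
Lemma cyclic_extend : cyclic W -> cyclic SM.
Proof.
  intro Hc. apply cyclic_elim in Hc as (h & Hh & H).
  destruct lift_blin as [B HL]. pose proof (blin_pos _ _ HL) as HB.
  set (k := vadd (lift h) first_branch).
  pose proof (blin_iter W K k0 spine_blin) as HWk.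
  pose proof (blin_pos _ _ HWk) as HKk.
  (* The [k0]-th power of [W] has dense range, each [delta n] being a multiple of the image of
     [delta (n - k0)]. Hence the [k0]-th iterate of [h] is again cyclic. *)
  assert (Hdense : forall n, in_cl W (Nat.iter k0 W h) (delta n)).
  { intro n. set (m := (n - Z.of_nat k0)%Z).
    assert (E : Nat.iter k0 W (delta m) = vscale (RtoC (wprod zpred w k0 n)) (delta n)).
    { apply wshift_delta_unique; [apply piter_zpred|]. intros v. rewrite piter_zpred. unfold m; lia. }
    apply in_cl_unscale with (wprod zpred w k0 n);
      [apply Rgt_not_eq, wprod_pos; unfold w; auto|].
    rewrite <- E. apply in_cl_lim. intros e He.
    destruct (H (delta m) (delta_l2 m) (e / (K ^ k0 + 1))) as [cs Hcs];
      [apply Rdiv_lt_0_compat; lra|].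
    exists (poly_apply W (Nat.iter k0 W h) cs). split; [apply in_cl_poly|].
    rewrite <- (blin_poly W W (Nat.iter k0 W) (K ^ k0) h cs HWk).
    2:{ intro x. now rewrite <- Nat.iter_succ_r, <- Nat.iter_succ. }
    rewrite <- (blin_sub _ _ _ _ HWk).
    eapply nle_mono; [|apply (blin_bound _ _ HWk), Hcs].
    replace e with ((K ^ k0 + 1) * (e / (K ^ k0 + 1))) at 2 by (field; lra).
    assert (0 < e / (K ^ k0 + 1)) by (apply Rdiv_lt_0_compat; lra). nra. }
  pose proof (in_cl_all _ _ Hdense) as Hall.
  assert (HLcl : forall x, l2 x -> in_cl SM k (lift x)).
  { intros x Hx. apply in_cl_lim. intros e He.
    destruct (Hall x Hx (e / (B + 1))) as [cs Hcs]; [apply Rdiv_lt_0_compat; lra|].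
    exists (lift (poly_apply W (Nat.iter k0 W h) cs)). split.
    - rewrite (blin_poly W SM lift B _ cs HL lift_intertwines), lift_iter.
      apply in_cl_poly_apply; [intros; eapply in_cl_T; eauto|].
      replace (Nat.iter k0 SM (lift h)) with (Nat.iter k0 SM k).
      + eapply in_cl_iter; eauto. apply in_cl_self.
      + unfold k. rewrite (blin_add _ _ (blin_iter SM K k0 HS)), first_branch_killed. vext.
    - rewrite <- (blin_sub _ _ _ _ HL). eapply nle_mono; [|apply (blin_bound _ _ HL), Hcs].
      replace e with ((B + 1) * (e / (B + 1))) at 2 by (field; lra).
      assert (0 < e / (B + 1)) by (apply Rdiv_lt_0_compat; lra). nra. }
  assert (Hz : in_cl SM k first_branch).
  { replace first_branch with (vsub k (lift h)) by (unfold k; vext).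
    apply in_cl_sub; [apply in_cl_self|auto]. }
  assert (Hr : forall p, in_cl SM k (delta (inr p))).
  { intro p. apply in_cl_unscale with (wprod parM lam (proj1_sig p) (inr p)).
    - now apply Rgt_not_eq, wprod_pos.
    - rewrite <- first_branch_iter. eapply in_cl_iter; eauto. }
  apply (cyclic_intro SM k).
  - apply blin_l2 with (T := lift) (K := B) in Hh; auto. apply l2_nle in Hh as [r Hh].
    destruct (proj1 (l2_nle _) first_branch_l2) as [r' Hr']. apply l2_nle. eexists.
    apply nle_vadd; eauto.
  - intros [n|p]; auto.
    pose proof (HLcl (delta n) (delta_l2 n)) as Hn.
    (* For [n] from 1 to [k0] the lifted basis vector has one additional coordinate on the branch,
       which is subtracted; otherwise it is the basis vector itself. *)
    destruct (classic (exists p, n = Z.of_nat (1 + proj1_sig (P := fun k => (k < k0)%nat) p))) as [[p Hp]|Hno].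
    + replace (delta (inl n : MV k0)) with (vsub (lift (delta n)) (vscale (RtoC (branch_ratio p)) (delta (inr p)))).
      * apply in_cl_sub; auto using in_cl_scale.
      * apply functional_extensionality; intros [m|q]; unfold vsub, vscale, lift.
        -- rewrite (delta_inj (fun n : Z => inl n : MV k0)) by congruence.
           rewrite (delta_other (inr p : MV k0)) by congruence. ring.
        -- rewrite (delta_other (inl n : MV k0)) by congruence.
           rewrite (delta_inj (fun q => inr q : MV k0)) by congruence.
           destruct (excluded_middle_informative (q = p)) as [->|Hq].
           ++ rewrite <- Hp, !delta_same. ring.
           ++ rewrite !delta_other; [ring|auto|]. intro E. apply Hq, sig_lt_eq. lia.
    + replace (delta (inl n : MV k0)) with (lift (delta n)); auto.
      apply functional_extensionality; intros [m|q]; unfold lift.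
      * now rewrite (delta_inj (fun n : Z => inl n : MV k0)) by congruence.
      * rewrite !delta_other; [ring|congruence|]. intro E. apply Hno. now exists q.
Qed.

End Appendix.

Lemma cyclic_transport {V W : Type} (par : V -> V) (par' : W -> W) (lam : V -> R) (phi : W -> V) K :
  blin (wshift par lam) K ->
  (forall w w', phi w = phi w' -> w = w') -> (forall v, exists w, phi w = v) ->
  (forall w, par (phi w) = phi (par' w)) ->
  blin (wshift par' (fun w => lam (phi w))) K /\
  (cyclic (wshift par lam) <-> cyclic (wshift par' (fun w => lam (phi w)))).
Proof.
  intros HT Hinj Hsur Hpar.
  set (psi := fun v => proj1_sig (constructive_indefinite_description _ (Hsur v))).
  assert (H1 : forall v, phi (psi v) = v)
    by (intro v; unfold psi; now destruct constructive_indefinite_description).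
  assert (H2 : forall w, psi (phi w) = w) by (intro; apply Hinj; auto).
  set (X := fun (x : vec V) w => x (phi w)). set (Y := fun (y : vec W) v => y (psi v)).
  assert (HX : blin X 1).
  { constructor; auto; [lra|]. intros x r Hx. rewrite Rmult_1_l. now apply (nle_comp_inj phi). }
  assert (HY : blin Y 1).
  { constructor; auto; [lra|]. intros x r Hx. rewrite Rmult_1_l. apply (nle_comp_inj psi); auto.
    intros v v' E. rewrite <- (H1 v), <- (H1 v'). congruence. }
  assert (HXT : forall x, X (wshift par lam x) = wshift par' (fun w => lam (phi w)) (X x)).
  { intro x; apply functional_extensionality; intro w. unfold X, wshift. now rewrite Hpar. }
  assert (HYT : forall y, Y (wshift par' (fun w => lam (phi w)) y) = wshift par lam (Y y)).
  { intro y; apply functional_extensionality; intro v. unfold Y, wshift.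
    rewrite H1. do 2 f_equal. apply Hinj. rewrite <- Hpar. now rewrite !H1. }
  assert (HXY : forall y, X (Y y) = y)
    by (intro y; apply functional_extensionality; intro; unfold X, Y; now rewrite H2).
  assert (HT' : blin (wshift par' (fun w => lam (phi w))) K).
  { constructor.
    - intros; vext. unfold wshift. ring.
    - intros; vext. unfold wshift. ring.
    - apply (blin_pos _ _ HT).
    - intros y r Hy. rewrite <- (HXY y), <- HXT. rewrite <- (Rmult_1_l (K * r)).
      apply (blin_bound _ _ HX), (blin_bound _ _ HT).
      rewrite <- (Rmult_1_l r). now apply (blin_bound _ _ HY). }
  assert (Hone : RtoC 1 <> C0) by (intro E; apply (f_equal fst) in E; simpl in E; lra).
  split; auto. split.
  - apply (cyclic_quasi_affine _ _ X 1 K); auto.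
    intro w. exists (delta (phi w)), (RtoC 1). repeat split; auto using delta_l2.
    apply functional_extensionality; intro w'. unfold X, vscale. rewrite (delta_inj phi) by auto. ring.
  - apply (cyclic_quasi_affine _ _ Y 1 K); auto.
    intro v. exists (delta (psi v)), (RtoC 1). repeat split; auto using delta_l2.
    apply functional_extensionality; intro v'. unfold Y, vscale. rewrite (delta_inj psi); [ring|].
    intros x y E. rewrite <- (H1 x), <- (H1 y). congruence.
Qed.

(** * Contractions that are not of class C.0 *)

Lemma adjoint_iter {V : Type} (T A : op V) K n :
  blin T K -> is_adjoint T A -> is_adjoint (Nat.iter n T) (Nat.iter n A).
Proof.
  intros HT HA. induction n as [|n IH]; intros x y Hx Hy.
  - split; auto. reflexivity.
  - destruct (HA (Nat.iter n T x) y) as [H1 H2]; auto.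
    { exact (blin_l2 _ _ _ (blin_iter T K n HT) Hx). }
    destruct (IH x (A y) Hx H1) as [H3 H4].
    rewrite Nat.iter_succ_r. split; auto. intro s. rewrite <- H4, <- H2. reflexivity.
Qed.

Lemma sumR_indicator_le {V : Type} (g : V -> R) (F L : list V) :
  (forall v, 0 <= g v) -> NoDup L ->
  sumR (fun v => if excluded_middle_informative (In v F) then g v else 0) L <= sumR g F.
Proof.
  intros Hg HL.
  set (p := fun v => if excluded_middle_informative (In v F) then true else false).
  rewrite (sumR_ext _ (fun v => if p v then g v else 0)).
  - rewrite <- sumR_filter. apply sumR_incl; auto using NoDup_filter.
    intros v Hv. apply filter_In in Hv as [_ Hv]. unfold p in Hv.
    destruct excluded_middle_informative; easy.
  - intros v _. unfold p. destruct excluded_middle_informative; auto.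
Qed.

Lemma sumR_const {V : Type} (r : R) (l : list V) : sumR (fun _ => r) l = INR (length l) * r.
Proof.
  induction l as [|v l IH]; [simpl; ring|].
  change (length (v :: l)) with (S (length l)). rewrite S_INR. unfold sumR in *. simpl.
  rewrite IH. ring.
Qed.

Lemma nsq_restr {V : Type} (l : list V) (y : vec V) :
  nsq_le (restr l y) (sumR (fun v => Cnorm2 (y v)) l).
Proof.
  intros m Hm. eapply Rle_trans; [|apply (sumR_indicator_le _ l m); auto using Cnorm2_ge0].
  apply sumR_le. intros v _. unfold restr.
  destruct excluded_middle_informative; [lra|rewrite Cnorm2_C0; lra].
Qed.

Lemma inner_restr {V : Type} (l : list V) (y : vec V) : NoDup l ->
  inner (restr l y) y (RtoC (sumR (fun v => Cnorm2 (y v)) l)).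
Proof.
  intros Hl e He. exists l. intros L HL Hi.
  set (f := fun v => Cmul (restr l y v) (Cconj (y v))).
  assert (Ef : forall v, f v = RtoC (if excluded_middle_informative (In v l) then Cnorm2 (y v) else 0)).
  { intro v. unfold f, restr. destruct excluded_middle_informative.
    - destruct (y v); unfold Cmul, Cconj, Cnorm2, RtoC; simpl; f_equal; ring.
    - unfold Cmul, C0, RtoC; simpl; f_equal; ring. }
  assert (E : sumC f L = RtoC (sumR (fun v => Cnorm2 (y v)) l)).
  { destruct (sumC_parts f L) as [E1 E2]. rewrite (surjective_pairing (sumC f L)), E1, E2.
    unfold RtoC. f_equal.
    - rewrite (sumR_ext _ (fun v => if excluded_middle_informative (In v l) then Cnorm2 (y v) else 0))
        by (intros; rewrite Ef; reflexivity).
      apply Rle_antisym; [apply sumR_indicator_le; auto using Cnorm2_ge0|].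
      rewrite (sumR_ext _ (fun v => if excluded_middle_informative (In v l) then Cnorm2 (y v) else 0) l).
      + apply sumR_incl; auto. intro v. destruct excluded_middle_informative; [apply Cnorm2_ge0|lra].
      + intros v Hv. destruct excluded_middle_informative; easy.
    - apply sumR_0. intros; rewrite Ef; reflexivity. }
  rewrite E. replace (Cadd _ _) with C0 by ring. rewrite Cnorm2_C0; lra.
Qed.

Lemma eventually_list {V : Type} (P : V -> nat -> Prop) (l : list V) :
  (forall v, exists N, forall n, (N <= n)%nat -> P v n) ->
  exists N, forall n, (N <= n)%nat -> forall v, In v l -> P v n.
Proof.
  intro H. induction l as [|v l [N IH]]; [exists 0%nat; easy|].
  destruct (H v) as [M HM]. exists (max N M). intros n Hn w [<-|Hw]; [apply HM|apply IH]; auto; lia.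
Qed.

Definition dot (a b : C) : R := fst a * fst b + snd a * snd b.

Lemma Cdot_le (a b : C) (t : R) : 0 < t ->
  dot a b <= / (4 * t) * Cnorm2 a + t * Cnorm2 b.
Proof.
  intro Ht. destruct a as [a1 a2], b as [b1 b2]; unfold dot, Cnorm2; simpl.
  apply Rmult_le_reg_l with (4 * t); [lra|].
  replace (4 * t * (/ (4 * t) * (a1 * a1 + a2 * a2) + t * (b1 * b1 + b2 * b2)))
    with (a1 * a1 + a2 * a2 + 4 * t * t * (b1 * b1 + b2 * b2)) by (field; lra).
  pose proof (Rle_0_sqr (a1 - 2 * t * b1)). pose proof (Rle_0_sqr (a2 - 2 * t * b2)).
  unfold Rsqr in *. nra.
Qed.

Lemma Cdot_scale (c : R) (a b : C) : dot (Cmul (RtoC c) a) b = dot a (Cmul (RtoC c) b).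
Proof. unfold dot, Cmul, RtoC; simpl; ring. Qed.

(** The adjoint is arbitrary, so no formula for it is used. Testing [z], the n-th adjoint iterate of
    [y], against its own restriction [x] to [l] turns the partial sum [R0] of [z] into the inner
    product of the n-th iterate of [x] with [y]. That is at most [R0 / 2 + eps / 2] up to [e / 2],
    whence [R0 <= eps + e]. *)
Lemma vanishing_products_Cdot0 {V : Type} (par : V -> V) (lam : V -> R) :
  blin (wshift par lam) 1 ->
  (forall v eps, 0 < eps -> exists N, forall n, (N <= n)%nat -> Rabs (wprod par lam n v) <= eps) ->
  class_Cdot0 (wshift par lam).
Proof.
  intros HT Hw A HA y Hy eps He. set (T := wshift par lam) in *.
  destruct (nsq_tail y (eps / 4)) as (F & HF & Htail); auto; [lra|].
  destruct Hy as [Y HY].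
  assert (HY0 : 0 <= Y) by (eapply nsq_le_nonneg; eauto).
  set (m := INR (length F) + 1).
  assert (Hm : 1 <= m) by (pose proof (pos_INR (length F)); unfold m; lra).
  set (q := eps / 4 / (m * (Y + 1))).
  assert (HmY : 0 < m * (Y + 1)) by nra.
  assert (Hq : 0 < q) by (apply Rdiv_lt_0_compat; lra).
  destruct (eventually_list (fun v n => Rabs (wprod par lam n v) <= sqrt q) F) as [N HN].
  { intro v. apply Hw. now apply sqrt_lt_R0. }
  exists N. intros n Hn l Hl. specialize (HN n Hn).
  set (z := Nat.iter n A y). set (R0 := sumR _ l).
  assert (HR0 : 0 <= R0) by (apply sumR_ge0; intro; apply Cnorm2_ge0).
  set (x := restr l z).
  assert (Hx : nle x (sqrt R0)) by (apply nsq_le_nle; apply nsq_restr).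
  assert (HTx : nsq_le (Nat.iter n T x) R0).
  { destruct (blin_bound _ _ (blin_iter T 1 n HT) x (sqrt R0) Hx) as [_ H].
    rewrite pow1, !Rmult_1_l, sqrt_sqrt in H by auto. exact H. }
  destruct (adjoint_iter T A 1 n HT HA x y) as [_ Hin].
  { apply l2_nle; eauto. } { now exists Y. }
  assert (Hs : inner (Nat.iter n T x) y (RtoC R0)) by (apply Hin; now apply inner_restr).
  apply le_epsilon. intros e He2.
  destruct (Hs (e / 2 * (e / 2))) as [F0 HF0]; [nra|].
  destruct (list_union_nodup F F0) as (L & HL & HLi).
  specialize (HF0 L HL ltac:(intros v Hv; apply HLi; auto)).
  set (g := fun v => Cmul (Nat.iter n T x v) (Cconj (y v))) in *.
  assert (H1 : R0 - e / 2 <= sumR (fun v => dot (Nat.iter n T x v) (y v)) L).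
  { destruct (sumC_parts g L) as [E1 _].
    rewrite (sumR_ext _ (fun v => fst (g v))); [rewrite <- E1|].
    - unfold Cnorm2, Cadd, Copp, RtoC in HF0; simpl in HF0.
      assert (0 <= (snd (sumC g L) + - 0) * (snd (sumC g L) + - 0)) by apply Rle_0_sqr.
      destruct (Rle_or_lt (R0 - e / 2) (fst (sumC g L))); auto. exfalso. nra.
    - intros v _. unfold g, dot, Cmul, Cconj; simpl; ring. }
  (* On the finite set [F] carrying most of [y] the small weight products are used; off [F] the tail
     of [y] is small. The value of [q] makes the share of [y] on [F] at most [eps / 4], and the
     weight [1 / (4 m)] keeps the share of [R0] there at most [R0 / 4]. *)
  assert (H2 : sumR (fun v => dot (Nat.iter n T x v) (y v)) L <=
    sumR (fun v => (/ 4 * Cnorm2 (Nat.iter n T x v) + Cnorm2 (vsub y (restr F y) v)) +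
      (if excluded_middle_informative (In v F)
       then / (4 * m) * R0 + m * q * Cnorm2 (y v) else 0)) L).
  { apply sumR_le. intros v _.
    pose proof (Cnorm2_ge0 (Nat.iter n T x v)).
    destruct excluded_middle_informative as [Hv|Hv].
    - pose proof (Cnorm2_ge0 (vsub y (restr F y) v)).
      assert (dot (Nat.iter n T x v) (y v) <= / (4 * m) * R0 + m * q * Cnorm2 (y v)); [|lra].
      unfold T. rewrite wshift_iter, Cdot_scale.
      eapply Rle_trans; [apply (Cdot_le _ _ m); lra|]. apply Rplus_le_compat.
      + apply Rmult_le_compat_l; [left; apply Rinv_0_lt_compat; lra|].
        rewrite <- (sqrt_sqrt R0) by auto. now apply nle_point.
      + rewrite Cnorm2_mul, Cnorm2_RtoC, (Rmult_assoc m q). apply Rmult_le_compat_l; [lra|].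
        apply Rmult_le_compat_r; [apply Cnorm2_ge0|].
        specialize (HN v Hv). rewrite <- (sqrt_sqrt q) by lra.
        replace (wprod par lam n v * wprod par lam n v) with
          (Rabs (wprod par lam n v) * Rabs (wprod par lam n v))
          by (rewrite <- Rabs_mult; apply Rabs_right, Rle_ge, Rle_0_sqr).
        apply Rmult_le_compat; auto using Rabs_pos.
    - rewrite Rplus_0_r. unfold vsub, restr. destruct excluded_middle_informative; [easy|].
      replace (Cadd (y v) (Copp C0)) with (y v) by ring.
      pose proof (Cdot_le (Nat.iter n T x v) (y v) 1). lra. }
  rewrite sumR_plus, sumR_plus, sumR_scal in H2.
  assert (H3 := sumR_indicator_le (fun v => / (4 * m) * R0 + m * q * Cnorm2 (y v)) F L).
  assert (Him : 0 < / (4 * m)) by (apply Rinv_0_lt_compat; lra).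
  assert (Hmq : 0 < m * q) by nra.
  specialize (H3 ltac:(intro v; pose proof (Cnorm2_ge0 (y v)); nra) HL).
  rewrite sumR_plus, (sumR_scal (m * q)) in H3.
  assert (H4 : sumR (fun _ : V => / (4 * m) * R0) F <= R0 / 4).
  { assert (E : sumR (fun _ : V => / (4 * m) * R0) F = INR (length F) * (/ (4 * m) * R0)).
    { apply sumR_const. }
    rewrite E. apply Rle_trans with (m * (/ (4 * m) * R0)).
    - apply Rmult_le_compat_r; [nra|unfold m; lra].
    - right; field; lra. }
  assert (H5 : m * q * sumR (fun v => Cnorm2 (y v)) F <= eps / 4).
  { apply Rle_trans with (m * q * (Y + 1)).
    - apply Rmult_le_compat_l; [lra|]. specialize (HY F HF). lra.
    - right. unfold q. field. split; lra. }
  specialize (HTx L HL). specialize (Htail L HL). lra.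
Qed.

Lemma wprod_antitone {V : Type} (par : V -> V) lam m n v :
  (forall v, 0 < lam v <= 1) -> (m <= n)%nat -> wprod par lam n v <= wprod par lam m v.
Proof.
  intros H Hmn. replace n with (m + (n - m))%nat by lia. rewrite wprod_add.
  pose proof (wprod_le1 par lam (n - m) (piter par m v) H).
  assert (0 < wprod par lam m v) by (apply wprod_pos; apply H). nra.
Qed.

(** The products decrease in [n], so not vanishing at some [v] means being bounded below there. The
    bound passes to a common ancestor of [v] and [u], as the dropped factors are at most 1, and from
    there to [u] at the cost of one fixed product. *)
Lemma not_Cdot0_products {V : Type} (par : V -> V) (lam : V -> R) (u : V) :
  (forall v, 0 < lam v <= 1) -> blin (wshift par lam) 1 ->
  (forall v, exists m n, piter par m v = piter par n u) ->
  ~ class_Cdot0 (wshift par lam) ->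
  exists d, 0 < d /\ forall n, d <= wprod par lam n u.
Proof.
  intros Hl HT Hconn Hno.
  assert (Hl0 : forall v, 0 < lam v) by apply Hl.
  destruct (classic (exists v eps, 0 < eps /\ forall n, eps <= wprod par lam n v))
    as [(v & eps & He & Hv)|Hn].
  - destruct (Hconn v) as (k & j & E).
    exists (wprod par lam j u * eps). pose proof (wprod_pos par lam j u Hl0).
    split; [nra|]. intro n.
    apply Rle_trans with (wprod par lam (j + n) u); [|apply wprod_antitone; auto; lia].
    rewrite wprod_add. apply Rmult_le_compat_l; [lra|]. rewrite <- E.
    specialize (Hv (k + n)%nat). rewrite wprod_add in Hv.
    pose proof (wprod_le1 par lam k v Hl). pose proof (wprod_pos par lam k v Hl0).
    pose proof (wprod_pos par lam n (piter par k v) Hl0). nra.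
  - exfalso. apply Hno. apply vanishing_products_Cdot0; auto. intros v eps He.
    destruct (classic (exists N, wprod par lam N v <= eps)) as [[N HN]|Hn'].
    + exists N. intros n Hn2. pose proof (wprod_pos par lam n v Hl0).
      rewrite Rabs_right by lra. pose proof (wprod_antitone par lam N n v Hl Hn2). lra.
    + exfalso. apply Hn. exists v, eps. split; auto. intro n.
      destruct (Rle_or_lt eps (wprod par lam n v)); auto. exfalso; apply Hn'. exists n. lra.
Qed.

(** * Two infinite chains *)

Definition has_sumR {V : Type} (f : V -> R) (s : R) : Prop :=
  forall eps, 0 < eps -> exists F0 : list V,
    forall L, NoDup L -> incl F0 L -> Rabs (sumR f L - s) <= eps.

Lemma has_sumR_nonneg {V : Type} (f : V -> R) (M : R) : (forall v, 0 <= f v) ->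
  (forall L, NoDup L -> sumR f L <= M) -> exists s, has_sumR f s.
Proof.
  intros Hf HM.
  destruct (completeness (fun r => exists l, NoDup l /\ r = sumR f l)) as [s [Hub Hlub]].
  - exists M. intros r (l & Hl & ->). auto.
  - exists 0, []. split; [constructor|reflexivity].
  - exists s. intros e He.
    destruct (classic (exists l, NoDup l /\ s - e < sumR f l)) as [(l & Hl & Hs)|Hno].
    + exists l. intros L HL Hi.
      assert (sumR f L <= s) by (apply Hub; eauto).
      pose proof (sumR_incl f l L Hf Hl Hi). apply Rabs_le. lra.
    + exfalso. assert (s <= s - e); [|lra]. apply Hlub. intros r (l & Hl & ->).
      destruct (Rle_or_lt (sumR f l) (s - e)); auto. exfalso; eauto.
Qed.

Lemma has_sumR_minus {V : Type} (f g : V -> R) s t :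
  has_sumR f s -> has_sumR g t -> has_sumR (fun v => f v - g v) (s - t).
Proof.
  intros Hf Hg e He. destruct (Hf (e / 2)) as [F HF]; [lra|].
  destruct (Hg (e / 2)) as [G HG]; [lra|]. exists (F ++ G). intros L HL Hi.
  specialize (HF L HL ltac:(intros v Hv; apply Hi, in_or_app; auto)).
  specialize (HG L HL ltac:(intros v Hv; apply Hi, in_or_app; auto)).
  rewrite (sumR_ext _ (fun v => f v + -1 * g v)) by (intros; ring).
  rewrite sumR_plus, sumR_scal.
  replace (sumR f L + -1 * sumR g L - (s - t)) with ((sumR f L - s) - (sumR g L - t)) by ring.
  eapply Rle_trans; [apply Rabs_triang|]. rewrite Rabs_Ropp. lra.
Qed.

Lemma has_sumR_abs {V : Type} (f : V -> R) (M : R) :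
  (forall L, NoDup L -> sumR (fun v => Rabs (f v)) L <= M) -> exists s, has_sumR f s.
Proof.
  intro HM.
  destruct (has_sumR_nonneg (fun v => Rabs (f v)) M) as [s Hs]; auto using Rabs_pos.
  destruct (has_sumR_nonneg (fun v => f v + Rabs (f v)) (2 * M)) as [t Ht].
  - intro v. pose proof (Rle_abs (- f v)). rewrite Rabs_Ropp in *. lra.
  - intros L HL. apply Rle_trans with (sumR (fun v => 2 * Rabs (f v)) L).
    + apply sumR_le. intros v _. pose proof (Rle_abs (f v)). lra.
    + rewrite sumR_scal. specialize (HM L HL). lra.
  - exists (t - s). replace f with (fun v => (f v + Rabs (f v)) - Rabs (f v))
      by (apply functional_extensionality; intro; ring).
    now apply has_sumR_minus.
Qed.

Lemma has_sumC_pair {V : Type} (f : V -> C) (s : C) :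
  has_sumC f s <-> has_sumR (fun v => fst (f v)) (fst s) /\ has_sumR (fun v => snd (f v)) (snd s).
Proof.
  split.
  - assert (Habs : forall x y e, 0 < e -> x * x + y * y <= e * e -> Rabs x <= e).
    { intros x y e He Hx. apply Rabs_le. split; nra. }
    intro H; split; intros e He; destruct (H (e * e)) as [F HF]; try nra; exists F;
      intros L HL Hi; specialize (HF L HL Hi); destruct (sumC_parts f L) as [E1 E2];
      rewrite <- ?E1, <- ?E2; unfold Cnorm2, Cadd, Copp in HF; simpl in HF.
    + exact (Habs _ _ e He HF).
    + rewrite Rplus_comm in HF. exact (Habs _ _ e He HF).
  - intros [H1 H2] e He. destruct (H1 (sqrt (e / 2))) as [F HF]; [apply sqrt_lt_R0; lra|].
    destruct (H2 (sqrt (e / 2))) as [G HG]; [apply sqrt_lt_R0; lra|].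
    exists (F ++ G). intros L HL Hi.
    specialize (HF L HL ltac:(intros v Hv; apply Hi, in_or_app; auto)).
    specialize (HG L HL ltac:(intros v Hv; apply Hi, in_or_app; auto)).
    destruct (sumC_parts f L) as [E1 E2]. rewrite <- E1 in HF. rewrite <- E2 in HG.
    unfold Cnorm2, Cadd, Copp; simpl.
    assert (Hq : sqrt (e / 2) * sqrt (e / 2) = e / 2) by (apply sqrt_sqrt; lra).
    assert (Hsq : forall x, Rabs x <= sqrt (e / 2) -> x * x <= e / 2).
    { intros x Hx. rewrite <- Hq. replace (x * x) with (Rabs x * Rabs x)
        by (rewrite <- Rabs_mult; apply Rabs_right, Rle_ge, Rle_0_sqr).
      apply Rmult_le_compat; auto using Rabs_pos. }
    apply Hsq in HF. apply Hsq in HG. unfold Rminus in *. lra.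
Qed.

Lemma has_sumR_unique {V : Type} (f : V -> R) s t : has_sumR f s -> has_sumR f t -> s = t.
Proof.
  intros Hs Ht. apply cond_eq. intros e He.
  destruct (Hs (e / 3)) as [F HF]; [lra|]. destruct (Ht (e / 3)) as [G HG]; [lra|].
  destruct (list_union_nodup F G) as (L & HL & HLi).
  specialize (HF L HL ltac:(intros v Hv; apply HLi; auto)).
  specialize (HG L HL ltac:(intros v Hv; apply HLi; auto)).
  replace (s - t) with ((sumR f L - t) - (sumR f L - s)) by ring.
  eapply Rle_lt_trans; [apply Rabs_triang|]. rewrite Rabs_Ropp. lra.
Qed.

Lemma has_sumC_unique {V : Type} (f : V -> C) s t : has_sumC f s -> has_sumC f t -> s = t.
Proof.
  rewrite !has_sumC_pair. intros [H1 H2] [H3 H4].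
  rewrite (surjective_pairing s), (surjective_pairing t). f_equal; eapply has_sumR_unique; eauto.
Qed.

Lemma sumC_cons {V : Type} (f : V -> C) v l : sumC f (v :: l) = Cadd (f v) (sumC f l).
Proof. reflexivity. Qed.

Lemma sumC_map {V W : Type} (f : W -> C) (g : V -> W) l :
  sumC f (map g l) = sumC (fun v => f (g v)) l.
Proof. induction l; simpl; auto. unfold sumC in *. now rewrite IHl. Qed.

Lemma has_sumC_reindex {V W : Type} (f : W -> C) (g : V -> W) (g' : W -> V) s :
  (forall v, g' (g v) = v) -> (forall w, g (g' w) = w) ->
  has_sumC f s -> has_sumC (fun v => f (g v)) s.
Proof.
  intros H1 H2 H e He. destruct (H e He) as [F HF]. exists (map g' F). intros L HL Hi.
  rewrite <- (sumC_map f g L). apply HF.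
  - apply Injective_map_NoDup; auto. intros x y E. rewrite <- (H1 x), <- (H1 y). congruence.
  - intros w Hw. rewrite <- (H2 w). apply in_map, Hi, in_map, Hw.
Qed.

Lemma sumC_add {V : Type} (f g : V -> C) l :
  sumC (fun v => Cadd (f v) (g v)) l = Cadd (sumC f l) (sumC g l).
Proof. induction l; simpl; [ring|]. unfold sumC in *. rewrite IHl. ring. Qed.

Lemma sumC_scale {V : Type} c (f : V -> C) l :
  sumC (fun v => Cmul c (f v)) l = Cmul c (sumC f l).
Proof. induction l; simpl; [ring|]. unfold sumC in *. rewrite IHl. ring. Qed.

Lemma Cnorm2_add_le2 (a b : C) : Cnorm2 (Cadd a b) <= 2 * (Cnorm2 a + Cnorm2 b).
Proof.
  destruct a as [a1 a2], b as [b1 b2]; unfold Cnorm2, Cadd; simpl.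
  pose proof (Rle_0_sqr (a1 - b1)). pose proof (Rle_0_sqr (a2 - b2)). unfold Rsqr in *. lra.
Qed.

Lemma has_sumC_add {V : Type} (f g : V -> C) s t :
  has_sumC f s -> has_sumC g t -> has_sumC (fun v => Cadd (f v) (g v)) (Cadd s t).
Proof.
  intros Hf Hg e He. destruct (Hf (e / 4)) as [F HF]; [lra|].
  destruct (Hg (e / 4)) as [G HG]; [lra|]. exists (F ++ G). intros L HL Hi.
  specialize (HF L HL ltac:(intros v Hv; apply Hi, in_or_app; auto)).
  specialize (HG L HL ltac:(intros v Hv; apply Hi, in_or_app; auto)).
  rewrite sumC_add.
  replace (Cadd _ _) with (Cadd (Cadd (sumC f L) (Copp s)) (Cadd (sumC g L) (Copp t))) by ring.
  eapply Rle_trans; [apply Cnorm2_add_le2|]. lra.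
Qed.

Lemma has_sumC_scale {V : Type} c (f : V -> C) s :
  has_sumC f s -> has_sumC (fun v => Cmul c (f v)) (Cmul c s).
Proof.
  intros Hf e He. pose proof (Cnorm2_ge0 c).
  destruct (Hf (e / (Cnorm2 c + 1))) as [F HF]; [apply Rdiv_lt_0_compat; lra|].
  exists F. intros L HL Hi. specialize (HF L HL Hi). rewrite sumC_scale.
  replace (Cadd _ _) with (Cmul c (Cadd (sumC f L) (Copp s))) by ring.
  rewrite Cnorm2_mul. apply Rle_trans with (Cnorm2 c * (e / (Cnorm2 c + 1))).
  - now apply Rmult_le_compat_l.
  - assert (0 < e / (Cnorm2 c + 1)) by (apply Rdiv_lt_0_compat; lra).
    replace e with ((Cnorm2 c + 1) * (e / (Cnorm2 c + 1))) at 2 by (field; lra). nra.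
Qed.

(* The value at 0 of the convolution of x and y. *)
Definition conv0 (x y : vec Z) (s : C) : Prop := has_sumC (fun k => Cmul (x k) (y (- k)%Z)) s.

Lemma Cmul_parts_le (a b : C) t : 0 < t ->
  Rabs (fst (Cmul a b)) <= / (4 * t) * Cnorm2 a + t * Cnorm2 b /\
  Rabs (snd (Cmul a b)) <= / (4 * t) * Cnorm2 a + t * Cnorm2 b.
Proof.
  intro Ht. destruct a as [a1 a2], b as [b1 b2]. unfold Cmul, Cnorm2; simpl.
  assert (H : forall p q, p * q <= / (4 * t) * (p * p) + t * (q * q) /\
                          - (p * q) <= / (4 * t) * (p * p) + t * (q * q)).
  { intros p q.
    pose proof (Rle_0_sqr (p - 2 * t * q)). pose proof (Rle_0_sqr (p + 2 * t * q)). unfold Rsqr in *.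
    split; apply Rmult_le_reg_l with (4 * t); try lra;
    replace (4 * t * (/ (4 * t) * (p * p) + t * (q * q))) with (p * p + 4 * t * t * (q * q))
      by (field; lra); nra. }
  pose proof (H a1 b1). pose proof (H a2 b2). pose proof (H a1 b2). pose proof (H a2 b1).
  split; apply Rabs_le; lra.
Qed.

Lemma nle_rev (y : vec Z) r : nle y r -> nle (fun k => y (- k)%Z) r.
Proof. apply (nle_comp_inj Z.opp). intros; lia. Qed.

(** The free parameter of the arithmetic-geometric mean inequality replaces Cauchy-Schwarz: [t = 1]
    gives existence of the sum, and [t = e] for a factor of norm at most [e] gives a bound linear in
    [e]. *)
Lemma conv0_sums x y r q t L : nle x r -> nle y q -> 0 < t -> NoDup L ->
  sumR (fun k => Rabs (fst (Cmul (x k) (y (- k)%Z)))) L <= / (4 * t) * (r * r) + t * (q * q) /\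
  sumR (fun k => Rabs (snd (Cmul (x k) (y (- k)%Z)))) L <= / (4 * t) * (r * r) + t * (q * q).
Proof.
  intros [_ Hx] Hy Ht HL. apply nle_rev in Hy as [_ Hy].
  assert (0 < / (4 * t)) by (apply Rinv_0_lt_compat; lra).
  assert (E : sumR (fun k => / (4 * t) * Cnorm2 (x k) + t * Cnorm2 (y (- k)%Z)) L <=
    / (4 * t) * (r * r) + t * (q * q)).
  { rewrite sumR_plus, !sumR_scal. apply Rplus_le_compat; apply Rmult_le_compat_l; auto; lra. }
  split; (eapply Rle_trans; [|exact E]); apply sumR_le; intros k _; now apply Cmul_parts_le.
Qed.

Lemma conv0_ex x y : l2 x -> l2 y -> exists s, conv0 x y s.
Proof.
  intros Hx Hy. apply l2_nle in Hx as [r Hr]. apply l2_nle in Hy as [q Hq].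
  destruct (has_sumR_abs (fun k => fst (Cmul (x k) (y (- k)%Z))) (/ (4 * 1) * (r * r) + 1 * (q * q)))
    as [s Hs]. { intros L HL. apply conv0_sums; auto; lra. }
  destruct (has_sumR_abs (fun k => snd (Cmul (x k) (y (- k)%Z))) (/ (4 * 1) * (r * r) + 1 * (q * q)))
    as [t Ht]. { intros L HL. apply conv0_sums; auto; lra. }
  exists (s, t). now apply has_sumC_pair.
Qed.

Lemma sumR_abs_le {V : Type} (f : V -> R) l : Rabs (sumR f l) <= sumR (fun v => Rabs (f v)) l.
Proof.
  induction l; simpl; [rewrite Rabs_R0; lra|]. unfold sumR in *.
  eapply Rle_trans; [apply Rabs_triang|]. lra.
Qed.

Lemma has_sumR_le {V : Type} (f : V -> R) s M : has_sumR f s ->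
  (forall L, NoDup L -> sumR (fun v => Rabs (f v)) L <= M) -> Rabs s <= M.
Proof.
  intros Hs HM. apply le_epsilon. intros e He. destruct (Hs e He) as [F HF].
  destruct (list_union_nodup F F) as (L & HL & HLi).
  specialize (HF L HL ltac:(intros v Hv; apply HLi; auto)). specialize (HM L HL).
  pose proof (sumR_abs_le f L).
  replace s with (sumR f L - (sumR f L - s)) by ring.
  eapply Rle_trans; [apply Rabs_triang|]. rewrite Rabs_Ropp. lra.
Qed.

Lemma conv0_bound x y s e q : 0 < e -> nle x e -> nle y q -> conv0 x y s ->
  Rabs (fst s) <= e * (/ 4 + q * q) /\ Rabs (snd s) <= e * (/ 4 + q * q).
Proof.
  intros He Hx Hy Hs. apply has_sumC_pair in Hs as [H1 H2].
  replace (e * (/ 4 + q * q)) with (/ (4 * e) * (e * e) + e * (q * q)) by (field; lra).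
  split; (eapply has_sumR_le; [eassumption|]); intros L HL; now apply conv0_sums.
Qed.

Lemma conv0_sym x y s : conv0 x y s -> conv0 y x s.
Proof.
  intro H. apply (has_sumC_reindex _ Z.opp Z.opp) in H; [|intro; lia|intro; lia].
  unfold conv0. replace (fun k => Cmul (y k) (x (- k)%Z)) with
    (fun k => Cmul (x (- k)%Z) (y (- - k)%Z)); auto.
  apply functional_extensionality; intro. rewrite Z.opp_involutive. ring.
Qed.

Lemma conv0_shift x y s : conv0 x (bshift y) s -> conv0 (bshift x) y s.
Proof.
  intro H. apply (has_sumC_reindex _ (fun k => (k - 1)%Z) (fun k => (k + 1)%Z)) in H;
    [|intro; lia|intro; lia].
  unfold conv0. replace (fun k => Cmul (bshift x k) (y (- k)%Z)) with
    (fun k => Cmul (x (k - 1)%Z) (bshift y (- (k - 1))%Z)); auto.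
  apply functional_extensionality; intro k. unfold bshift, wshift.
  replace (- (k - 1) - 1)%Z with (- k)%Z by lia. ring.
Qed.

Lemma conv0_add x x' y s s' : conv0 x y s -> conv0 x' y s' -> conv0 (vadd x x') y (Cadd s s').
Proof.
  intros H H'. pose proof (has_sumC_add _ _ _ _ H H') as E.
  unfold conv0. replace (fun k => Cmul (vadd x x' k) _) with
    (fun k => Cadd (Cmul (x k) (y (- k)%Z)) (Cmul (x' k) (y (- k)%Z))); auto.
  apply functional_extensionality; intro. unfold vadd. ring.
Qed.

Lemma conv0_scale c x y s : conv0 x y s -> conv0 (vscale c x) y (Cmul c s).
Proof.
  intros H. pose proof (has_sumC_scale c _ _ H) as E.
  unfold conv0. replace (fun k => Cmul (vscale c x k) _) with
    (fun k => Cmul c (Cmul (x k) (y (- k)%Z))); auto.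
  apply functional_extensionality; intro. unfold vscale. ring.
Qed.

Lemma poly_l2 {V : Type} (T : op V) K h cs : blin T K -> l2 h -> l2 (poly_apply T h cs).
Proof.
  intros HT. revert h. induction cs as [|c cs IH]; intros h Hh; simpl.
  - apply l2_nle. exists 0. apply nle_zero.
  - assert (H1 : l2 (poly_apply T (T h) cs)) by (apply IH; eapply blin_l2; eauto).
    apply l2_nle in H1 as [r Hr]. apply l2_nle in Hh as [q Hq]. apply l2_nle.
    eexists. apply nle_vadd; [|exact Hr].
    apply (nle_vscale c h q (sqrt (Cnorm2 c))); auto; [apply sqrt_pos|].
    rewrite sqrt_sqrt by apply Cnorm2_ge0. lra.
Qed.

(* Convolution is commutative and associative, and [p(U) x] is a convolution with x. *)
Lemma conv0_poly x y cs s : l2 x -> l2 y ->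
  conv0 x (poly_apply bshift y cs) s -> conv0 (poly_apply bshift x cs) y s.
Proof.
  intros Hx Hy. pose proof bshift_blin as HU. revert x s Hx.
  induction cs as [|c cs IH]; intros x s Hx H; simpl in *.
  - apply conv0_sym in H. unfold conv0 in *.
    replace (fun k => Cmul (vzero k) (y (- k)%Z)) with (fun k : Z => Cmul (@vzero Z k) (x (- k)%Z)); auto.
    apply functional_extensionality; intro. unfold vzero. ring.
  - assert (Hp : l2 (poly_apply bshift y cs)) by (eapply poly_l2; eauto).
    assert (HUx : l2 (bshift x)) by (eapply blin_l2; eauto).
    destruct (conv0_ex x y Hx Hy) as [s1 H1].
    destruct (conv0_ex x (bshift (poly_apply bshift y cs)) Hx) as [s2 H2].
    { eapply blin_l2; eauto. }
    assert (E : s = Cadd (Cmul c s1) s2).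
    { eapply has_sumC_unique; [exact H|]. apply conv0_sym. apply conv0_add.
      - apply conv0_scale, conv0_sym, H1.
      - apply conv0_sym. rewrite <- (blin_poly bshift bshift bshift 1 y cs HU (fun _ => eq_refl)).
        exact H2. }
    rewrite E. apply conv0_add; [now apply conv0_scale|].
    apply IH; auto. apply conv0_shift, H2.
Qed.

Lemma conv0_delta k y : l2 y -> conv0 (delta k) y (y (- k)%Z).
Proof.
  intros Hy e He. exists [k]. intros L HL Hi.
  replace (sumC _ L) with (y (- k)%Z).
  - replace (Cadd _ _) with C0 by ring. rewrite Cnorm2_C0; lra.
  - specialize (Hi k (or_introl eq_refl)). clear -HL Hi.
    assert (Hno : forall M, ~ In k M -> sumC (fun j => Cmul (delta k j) (y (- j)%Z)) M = C0).
    { induction M as [|j M IH]; intro Hk; auto. rewrite sumC_cons, IH by (simpl in Hk; tauto).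
      rewrite delta_other by (intros ->; simpl in Hk; tauto). ring. }
    induction L as [|j L IH]; [easy|]. inversion HL; subst. rewrite sumC_cons.
    destruct (Z.eq_dec j k) as [->|Hj].
    + rewrite delta_same, Hno by auto. ring.
    + rewrite delta_other by auto. destruct Hi as [|Hi]; [easy|].
      rewrite <- IH by auto. ring.
Qed.

Section TwoChains.
Context {V : Type} (par : V -> V) (lam : V -> R) (Hpos : forall v, 0 < lam v).
Let T := wshift par lam.

Definition chain (a : Z -> V) : Prop :=
  (forall n m, a n = a m -> n = m) /\ forall n, par (a n) = a (n - 1)%Z.

(** Dividing by the cumulative products turns the weighted shift along the chain into the unweighted
    one, the reverse of the diagonal map used for cyclicity. *)
Definition chain_map (a : Z -> V) (x : vec V) : vec Z :=
  diag (fun n => / cumw (fun n => lam (a n)) n) (fun n => x (a n)).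

Lemma chain_map_blin a d : chain a -> 0 < d -> (forall n, d <= cumw (fun n => lam (a n)) n) ->
  blin (chain_map a) (/ d).
Proof.
  intros [Hinj Hpar] Hd Hc.
  assert (Hid : 0 < / d) by now apply Rinv_0_lt_compat.
  assert (HD : blin (diag (fun n => / cumw (fun n => lam (a n)) n)) (/ d)).
  { apply diag_blin; [lra|]. intro n. specialize (Hc n). split.
    - left. apply Rinv_0_lt_compat. lra.
    - now apply Rinv_le_contravar. }
  constructor.
  - intros; apply (blin_add _ _ HD).
  - intros; apply (blin_scale _ _ HD).
  - lra.
  - intros x r Hx. apply (blin_bound _ _ HD). now apply nle_comp_inj.
Qed.

Lemma chain_map_shift a x : chain a -> chain_map a (T x) = bshift (chain_map a x).
Proof.
  intros [Hinj Hpar]. apply functional_extensionality; intro n.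
  unfold chain_map, diag, bshift, T, wshift. rewrite Hpar, (cumw_step _ n) by auto.
  pose proof (Hpos (a n)). pose proof (cumw_pos (fun n => lam (a n)) (n - 1)%Z (fun k => Hpos (a k))).
  rewrite Rinv_mult, RtoC_mul.
  transitivity (Cmul (Cmul (RtoC (/ lam (a n))) (RtoC (lam (a n))))
    (Cmul (RtoC (/ cumw (fun n => lam (a n)) (n - 1)%Z)) (x (a (n - 1)%Z)))); [ring|].
  rewrite <- RtoC_mul, Rinv_l by lra. reflexivity.
Qed.

Lemma chain_map_delta a n : chain a ->
  chain_map a (delta (a n)) = vscale (RtoC (/ cumw (fun n => lam (a n)) n)) (delta n).
Proof.
  intros [Hinj _]. apply functional_extensionality; intro k. unfold chain_map, diag, vscale.
  rewrite (delta_inj a) by auto. destruct (Z.eq_dec k n) as [->|Hk]; auto.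
  rewrite delta_other by auto. ring.
Qed.

Theorem two_chains_not_cyclic (a b : Z -> V) (d : R) :
  chain a -> chain b -> (forall n, (n <= 0)%Z -> a n = b n) ->
  (forall n m, (0 < n)%Z -> a n <> b m) -> 0 < d ->
  (forall n, d <= cumw (fun n => lam (a n)) n) ->
  (forall n, d <= cumw (fun n => lam (b n)) n) -> ~ cyclic T.
Proof.
  intros Ha Hb Hab Hdis Hd Hca Hcb Hc. apply cyclic_elim in Hc as (h & Hh & H).
  pose proof (chain_map_blin a d Ha Hd Hca) as HA. pose proof (chain_map_blin b d Hb Hd Hcb) as HB.
  set (f := chain_map a h). set (g := chain_map b h).
  assert (Hf : l2 f) by (eapply blin_l2; eauto). assert (Hg : l2 g) by (eapply blin_l2; eauto).
  assert (Hid : 0 < / d) by now apply Rinv_0_lt_compat.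
  pose proof bshift_blin as HU.
  (* The functional sending [x] to the convolution at 0 of [chain_map a x] with [g], minus that of
     [chain_map b x] with [f], annihilates all [p(T) h]. At [delta (a (- k))], a vertex off the
     chain [b], its value is [c * g k]; density forces this to be 0. *)
  assert (Hzero : forall k, (k < 0)%Z -> g k = C0).
  { intros k Hk. set (c := / cumw (fun n => lam (a n)) (- k)%Z).
    assert (Hcpos : 0 < c) by (apply Rinv_0_lt_compat, cumw_pos; auto).
    destruct (proj1 (l2_nle _) Hf) as [rf Hrf]. destruct (proj1 (l2_nle _) Hg) as [rg Hrg].
    set (B := / 4 + rf * rf + (/ 4 + rg * rg)).
    assert (HB0 : 0 < B) by (unfold B; nra).
    assert (Hsmall : forall e, 0 < e -> Rabs (fst (Cmul (RtoC c) (g k))) <= e /\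
                                   Rabs (snd (Cmul (RtoC c) (g k))) <= e).
    (* [B] adds up the factors of the two convolution bounds. The precision [e1 * d] becomes [e1]
       under the chain maps, whose norms are at most [1 / d]. *)
    { intros e He. set (e1 := e / B). assert (He1 : 0 < e1) by (apply Rdiv_lt_0_compat; auto).
      destruct (H (delta (a (- k)%Z)) (delta_l2 _) (e1 * d)) as [cs Hcs]; [nra|].
      set (p := poly_apply T h cs) in *.
      pose proof (blin_bound _ _ HA _ _ Hcs) as H1. pose proof (blin_bound _ _ HB _ _ Hcs) as H2.
      rewrite (blin_sub _ _ _ _ HA), chain_map_delta in H1 by auto.
      rewrite (blin_sub _ _ _ _ HB) in H2.
      replace (/ d * (e1 * d)) with e1 in H1, H2 by (field; lra).
      unfold p in H1, H2.
      rewrite (blin_poly T bshift _ _ h cs HA (fun x => chain_map_shift a x Ha)) in H1.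
      rewrite (blin_poly T bshift _ _ h cs HB (fun x => chain_map_shift b x Hb)) in H2.
      fold f in H1. fold g in H2.
      assert (E0 : chain_map b (delta (a (- k)%Z)) = vzero).
      { apply functional_extensionality; intro n. unfold chain_map, diag, vzero.
        rewrite delta_other; [ring|]. intro E. apply (Hdis (- k)%Z n); [lia|auto]. }
      rewrite E0 in H2. fold c in H1.
      set (F := poly_apply bshift f cs) in *. set (G := poly_apply bshift g cs) in *.
      assert (HF : l2 F) by (eapply poly_l2; eauto). assert (HG : l2 G) by (eapply poly_l2; eauto).
      destruct (conv0_ex F g HF Hg) as [s Hs].
      assert (Hs' : conv0 G f s).
      { apply conv0_poly; auto. now apply conv0_sym. }
      set (D := vsub (vscale (RtoC c) (delta (- k)%Z)) F) in *.
      assert (H3 : conv0 D g (Cadd (Cmul (RtoC c) (g k)) (Cmul (RtoC (-1)) s))).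
      { unfold D. rewrite vsub_alt. apply conv0_add; [|now apply conv0_scale].
        apply conv0_scale. replace (g k) with (g (- - k)%Z) by (f_equal; lia). now apply conv0_delta. }
      assert (H4 : conv0 (vsub vzero G) f (Cmul (RtoC (-1)) s)).
      { replace (vsub vzero G) with (vscale (RtoC (-1)) G).
        - now apply conv0_scale.
        - apply functional_extensionality; intro n. unfold vscale, vsub, vzero.
          generalize (G n); intro. cdestr; f_equal; ring. }
      destruct (conv0_bound D g _ e1 rg He1 H1 Hrg H3) as [B1 B2].
      destruct (conv0_bound _ f _ e1 rf He1 H2 Hrf H4) as [B3 B4].
      assert (Ee : e = e1 * (/ 4 + rf * rf) + e1 * (/ 4 + rg * rg)).
      { rewrite <- Rmult_plus_distr_l. fold B. unfold e1. field. lra. }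
      revert B1 B2 B3 B4. generalize (Cmul (RtoC c) (g k)), (Cmul (RtoC (-1)) s). intros q q'.
      unfold Cadd; simpl. intros B1 B2 B3 B4.
      split.
      - replace (fst q) with ((fst q + fst q') - fst q') by ring.
        eapply Rle_trans; [apply Rabs_triang|]. rewrite Rabs_Ropp. lra.
      - replace (snd q) with ((snd q + snd q') - snd q') by ring.
        eapply Rle_trans; [apply Rabs_triang|]. rewrite Rabs_Ropp. lra. }
    assert (E : Cmul (RtoC c) (g k) = C0).
    { assert (Hx : forall x, (forall e, 0 < e -> Rabs x <= e) -> x = 0).
      { intros x Hx. destruct (Req_dec x 0) as [|Hn]; auto.
        pose proof (Rabs_pos_lt x Hn). specialize (Hx (Rabs x / 2)). lra. }
      rewrite (surjective_pairing (Cmul _ _)). unfold C0. f_equal; apply Hx; apply Hsmall. }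
    rewrite <- (RtoC_inv_l c (g k)), E by lra. ring. }
  (* The shift only moves indices upwards, so polynomials keep coordinate -1 at zero. Then
     [delta (b (-1))] cannot be approximated: its image has the coordinate [q] there, against an
     error of at most [q / 2]. *)
  assert (Hp : forall cs y, (forall k, (k < 0)%Z -> y k = C0) ->
     poly_apply bshift y cs (-1)%Z = C0).
  { induction cs as [|c cs IH]; intros y Hy; simpl; auto.
    unfold vadd, vscale. rewrite IH.
    - rewrite Hy by lia. ring.
    - intros k Hk. unfold bshift, wshift. rewrite Hy by lia. ring. }
  destruct (H (delta (b (-1)%Z)) (delta_l2 _) (d * / cumw (fun n => lam (b n)) (-1)%Z / 2)) as [cs Hcs].
  { pose proof (cumw_pos (fun n => lam (b n)) (-1)%Z (fun k => Hpos (b k))) as Hq.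
    apply Rinv_0_lt_compat in Hq. apply Rdiv_lt_0_compat; nra. }
  pose proof (cumw_pos (fun n => lam (b n)) (-1)%Z (fun k => Hpos (b k))) as Hq.
  apply Rinv_0_lt_compat in Hq. set (q := / cumw (fun n => lam (b n)) (-1)%Z) in *.
  pose proof (blin_bound _ _ HB _ _ Hcs) as H2.
  rewrite (blin_sub _ _ _ _ HB), chain_map_delta in H2 by auto.
  rewrite (blin_poly T bshift _ _ h cs HB (fun x => chain_map_shift b x Hb)) in H2.
  replace (/ d * (d * q / 2)) with (q / 2) in H2 by (field; lra).
  apply (nle_point _ _ (-1)%Z) in H2. unfold vsub in H2. rewrite Hp in H2 by exact Hzero.
  unfold vscale in H2. rewrite delta_same in H2. fold q in H2.
  unfold Cnorm2, Cadd, Cmul, Copp, RtoC, C0 in H2; simpl in H2. nra.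
Qed.

End TwoChains.

(** * Branches of a tree with one fork *)

Lemma forked_sym {V : Type} (par : V -> V) u0 c1 c2 :
  forked par u0 c1 c2 -> forked par u0 c2 c1.
Proof.
  intros [H1 H2 H3 H4 H5 H6 H7]; constructor; auto. intros v Hv. destruct (H7 v Hv); auto.
Qed.

Section Branches.
Context {V : Type} (par : V -> V) (u0 c1 c2 : V) (F : forked par u0 c1 c2).

Lemma branch_not_trunk c d n v : par c = u0 -> piter par d v = c -> v <> piter par n u0.
Proof.
  intros Hc Hd ->. rewrite <- piter_add in Hd.
  apply (fk_acyclic _ _ _ _ F (n + d) u0). rewrite piter_S, Hd. exact Hc.
Qed.

Lemma branch_disjoint d d' v : piter par d v = c1 -> piter par d' v <> c2.
Proof.
  intros H1 H2. assert (S d = S d').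
  { apply (piter_inj par u0 c1 c2 F _ _ v). rewrite !piter_S, H1, H2.
    now rewrite (fk_c1 _ _ _ _ F), (fk_c2 _ _ _ _ F). }
  apply (fk_neq _ _ _ _ F). congruence.
Qed.

(** A vertex deeper than the leaf would have, [dl] steps from [c], an ancestor equal to the leaf,
    because each depth of a branch holds a single vertex. *)
Lemma leaf_depth c l dl d v : par c = u0 -> (forall v, par v <> l) ->
  piter par dl l = c -> piter par d v = c -> (d <= dl)%nat.
Proof.
  intros Hc Hl Hdl Hd. destruct (le_lt_dec d dl) as [|Hlt]; auto. exfalso.
  assert (E : piter par (d - dl) v = l).
  { apply (branch_unique par u0 c1 c2 F dl c); auto. rewrite <- piter_add.
    now replace (d - dl + dl)%nat with d by lia. }
  replace (d - dl)%nat with (S (d - dl - 1)) in E by lia. rewrite piter_S in E.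
  exact (Hl _ E).
Qed.

Lemma leaf_in_branch l : (forall v, par v <> l) ->
  exists d, piter par d l = c1 \/ piter par d l = c2.
Proof.
  intro Hl. destruct (vertex_cases par u0 c1 c2 F l) as [[[|n] E]|H]; auto; exfalso.
  - apply (Hl c1). rewrite E. apply (fk_c1 _ _ _ _ F).
  - apply (Hl (piter par n u0)). rewrite E. now rewrite piter_S.
Qed.

Lemma leaves_same_branch c l l' d d' : par c = u0 ->
  (forall v, par v <> l) -> (forall v, par v <> l') ->
  piter par d l = c -> piter par d' l' = c -> l = l'.
Proof.
  intros Hc Hl Hl' Hd Hd'. assert (d = d').
  { apply Nat.le_antisymm; [apply (leaf_depth c l' d' d l)|apply (leaf_depth c l d d' l')]; auto. }
  subst d'. now apply (branch_unique par u0 c1 c2 F d c).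
Qed.

Lemma piter_chain (a : Z -> V) n k : (forall n, par (a n) = a (n - 1)%Z) ->
  piter par n (a k) = a (k - Z.of_nat n)%Z.
Proof.
  intro Ha. revert k; induction n; intro k; [simpl; f_equal; lia|].
  simpl piter. rewrite Ha, IHn. f_equal; lia.
Qed.

Lemma wprod_chain (lam : V -> R) (a : Z -> V) n k : (forall n, par (a n) = a (n - 1)%Z) ->
  wprod zpred (fun n => lam (a n)) n k = wprod par lam n (a k).
Proof.
  intro Ha. revert k; induction n; intro k; simpl; auto. now rewrite IHn, Ha.
Qed.

Lemma chain_intro (a : Z -> V) : (forall n, par (a n) = a (n - 1)%Z) -> chain par a.
Proof.
  intro Ha. split; auto. intros n m E.
  assert (H : forall n m, (n <= m)%Z -> a n = a m -> n = m).
  { clear n m E. intros n m Hnm E.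
    assert (E' : piter par (Z.to_nat (m - n)) (a m) = piter par 0 (a m)).
    { rewrite piter_chain by auto. simpl. rewrite <- E. f_equal; lia. }
    apply (piter_inj par u0 c1 c2 F) in E'. lia. }
  destruct (Z.le_ge_cases n m); [auto|symmetry; auto].
Qed.

(** Children are picked by choice along the leafless branch, and ancestors of the fork fill the
    nonpositive indices, with the fork at index 0. *)
Lemma branch_chain c : par c = u0 ->
  (forall d v, piter par d v = c -> exists v', par v' = v) ->
  exists a : Z -> V, (forall n, par (a n) = a (n - 1)%Z) /\
    (forall n, a (- Z.of_nat n)%Z = piter par n u0) /\ a 1%Z = c.
Proof.
  intros Hc Hch.
  set (ch := fun v => epsilon (inhabits v) (fun v' => par v' = v)).
  assert (Hsp : forall v, (exists v', par v' = v) -> par (ch v) = v)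
    by (intros v Hv; exact (epsilon_spec (inhabits v) _ Hv)).
  set (b := fun d => Nat.iter d ch c).
  assert (Hb : forall d, piter par d (b d) = c /\ par (b (S d)) = b d).
  { induction d as [|d [IH1 IH2]].
    - split; auto. apply (Hsp c), (Hch 0%nat). reflexivity.
    - assert (H1 : piter par (S d) (b (S d)) = c) 
        by (change (piter par d (par (b (S d))) = c); now rewrite IH2).
      split; auto. apply (Hsp (b (S d))). now apply (Hch (S d)). }
  exists (fun n => if Z_le_dec n 0 then piter par (Z.to_nat (- n)) u0 else b (Z.to_nat (n - 1))).
  split; [|split; auto].
  - intro n. destruct (Z_le_dec n 0) as [H|H], (Z_le_dec (n - 1) 0) as [H'|H']; try lia.
    + rewrite <- piter_S. f_equal; lia.
    + replace n with 1%Z by lia. exact Hc.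
    + replace (Z.to_nat (n - 1)) with (S (Z.to_nat (n - 1 - 1))) by lia. apply Hb.
  - intro n. destruct Z_le_dec; [f_equal; lia|lia].
Qed.

Lemma chain_upper (a : Z -> V) c d v : par c = u0 -> (forall n, par (a n) = a (n - 1)%Z) ->
  a 1%Z = c -> piter par d v = c -> v = a (Z.of_nat d + 1)%Z.
Proof.
  intros Hc Ha H1 Hd. apply (branch_unique par u0 c1 c2 F d c); auto.
  rewrite piter_chain by auto. rewrite <- H1. f_equal; lia.
Qed.

Lemma one_leaf_iso l dl : (forall v, par v <> l) -> piter par dl l = c2 ->
  (forall d v, piter par d v = c1 -> exists v', par v' = v) ->
  exists phi : MV (S dl) -> V,
    (forall w w', phi w = phi w' -> w = w') /\ (forall v, exists w, phi w = v) /\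
    (forall w, par (phi w) = phi (parM w)).
Proof.
  intros Hl Hdl Hch.
  pose proof (fk_c1 _ _ _ _ F) as Hc1. pose proof (fk_c2 _ _ _ _ F) as Hc2.
  destruct (branch_chain c1 Hc1 Hch) as (a & Ha & Ha0 & Ha1).
  destruct (chain_intro a Ha) as [Hinj _].
  (* The finite branch is listed as ancestors of its leaf, so no child has to be chosen. It has
     [S dl] vertices, [dl] being the number of steps from [c2] to the leaf. *)
  set (phi := fun w : MV (S dl) => match w with
    | inl n => a n
    | inr p => piter par (dl - proj1_sig p) l end).
  assert (Hr : forall p, piter par (proj1_sig p) (phi (inr p)) = c2).
  { intros [k Hk]; simpl. rewrite <- piter_add, <- Hdl. f_equal; lia. }
  assert (Hlr : forall n p, phi (inl n) <> phi (inr p)).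
  { intros n p E. pose proof (Hr p) as H. rewrite <- E in H. simpl in H.
    destruct (Z.le_gt_cases n 0) as [Hn|Hn].
    - apply (branch_not_trunk c2 _ (Z.to_nat (- n)) _ Hc2 H). rewrite <- Ha0. f_equal; lia.
    - apply (branch_disjoint (Z.to_nat (n - 1)) (proj1_sig p) (a n)); auto.
      rewrite piter_chain, <- Ha1 by auto. f_equal; lia. }
  exists phi. split; [|split].
  - intros [n|p] [n'|p'] E.
    + f_equal; now apply Hinj.
    + now apply Hlr in E.
    + symmetry in E. now apply Hlr in E.
    + f_equal. apply sig_lt_eq. simpl in E. apply (piter_inj par u0 c1 c2 F) in E.
      pose proof (proj2_sig p). pose proof (proj2_sig p'). simpl in *. lia.
  - intro v. destruct (vertex_cases par u0 c1 c2 F v) as [[n E]|[d [E|E]]].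
    + exists (inl (- Z.of_nat n)%Z). simpl. now rewrite Ha0, E.
    + exists (inl (Z.of_nat d + 1)%Z). simpl. symmetry. now apply (chain_upper a c1).
    + assert (Hd : (d < S dl)%nat).
      { apply Nat.lt_succ_r. now apply (leaf_depth c2 l dl d v). }
      exists (inr (exist _ d Hd)). apply (branch_unique par u0 c1 c2 F d c2); auto.
      exact (Hr (exist _ d Hd)).
  - intros [n|[[|k] Hk]]; simpl; auto.
    + rewrite Nat.sub_0_r, Hdl, Hc2. symmetry. exact (Ha0 0%nat).
    + rewrite <- piter_S. f_equal; lia.
Qed.

Context (lam : V -> R) (Hpos : forall v, 0 < lam v).

(** After division by [K] the shift is a contraction. Both branches being finite, whatever reaches
    the fork disappears after boundedly many steps, so the decay bound may be taken as 1 up to time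
    [D] and 0 afterwards. *)
Lemma finite_branches_cyclic l1 l2 d1 d2 K : 0 < K -> blin (wshift par lam) K ->
  (forall u l, NoDup l -> (forall v, In v l -> par v = u) ->
     sumR (fun v => lam v * lam v) l <= K * K) ->
  (forall v, par v <> l1) -> (forall v, par v <> l2) ->
  piter par d1 l1 = c1 -> piter par d2 l2 = c2 -> cyclic (wshift par lam).
Proof.
  intros HK HT Hsum Hl1 Hl2 Hd1 Hd2.
  pose proof (fk_c1 _ _ _ _ F) as Hc1. pose proof (fk_c2 _ _ _ _ F) as Hc2.
  set (lam' := fun v => lam v / K).
  assert (HiK : 0 < / K) by now apply Rinv_0_lt_compat.
  assert (Hpos' : forall v, 0 < lam' v) by (intro; now apply Rdiv_lt_0_compat).
  assert (HT' : blin (wshift par lam') 1).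
  { apply wshift_blin; [lra|]. intros u l Hn Hl.
    rewrite (sumR_ext _ (fun v => / K * / K * (lam v * lam v)))
      by (intros; unfold lam', Rdiv; ring).
    rewrite sumR_scal. apply Rle_trans with (/ K * / K * (K * K)).
    - apply Rmult_le_compat_l; [nra|eauto].
    - right; field; lra. }
  apply (cyclic_of_scaled (wshift par lam) (wshift par lam') (RtoC (/ K)) K HT).
  { intro x. apply functional_extensionality; intro v. unfold wshift, vscale, lam', Rdiv.
    rewrite RtoC_mul. ring. }
  assert (Hlam' : forall v, 0 < lam' v <= 1) by (intro; now apply wshift_weight_le with par).
  set (D := (d1 + d2 + 1)%nat).
  assert (Hdeep : forall d v, (D < d)%nat -> piter par d v <> u0).
  { intros d v Hd E. replace d with (S (d - 1)) in E by (unfold D in *; lia).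
    rewrite piter_S in E. destruct (fk_fork _ _ _ _ F _ E) as [E'|E'].
    - pose proof (leaf_depth c1 l1 d1 _ v Hc1 Hl1 Hd1 E'). unfold D in *; lia.
    - pose proof (leaf_depth c2 l2 d2 _ v Hc2 Hl2 Hd2 E'). unfold D in *; lia. }
  set (tau := fun d => if le_lt_dec d D then 1 else 0).
  assert (Hnle : forall u d, (forall v, (D < d)%nat -> piter par d v <> u) ->
     nle (Nat.iter d (wshift par lam') (delta u)) (tau d)).
  { intros u d Hu. unfold tau. destruct (le_lt_dec d D) as [Hd|Hd].
    - rewrite <- (Rmult_1_r 1), <- (pow1 d) at 1.
      apply (blin_bound _ _ (blin_iter _ _ d HT')), nle_delta.
    - replace (Nat.iter d (wshift par lam') (delta u)) with (@vzero V); [apply nle_zero|].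
      apply functional_extensionality; intro v. rewrite wshift_iter, delta_other by auto.
      unfold vzero; ring. }
  apply (forked_cyclic par u0 c1 c2 lam' tau); auto.
  - intros m n Hmn. unfold tau. destruct (le_lt_dec n D), (le_lt_dec m D); lra || lia.
  - intro d. apply Hnle. intros v Hd E. apply (Hdeep (S d) v); [lia|]. now rewrite piter_S, E.
  - intros j e He. exists (D + j + 2)%nat. intros k Hk. unfold tau.
    destruct le_lt_dec as [Hle|_].
    + exfalso. assert (k - 1 < 2 ^ (k - 1))%nat by (apply Nat.pow_gt_lin_r; lia). lia.
    + apply Rmult_le_pos; [lra|]. left.
      apply Rmult_lt_0_compat; [now apply alpha_pos|now apply wprod_pos].
Qed.

(** [q n] is the norm of the n-th iterate of [delta c]. It decreases in [n], and class C1. forbids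
    the limit 0. At negative indices [cumw] is the reciprocal of a product of weights at most 1,
    hence at least 1. *)
Lemma chain_lower (a : Z -> V) c : par c = u0 -> (forall v, lam v <= 1) ->
  class_C1dot (wshift par lam) -> (forall n, par (a n) = a (n - 1)%Z) -> a 1%Z = c ->
  exists d, 0 < d /\ forall n, d <= cumw (fun n => lam (a n)) n.
Proof.
  intros Hc Hle HC1 Ha Ha1.
  assert (Hlam : forall v, 0 < lam v <= 1) by auto.
  set (q := fun n => wprod par lam n (a (Z.of_nat n + 1)%Z)).
  assert (Hq : forall n, 0 < q n) by (intro; now apply wprod_pos).
  assert (Hanti : forall m n, (m <= n)%nat -> q n <= q m).
  { intros m n H. induction H; [lra|]. apply Rle_trans with (q m0); auto.
    assert (E : q (S m0) = lam (a (Z.of_nat (S m0) + 1)%Z) *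
      wprod par lam m0 (par (a (Z.of_nat (S m0) + 1)%Z))) by reflexivity.
    rewrite Ha in E. replace (Z.of_nat (S m0) + 1 - 1)%Z with (Z.of_nat m0 + 1)%Z in E by lia.
    fold (q m0) in E. rewrite E. pose proof (Hq m0).
    pose proof (Hlam (a (Z.of_nat (S m0) + 1)%Z)). nra. }
  destruct (classic (exists e, 0 < e /\ forall n, e <= q n)) as [(e & He & Hqe)|Hno].
  - exists (e * lam c). pose proof (Hlam c) as Hlc.
    assert (He1 : e <= 1) by exact (Hqe 0%nat).
    split; [nra|]. intro n. unfold cumw. destruct (Z_le_dec 0 n) as [Hn|Hn].
    + rewrite wprod_chain by auto. destruct (Z.to_nat n) as [|m] eqn:Em; [simpl; nra|].
      replace (S m) with (m + 1)%nat by lia. rewrite wprod_add. simpl wprod at 2.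
      rewrite Rmult_1_r, piter_chain by auto.
      replace (n - Z.of_nat m)%Z with 1%Z by lia. rewrite Ha1.
      replace n with (Z.of_nat m + 1)%Z by lia. apply Rmult_le_compat_r; [lra|apply Hqe].
    + rewrite wprod_chain by auto.
      apply Rle_trans with 1; [nra|]. rewrite <- Rinv_1.
      apply Rinv_le_contravar; [now apply wprod_pos|now apply wprod_le1].
  - exfalso. assert (E : delta c c = C0).
    { apply (HC1 (delta c) (delta_l2 c)). intros eps He.
      destruct (classic (exists n, q n < sqrt eps)) as [[N HN]|Hn].
      - exists N. intros n Hn.
        rewrite (wshift_delta_unique par lam n c (a (Z.of_nat n + 1)%Z)).
        + fold (q n).
          assert (Hqn : nle (vscale (RtoC (q n)) (delta (a (Z.of_nat n + 1)%Z))) (sqrt eps)).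
          { pose proof (Hanti N n Hn). pose proof (Hq n).
            apply nle_mono with (q n * 1); [lra|]. apply nle_vscale; [lra| |apply nle_delta].
            rewrite Cnorm2_RtoC; lra. }
          destruct Hqn as [_ Hqn]. rewrite sqrt_sqrt in Hqn by lra. exact Hqn.
        + rewrite piter_chain, <- Ha1 by auto. f_equal; lia.
        + intros v' Hv'. now apply (chain_upper a c).
      - exfalso. apply Hno. exists (sqrt eps). split; [now apply sqrt_lt_R0|]. intro n.
        destruct (Rle_or_lt (sqrt eps) (q n)); auto. exfalso; eauto. }
    rewrite delta_same in E. apply (f_equal fst) in E. simpl in E. lra.
Qed.

Lemma C1dot_not_cyclic : (forall v, lam v <= 1) ->
  class_C1dot (wshift par lam) -> ~ cyclic (wshift par lam).
Proof.
  intros Hle HC1.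
  pose proof (fk_c1 _ _ _ _ F) as Hc1. pose proof (fk_c2 _ _ _ _ F) as Hc2.
  (* The basis vector of a leaf is killed by the shift, which class C1. excludes. *)
  assert (Hch : forall u, exists v, par v = u).
  { intro u. destruct (classic (exists v, par v = u)) as [|Hno]; auto. exfalso.
    assert (E : delta u u = C0).
    { apply (HC1 (delta u) (delta_l2 u)). intros eps He. exists 1%nat. intros n Hn.
      replace (Nat.iter n (wshift par lam) (delta u)) with (@vzero V).
      - eapply nsq_le_mono; [|apply nle_zero]. lra.
      - apply functional_extensionality; intro v. rewrite wshift_iter, delta_other.
        + unfold vzero; ring.
        + replace n with (S (n - 1)) by lia. rewrite piter_S. eauto. }
    rewrite delta_same in E. apply (f_equal fst) in E. simpl in E. lra. }
  destruct (branch_chain c1 Hc1) as (a & Ha & Ha0 & Ha1); [auto|].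
  destruct (branch_chain c2 Hc2) as (b & Hb & Hb0 & Hb1); [auto|].
  destruct (chain_lower a c1 Hc1 Hle HC1 Ha Ha1) as (d & Hd & Hda).
  destruct (chain_lower b c2 Hc2 Hle HC1 Hb Hb1) as (d' & Hd' & Hdb).
  apply (two_chains_not_cyclic par lam Hpos a b (Rmin d d')).
  - now apply chain_intro.
  - now apply chain_intro.
  - intros n Hn. replace n with (- Z.of_nat (Z.to_nat (- n)))%Z by lia. now rewrite Ha0, Hb0.
  - intros n m Hn E.
    assert (H1 : piter par (Z.to_nat (n - 1)) (a n) = c1).
    { rewrite piter_chain, <- Ha1 by auto. f_equal; lia. }
    destruct (Z.le_gt_cases m 0) as [Hm|Hm].
    + apply (branch_not_trunk c1 _ (Z.to_nat (- m)) _ Hc1 H1). rewrite E, <- Hb0. f_equal; lia.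
    + apply (branch_disjoint _ (Z.to_nat (m - 1)) _ H1).
      rewrite E, piter_chain, <- Hb1 by auto. f_equal; lia.
  - now apply Rmin_glb_lt.
  - intro n. eapply Rle_trans; [apply Rmin_l|apply Hda].
  - intro n. eapply Rle_trans; [apply Rmin_r|apply Hdb].
Qed.

End Branches.

(** * Trees and the example *)

Section Tree.
Context {V : Type} (E : V -> V -> Prop) (Htree : directed_tree E) (Hroot : rootless E).
Let par := par_of E Hroot.

Lemma E_par u v : E u v <-> par v = u.
Proof.
  destruct Htree as (_ & _ & Huniq & _).
  assert (H : E (par v) v)
    by (unfold par, par_of; now destruct constructive_indefinite_description).
  split; [intro Hu; eauto|now intros <-].
Qed.

Lemma tree_acyclic n v : piter par (S n) v <> v.
Proof.
  intro Ev. destruct Htree as (_ & _ & _ & Hac).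
  assert (H : forall n v, clos_trans V E (piter par (S n) v) v).
  { clear n v Ev. induction n; intro v.
    - apply t_step. now apply E_par.
    - eapply t_trans; [exact (IHn (par v))|]. apply t_step. now apply E_par. }
  specialize (H n v). rewrite Ev in H. exact (Hac v H).
Qed.

Lemma tree_connected u v : exists m n, piter par m v = piter par n u.
Proof.
  destruct Htree as (_ & Hconn & _). specialize (Hconn v u).
  induction Hconn as [a b [H|H]|a|a b c _ (m & n & IH1) _ (m' & n' & IH2)].
  - exists 0%nat, 1%nat. simpl. symmetry. now apply E_par.
  - exists 1%nat, 0%nat. simpl. now apply E_par.
  - exists 0%nat, 0%nat. reflexivity.
  - exists (m + m')%nat, (n' + n)%nat.
    rewrite piter_add, IH1, <- piter_add, Nat.add_comm, piter_add, IH2, <- piter_add. reflexivity.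
Qed.

Lemma tree_forked : branching_index_one E -> exists u0 c1 c2, forked par u0 c1 c2.
Proof.
  intros (u0 & (l & Hl & Hlen & Hin) & Hone).
  destruct l as [|c1 [|c2 [|]]]; try discriminate.
  exists u0, c1, c2. constructor.
  - apply tree_acyclic.
  - apply tree_connected.
  - intros v v' Hv Hu. destruct (classic (v = v')) as [|Hne]; auto. exfalso.
    specialize (Hone (par v) Hu [v; v']). simpl in Hone.
    assert (2 <= 1)%nat; [|lia]. apply Hone.
    + constructor; [intros [->|[]]; auto|]. constructor; [easy|constructor].
    + intros w [<-|[<-|[]]]; apply E_par; auto.
  - apply E_par, Hin. now left.
  - apply E_par, Hin. right; now left.
  - inversion Hl; subst. intros ->. apply H1. now left.
  - intros v Hv. apply E_par, Hin in Hv. destruct Hv as [->|[->|[]]]; auto.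
Qed.

Lemma tree_bounded lam : bounded_weights E lam -> exists K, 0 < K /\
  forall u l, NoDup l -> (forall v, In v l -> par v = u) ->
     sumR (fun v => lam v * lam v) l <= K * K.
Proof.
  intros [M HM]. exists (sqrt (Rabs M) + 1).
  pose proof (sqrt_pos (Rabs M)). split; [lra|]. intros u l Hn Hl.
  apply Rle_trans with M; [apply HM with u; auto; intros v Hv; apply E_par; auto|].
  pose proof (Rle_abs M). pose proof (sqrt_sqrt (Rabs M) (Rabs_pos M)). nra.
Qed.

Lemma leaf_par l : leaf E l <-> forall v, par v <> l.
Proof.
  split; intros H v Hv; apply (H v); now apply E_par.
Qed.

Lemma iso_par k0 (phi : MV k0 -> V) : graph_iso (Em k0) E phi <->
  (forall w w', phi w = phi w' -> w = w') /\ (forall v, exists w, phi w = v) /\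
  (forall w, par (phi w) = phi (parM w)).
Proof.
  split; intros (H1 & H2 & H3); repeat split; auto.
  - intro w. apply E_par, H3, Em_parM. reflexivity.
  - intro H. apply Em_parM. apply H1. rewrite <- H3. now apply E_par.
  - intro H. apply E_par. rewrite H3. f_equal. now apply Em_parM.
Qed.

End Tree.

Lemma contraction_blin {V : Type} (par : V -> V) lam :
  contraction (wshift par lam) -> blin (wshift par lam) 1.
Proof.
  intro H. constructor.
  - intros; vext. unfold wshift. ring.
  - intros; vext. unfold wshift. ring.
  - lra.
  - intros x r [Hr Hx]. rewrite Rmult_1_l. split; auto. apply H; auto. now exists (r * r).
Qed.

(** * A cyclic shift on the tree with two infinite branches *)

Definition lamT (v : VT) : R :=
  match v with
  | inl n => if Z_le_dec n 0 then 1 else (1 / 2) ^ Z.to_nat n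
  | inr k => (1 / 2) ^ S k
  end.

(** The power of 1/2 with exponent [d (d + 1) / 2]. The weights are 1 on the trunk, so this sequence
    is [alpha], and up to a factor 2 it also bounds the orbits on the branches; the latter are
    evaluated near [2 ^ (k - 1)] and thus win over [alpha k]. *)
Fixpoint half_tri (d : nat) : R :=
  match d with O => 1 | S d' => half_tri d' * (1 / 2) ^ d end.

Lemma lamT_bounds v : 0 < lamT v <= 1.
Proof.
  destruct v as [n|k]; unfold lamT; [destruct Z_le_dec; [lra|]|]; apply half_pow_bounds.
Qed.

Lemma ET_parT u v : ET u v <-> parT v = u.
Proof.
  destruct u as [i|i], v as [j|[|j]]; simpl; split; intro H; try easy.
  - now subst.
  - now injection H.
  - destruct H as [-> _]. reflexivity.
  - injection H as <-. auto.
  - f_equal; lia.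
  - injection H as <-. reflexivity.
Qed.

Lemma children_T u : (exists v, forall w, parT w = u -> w = v) \/
  u = inl 0%Z /\ forall w, parT w = u -> w = inr 0%nat \/ w = inl 1%Z.
Proof.
  destruct u as [i|i].
  - destruct (Z.eq_dec i 0) as [->|Hi].
    + right. split; auto. intros [j|[|j]] H; simpl in H; try discriminate.
      * injection H as H. right. f_equal; lia.
      * now left.
    + left. exists (inl (i + 1)%Z). intros [j|[|j]] H; simpl in H; try discriminate.
      * injection H as H. f_equal; lia.
      * injection H as H. congruence.
  - left. exists (inr (S i)). intros [j|[|j]] H; simpl in H; try discriminate.
    injection H as H. congruence.
Qed.

Lemma lamT_children u l : NoDup l -> (forall v, In v l -> parT v = u) ->
  sumR (fun v => lamT v * lamT v) l <= 1 * 1.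
Proof.
  intros Hl Hu. assert (Hsq : forall v, 0 <= lamT v * lamT v) by (intro; apply Rle_0_sqr).
  destruct (children_T u) as [[v Hv]|[-> Hv]].
  - apply Rle_trans with (sumR (fun v => lamT v * lamT v) [v]).
    + apply sumR_incl; auto. intros w Hw. left. symmetry; auto.
    + simpl. pose proof (lamT_bounds v). nra.
  - apply Rle_trans with (sumR (fun v => lamT v * lamT v) [inr 0%nat; inl 1%Z]).
    + apply sumR_incl; auto. intros w Hw. destruct (Hv w (Hu w Hw)) as [-> | ->]; simpl; auto.
    + simpl. lra.
Qed.

Lemma forkedT : forked parT (inl 0%Z) (inr 0%nat) (inl 1%Z).
Proof.
  (* The height drops by one from a vertex to its parent, which rules out cycles. *)
  set (lev := fun v : VT => match v with inl n => n | inr k => (Z.of_nat k + 1)%Z end).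
  assert (Hlev : forall v, lev (parT v) = (lev v - 1)%Z).
  { intros [n|[|k]]; unfold parT, lev; lia. }
  assert (Hlevn : forall n v, lev (piter parT n v) = (lev v - Z.of_nat n)%Z).
  { induction n; intro v; simpl piter; [lia|]. rewrite IHn, Hlev. lia. }
  assert (Hinl : forall n j, piter parT n (inl j) = inl (j - Z.of_nat n)%Z).
  { induction n; intro j; simpl piter; [f_equal; lia|]. rewrite IHn. f_equal; lia. }
  assert (Hinr : forall k, piter parT (S k) (inr k) = inl 0%Z).
  { induction k; auto. }
  constructor; auto.
  - intros n v Ev. apply (f_equal lev) in Ev. rewrite Hlevn in Ev. lia.
  - intros [j|k].
    + exists (Z.to_nat j), (Z.to_nat (- j)). rewrite !Hinl. f_equal; lia.
    + exists (S k), 0%nat. apply Hinr.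
  - intros v v' Hv Hu. destruct (children_T (parT v)) as [[w Hw]|[Hw _]]; [|easy].
    rewrite (Hw v), (Hw v'); auto.
  - discriminate.
  - intros v Hv. destruct (children_T (inl 0%Z)) as [[w Hw]|[_ Hw]]; auto.
    assert (@inr Z nat 0%nat = inl 1%Z); [|discriminate]. rewrite (Hw (inr 0%nat)), (Hw (inl 1%Z)); auto.
Qed.

Lemma half_tri_pos d : 0 < half_tri d.
Proof.
  induction d; cbn [half_tri]; [lra|]. pose proof (half_pow_bounds (S d)). nra.
Qed.

Lemma half_tri_step d : half_tri (S d) <= half_tri d.
Proof.
  cbn [half_tri]. pose proof (half_pow_bounds (S d)). pose proof (half_tri_pos d). nra.
Qed.

Lemma half_tri_antitone m n : (m <= n)%nat -> half_tri n <= half_tri m.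
Proof. intro H; induction H; [lra|]. pose proof (half_tri_step m0). lra. Qed.

Lemma wprod_trunkT n j : (j <= 0)%Z -> wprod parT lamT n (inl j) = 1.
Proof.
  revert j; induction n; intros j Hj; auto.
  change (lamT (inl j) * wprod parT lamT n (inl (j - 1)%Z) = 1). rewrite IHn by lia.
  unfold lamT. destruct Z_le_dec; [ring|lia].
Qed.

Lemma alphaT k : alpha parT (inl 0%Z) lamT k = half_tri k.
Proof. induction k; cbn [alpha half_tri]; auto. rewrite IHk, wprod_trunkT by lia. ring. Qed.

Lemma shiftT_inr k : wshift parT lamT (delta (inr k)) =
  vscale (RtoC ((1 / 2) ^ S (S k))) (delta (inr (S k))).
Proof.
  refine (eq_trans (wshift_delta_unique parT lamT 1 (inr k) (inr (S k)) _ _) _); auto.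
  2: simpl; now rewrite Rmult_1_r.
  intros [j|[|j]] H; simpl in H; congruence.
Qed.

Lemma shiftT_inl d : wshift parT lamT (delta (inl (Z.of_nat (S d)))) =
  vscale (RtoC ((1 / 2) ^ S (S d))) (delta (inl (Z.of_nat (S (S d))))).
Proof.
  refine (eq_trans (wshift_delta_unique parT lamT 1 _ (inl (Z.of_nat (S (S d)))) _ _) _).
  3:{ cbn [wprod]. unfold lamT. destruct Z_le_dec; [lia|]. rewrite Nat2Z.id, Rmult_1_r. reflexivity. }
  - cbn [piter parT]. f_equal; lia.
  - intros [j|[|j]] H; cbn [piter parT] in H;
      [injection H as H; f_equal; lia|injection H as H; lia|discriminate].
Qed.

Lemma shiftT_fork : wshift parT lamT (delta (inl 0%Z)) =
  vscale (RtoC (1 / 2)) (vadd (delta (inl 1%Z)) (delta (inr 0%nat))).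
Proof.
  apply functional_extensionality; intro v. unfold wshift, vscale, vadd.
  destruct (excluded_middle_informative (v = inl 1%Z)) as [->|H1].
  - change (parT (inl 1%Z)) with (@inl Z nat 0%Z). rewrite !delta_same, delta_other by discriminate.
    cdestr; f_equal; ring.
  - rewrite (delta_other (inl 1%Z) v) by auto.
    destruct (excluded_middle_informative (v = inr 0%nat)) as [->|H2].
    + rewrite !delta_same. cdestr; f_equal; ring.
    + rewrite !delta_other; [ring|auto|]. intro H.
      destruct v as [j|[|j]]; simpl in H; try congruence. injection H as H. apply H1. f_equal; lia.
Qed.

(** The factor 2 appears because an orbit starting at 1' does not pick up the weight 1/2 of 1'
    itself. *)
Lemma orbitT_branch d : Nat.iter d (wshift parT lamT) (delta (inr 0%nat)) =
  vscale (RtoC (2 * half_tri (S d))) (delta (inr d)).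
Proof.
  assert (HT : blin (wshift parT lamT) 1) by (apply wshift_blin; [lra|apply lamT_children]).
  induction d.
  - simpl. vext. replace (RtoC _) with (RtoC 1) by (f_equal; lra). ring.
  - rewrite Nat.iter_succ, IHd, (blin_scale _ _ HT), shiftT_inr.
    cbn [half_tri]. rewrite !RtoC_mul. vext.
Qed.

Lemma orbitT_fork d : Nat.iter (S d) (wshift parT lamT) (delta (inl 0%Z)) =
  vscale (RtoC (half_tri (S d))) (vadd (delta (inl (Z.of_nat (S d)))) (delta (inr d))).
Proof.
  assert (HT : blin (wshift parT lamT) 1) by (apply wshift_blin; [lra|apply lamT_children]).
  induction d.
  - simpl Nat.iter. rewrite shiftT_fork. cbn [half_tri]. f_equal. f_equal. simpl; ring.
  - rewrite Nat.iter_succ, IHd, (blin_scale _ _ HT), (blin_add _ _ HT), shiftT_inr, shiftT_inl.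
    cbn [half_tri]. rewrite !RtoC_mul. vext.
Qed.

Lemma pow2_ge_double k : (4 <= k)%nat -> (2 * k <= 2 ^ (k - 1))%nat.
Proof.
  intro H. induction H; [simpl; lia|].
  replace (S m - 1)%nat with (S (m - 1)) by lia. rewrite Nat.pow_succ_r'. lia.
Qed.

Lemma lamT_cyclic : cyclic (wshift parT lamT).
Proof.
  assert (HT : blin (wshift parT lamT) 1) by (apply wshift_blin; [lra|apply lamT_children]).
  apply (forked_cyclic parT (inl 0%Z) (inr 0%nat) (inl 1%Z) lamT (fun d => 2 * half_tri d));
    auto using forkedT, lamT_bounds.
  - intros m n H. pose proof (half_tri_antitone m n H). lra.
  - intros [|d].
    + eapply nle_mono; [|apply nle_delta]. simpl; lra.
    + rewrite orbitT_fork. pose proof (half_tri_pos (S d)).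
      replace (2 * half_tri (S d)) with (half_tri (S d) * (1 + 1)) by ring.
      apply nle_vscale; [lra| |apply nle_vadd; apply nle_delta]. rewrite Cnorm2_RtoC; lra.
  - intro d. rewrite orbitT_branch. pose proof (half_tri_pos (S d)). pose proof (half_tri_step d).
    eapply nle_mono; [|apply (nle_vscale _ _ 1 (2 * half_tri (S d)))]; [lra|lra| |apply nle_delta].
    rewrite Cnorm2_RtoC; lra.
  - intros j e He.
    destruct (pow_lt_1_zero (1 / 2)) with (y := e) as [N HN];
      [rewrite Rabs_right; lra|lra|].
    (* From here [2 ^ (k - 1) - j >= 2 k - j >= k + 1], and [2 * half_tri (S k)] equals
       [half_tri k * (1 / 2) ^ k]. *)
    exists (N + j + 4)%nat. intros k Hk. rewrite alphaT, wprod_trunkT, Rmult_1_r by lia.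
    pose proof (pow2_ge_double k ltac:(lia)).
    apply Rle_trans with (2 * half_tri (S k)).
    + apply Rmult_le_compat_l; [lra|]. apply half_tri_antitone. lia.
    + cbn [half_tri pow]. specialize (HN k ltac:(lia)). pose proof (half_pow_bounds k).
      rewrite Rabs_right in HN by lra. pose proof (half_tri_pos k). nra.
Qed.

Theorem mainTheorem17 (V : Type) (E : V -> V -> Prop)
  (Htree : directed_tree E) (Hroot : rootless E) (HBr : branching_index_one E)
  (lam : V -> R) (Hpos : forall v, 0 < lam v) (Hbdd : bounded_weights E lam) :
  let S := wshift (par_of E Hroot) lam in
  (* (i) *)
  (card_eq (leaf E) 2 -> cyclic S) /\
  (* (ii) *)
  (card_eq (leaf E) 1 ->
     (exists (k0 : nat) (phi : MV k0 -> V), graph_iso (Em k0) E phi) /\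
     (forall (k0 : nat) (phi : MV k0 -> V), graph_iso (Em k0) E phi ->
        (cyclic S <->
         cyclic (wshift (fun n : Z => (n - 1)%Z) (fun n : Z => lam (phi (inl n)))))) /\
     (contraction S -> ~ class_Cdot0 S -> cyclic S)) /\
  (* (iii) *)
  (contraction S -> class_C1dot S -> ~ cyclic S) /\
  (* (iv) *)
  (exists lamt : VT -> R,
     (forall v, 0 < lamt v) /\ bounded_weights ET lamt /\ cyclic (wshift parT lamt)).
Proof.
  intro S. set (par := par_of E Hroot) in *.
  destruct (tree_forked E Htree Hroot HBr) as (u0 & c1 & c2 & F). fold par in F.
  destruct (tree_bounded E Htree Hroot lam Hbdd) as (K & HK & HKs). fold par in HKs.
  assert (HS : blin S K) by (apply wshift_blin; auto; lra).
  assert (Hleaf : forall l, leaf E l <-> forall v, par v <> l) by apply (leaf_par E Htree Hroot).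
  split; [|split; [|split]].
  - intros (l & Hn & Hlen & Hl). destruct l as [|l1 [|l2 [|]]]; try discriminate.
    assert (H1 : forall v, par v <> l1) by (apply Hleaf, Hl; now left).
    assert (H2 : forall v, par v <> l2) by (apply Hleaf, Hl; right; now left).
    assert (Hne : l1 <> l2) by (inversion Hn; subst; intros ->; apply H3; now left).
    destruct (leaf_in_branch par u0 c1 c2 F l1 H1) as [d1 D1].
    destruct (leaf_in_branch par u0 c1 c2 F l2 H2) as [d2 D2].
    pose proof (fk_c1 _ _ _ _ F) as Hc1. pose proof (fk_c2 _ _ _ _ F) as Hc2.
    pose proof (leaves_same_branch par u0 c1 c2 F) as Hsame.
    destruct D1 as [D1|D1], D2 as [D2|D2].
    + elim Hne. eapply (Hsame c1); eauto.
    + exact (finite_branches_cyclic par u0 c1 c2 F lam Hpos l1 l2 d1 d2 K HK HS HKs H1 H2 D1 D2).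
    + exact (finite_branches_cyclic par u0 c1 c2 F lam Hpos l2 l1 d2 d1 K HK HS HKs H2 H1 D2 D1).
    + elim Hne. eapply (Hsame c2); eauto.
  - intros (l & Hn & Hlen & Hl). destruct l as [|l [|]]; try discriminate.
    assert (Hll : forall v, par v <> l) by (apply Hleaf, Hl; now left).
    assert (Hiso : exists (k0 : nat) (phi : MV k0 -> V), graph_iso (Em k0) E phi).
    (* The two children of the fork play symmetric roles; [c'] names the one whose branch ends in
       the leaf. *)
    { assert (Hex : forall c c', forked par u0 c c' -> (exists d, piter par d l = c') ->
        exists (k0 : nat) (phi : MV k0 -> V), graph_iso (Em k0) E phi).
      { intros c c' F' [dl Hdl]. exists (Datatypes.S dl).
        destruct (one_leaf_iso par u0 c c' F' l dl Hll Hdl) as (phi & Hphi).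
        - intros d v Hd. destruct (classic (exists v', par v' = v)) as [|Hno]; auto. exfalso.
          assert (Hv : leaf E v) by (apply Hleaf; intros v' Hv'; eauto).
          apply Hl in Hv as [<-|[]]. exact (branch_disjoint par u0 c c' F' d dl l Hd Hdl).
        - exists phi. now apply (iso_par E Htree Hroot). }
      destruct (leaf_in_branch par u0 c1 c2 F l Hll) as [d [D|D]].
      - apply (Hex c2 c1); eauto using forked_sym.
      - apply (Hex c1 c2); eauto. }
    assert (Hequiv : forall (k0 : nat) (phi : MV k0 -> V), graph_iso (Em k0) E phi ->
        (cyclic S <-> cyclic (wshift zpred (fun n : Z => lam (phi (inl n)))))).
    { intros k0 phi Hphi. apply (iso_par E Htree Hroot) in Hphi as (P1 & P2 & P3).
      destruct (cyclic_transport par parM lam phi K HS P1 P2 P3) as [HB HC].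
      unfold S. rewrite HC. split.
      - apply (cyclic_restrict (fun w => lam (phi w)) (fun w => Hpos (phi w)) K HB).
      - apply (cyclic_extend (fun w => lam (phi w)) (fun w => Hpos (phi w)) K HB). }
    split; [exact Hiso|]. split; [exact Hequiv|].
    intros Hcon HC0. destruct Hiso as (k0 & phi & Hphi).
    apply (Hequiv k0 phi Hphi). apply (iso_par E Htree Hroot) in Hphi as (P1 & P2 & P3).
    pose proof (contraction_blin par lam Hcon) as HB1.
    assert (Hlam : forall v, 0 < lam v <= 1) by (intro; now apply wshift_weight_le with par).
    (* By the equivalence only the spine matters, and the backward products starting at its vertex 0
       are products along the trunk. *)
    destruct (not_Cdot0_products par lam (phi (inl 0%Z)) Hlam HB1) as (d & Hd & Hdn); auto.
    { apply (tree_connected E Htree Hroot). }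
    apply (bilateral_cyclic _ d); auto. intro n.
    rewrite (wprod_chain par lam (fun n => phi (inl n))); auto.
  - intros Hcon. apply (C1dot_not_cyclic par u0 c1 c2 F lam Hpos).
    intro v. apply (wshift_weight_le par lam 1 v Hpos), contraction_blin, Hcon.
  - exists lamT. split; [apply lamT_bounds|]. split; [|apply lamT_cyclic].
    exists (1 * 1). intros u l Hn Hu. apply (lamT_children u); auto.
    intros v Hv. now apply ET_parT, Hu.
Qed.
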